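(* Let $\mathbb{K}$ be an algebraically closed field, let $n$ be an integer with $n+1>3$, and let $\mathcal{X}$ be a smooth plane curve over $\mathbb{K}$ of degree $n+1$, equipped with three points $P_1,P_2,P_3$ such that there are three distinct lines cutting out on $\mathcal{X}$ the divisors $nP_1+P_2$, $nP_2+P_3$ and $nP_3+P_1$, respectively. Then the set $G_0(P_1,P_2,P_3)$ of pure gaps of $\mathcal{X}$ at $(P_1,P_2,P_3)$ consists exactly of the triples $$(a,b,c)=\big(kn+j+r+1,\ in+k+s+1,\ jn+i+t+1\big),$$ with integers $i,j,k\ge 0$, $i+j+k=d\le n-3$ and $r,s,t\in\{0,\ldots,n-3-d\}$. Moreover, for such $(a,b,c)$, the Riemann-Roch spaces $\mathcal{L}(aP_1+bP_2+cP_3)$ and $\mathcal{L}((a-1)P_1+(b-1)P_2+(c-1)P_3)$ both have dimension $\frac{1}{2}(d+1)(d+2)$. In particular, the number of pure gaps at $(P_1,P_2,P_3)$ is $$\#G_0(P_1,P_2,P_3)=\frac{1}{30}(g-1)g(2g-1),$$ where $g$ is the genus of $\mathcal{X}$.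
   Context: For a divisor $D$ on $\mathcal{X}$, $\mathcal{L}(D)=\{f\in\mathbb{K}(\mathcal{X})^{*}:\operatorname{div}(f)\ge -D\}\cup\{0\}$ is its Riemann-Roch space. Let $\mathbb{N}_0$ be the set of nonnegative integers. For distinct points $Q_1,\ldots,Q_r\in\mathcal{X}$, an $r$-tuple $(n_1,\ldots,n_r)\in\mathbb{N}_0^r$ is a pure gap of $\mathcal{X}$ at $(Q_1,\ldots,Q_r)$ if $\mathcal{L}(\sum_{i=1}^r n_iQ_i)$ and $\mathcal{L}(\sum_{i=1}^r n_iQ_i-Q_j)$ have the same dimension for all $j=1,\ldots,r$; the set of pure gaps is denoted $G_0(Q_1,\ldots,Q_r)$. The divisor cut out on $\mathcal{X}$ by a line is the intersection divisor of the line with $\mathcal{X}$. *)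

(* Defs.v *)
From HB Require Import structures.
From mathcomp Require Import all_boot all_order all_algebra.
From mathcomp Require Import ring_quotient fraction.
From mathcomp Require Import boolp mpoly freeg.
Set Implicit Arguments.
Unset Strict Implicit.
Unset Printing Implicit Defensive.
Import Order.TTheory GRing.Theory Num.Theory.
Local Open Scope ring_scope.
Local Open Scope quotient_scope.

(* A point of the projective plane is given by its homogeneous coordinates,
   scaled so that the first nonzero one is 1; each point of P^2(K) has exactly
   one such representative, so equality of points is Leibniz equality. *)
Definition normalized (K : fieldType) (v : 'rV[K]_3) : bool :=
  [exists i : 'I_3, (v 0 i == 1) && [forall j : 'I_3, (j < i)%N ==> (v 0 j == 0)]].

Definition proj_plane (K : fieldType) : Type := {v : 'rV[K]_3 | normalized v}.
HB.instance Definition _ (K : fieldType) := Choice.on (proj_plane K).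

Definition coords (K : fieldType) (P : proj_plane K) : 'I_3 -> K :=
  fun i => val P 0 i.

(* Lines are points of the dual plane: u stands for the line
   u_0 X_0 + u_1 X_1 + u_2 X_2 = 0. *)
Definition line (K : fieldType) : Type := proj_plane K.
HB.instance Definition _ (K : fieldType) := Choice.on (line K).

Definition line_form (K : fieldType) (u : line K) : {mpoly K[3]} :=
  \sum_(i < 3) coords u i *: 'X_i.

Definition principal_ideal (K : fieldType) (F : {mpoly K[3]}) : {pred {mpoly K[3]}} :=
  fun A => `[< exists Q, A = Q * F >].

(* The homogeneous equation F of degree m generates a (proper) prime ideal, that
   is, the curve is integral; smoothness is the Jacobian criterion, tested at
   all homogeneous coordinate vectors of points of the curve. *)
Record smooth_plane_curve (K : closedFieldType) (m : nat) := SmoothPlaneCurve {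
  equation : {mpoly K[3]};
  equation_homog : equation \is m.-homog;
  equation_proper : 1 \notin principal_ideal equation;
  equation_prime : prime_idealr_closed (principal_ideal equation);
  equation_smooth : forall v : 'I_3 -> K, (exists i, v i != 0) ->
    equation.@[v] = 0 -> exists i, (mderiv i equation).@[v] != 0
}.

Section CurveAlgebra.
Context (K : closedFieldType) (m : nat) (X : smooth_plane_curve K m).

Definition ideal_of : {pred {mpoly K[3]}} := principal_ideal (equation X).

Lemma ideal_ofP A : reflect (exists Q, A = Q * equation X) (A \in ideal_of).
Proof. exact: asboolP. Qed.

Lemma ideal_of_closed : idealr_closed ideal_of.
Proof.
split; first by apply/ideal_ofP; exists 0; rewrite mul0r.
  exact: equation_proper.
move=> a u v /ideal_ofP[p ->] /ideal_ofP[q ->].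
by apply/ideal_ofP; exists (a * p + q); rewrite mulrDl mulrA.
Qed.

HB.instance Definition _ := isIdealr.Build {mpoly K[3]} ideal_of ideal_of_closed.
HB.instance Definition _ :=
  isPrimeIdealrClosed.Build {mpoly K[3]} ideal_of (@equation_prime K m X).

(* The homogeneous coordinate ring K[X_0, X_1, X_2] / (F). *)
Definition coord_ring : Type := {ideal_quot ideal_of}.
HB.instance Definition _ := GRing.ComNzRing.on coord_ring.
HB.instance Definition _ : EqQuotient _ (Quotient.equiv ideal_of) coord_ring :=
  EqQuotient.on coord_ring.

Definition coord_unit : {pred coord_ring} := fun x => `[< exists y, y * x = 1 >].

Definition coord_inv (x : coord_ring) : coord_ring :=
  if pselect (exists y, y * x = 1) is left ex then projT1 (cid ex) else x.

Lemma coord_mulVx : {in coord_unit, left_inverse 1 coord_inv *%R}.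
Proof.
move=> x /asboolP xU; rewrite /coord_inv; case: pselect => // ex.
by case: cid.
Qed.

Lemma coord_unitPl (x y : coord_ring) : y * x = 1 -> coord_unit x.
Proof. by move=> yx; apply/asboolP; exists y. Qed.

Lemma coord_inv_out : {in [predC coord_unit], coord_inv =1 id}.
Proof.
move=> x /asboolPn xU; rewrite /coord_inv.
by case: pselect.
Qed.

HB.instance Definition _ := GRing.ComNzRing_hasMulInverse.Build coord_ring
  coord_mulVx coord_unitPl coord_inv_out.

Lemma coord_ring_domain (x y : coord_ring) : x * y = 0 -> (x == 0) || (y == 0).
Proof. exact: Quotient.rquot_IdomainAxiom. Qed.

HB.instance Definition _ :=
  GRing.ComUnitRing_isIntegral.Build coord_ring coord_ring_domain.

Definition to_frac (A : {mpoly K[3]}) : {fraction coord_ring} :=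
  FracField.tofrac (\pi_{ideal_quot ideal_of} A : coord_ring).

Lemma to_fracB A B : to_frac (A - B) = to_frac A - to_frac B.
Proof. by rewrite /to_frac -tofracB; congr FracField.tofrac; rewrite rmorphB. Qed.

Lemma to_fracM A B : to_frac (A * B) = to_frac A * to_frac B.
Proof. by rewrite /to_frac -tofracM; congr FracField.tofrac; rewrite rmorphM. Qed.

Lemma to_frac1 : to_frac 1 = 1.
Proof. by rewrite /to_frac -tofrac1; congr FracField.tofrac; rewrite rmorph1. Qed.

HB.instance Definition _ :=
  GRing.isZmodMorphism.Build {mpoly K[3]} {fraction coord_ring} to_frac to_fracB.
HB.instance Definition _ :=
  GRing.isMonoidMorphism.Build {mpoly K[3]} {fraction coord_ring} to_frac
    (to_frac1, to_fracM).

Lemma to_frac_eq0 A : (to_frac A == 0) = (A \in ideal_of).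
Proof.
rewrite /to_frac tofrac_eq0 -[A in RHS](subr0 A) Quotient.idealrBE.
by congr (_ == _); rewrite rmorph0.
Qed.

(* K(X) is the field of degree-0 homogeneous fractions over X. *)
Definition is_rational (f : {fraction coord_ring}) : bool :=
  `[< exists d (G H : {mpoly K[3]}),
        [/\ G \is d.-homog, H \is d.-homog, H \notin ideal_of
          & f = to_frac G / to_frac H] >].

Lemma is_rational_divring : divring_closed is_rational.
Proof.
have ratM d e (A B : {mpoly K[3]}) : A \is d.-homog -> B \is e.-homog ->
  A * B \is (d + e)%N.-homog by exact: dhomogM.
have nM (A B : {mpoly K[3]}) : A \notin ideal_of -> B \notin ideal_of ->
  A * B \notin ideal_of.
  by move=> hA hB; rewrite prime_idealrM negb_or hA.
split.
- apply/asboolP; exists 0%N, 1, 1; rewrite !dhomog1; split=> //.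
    exact: equation_proper.
  by rewrite to_frac1 divr1.
- move=> _ _ /asboolP[d [G [H [Gd Hd H0 ->]]]] /asboolP[e [G' [H' [Gd' Hd' H0' ->]]]].
  apply/asboolP; exists (d + e)%N, (G * H' - G' * H), (H * H'); split.
  + by apply: rpredB; [exact: ratM|rewrite addnC; exact: ratM].
  + exact: ratM.
  + exact: nM.
  + rewrite to_fracB !to_fracM -(mulNr (to_frac G')) addf_div ?to_frac_eq0 //.
    by rewrite mulNr.
- move=> _ _ /asboolP[d [G [H [Gd Hd H0 ->]]]] /asboolP[e [G' [H' [Gd' Hd' H0' ->]]]].
  apply/asboolP; have [G0|G0] := boolP (G' \in ideal_of).
    exists 0%N, 0, 1; rewrite dhomog0 dhomog1; split=> //.
      exact: equation_proper.
    by move: G0; rewrite -to_frac_eq0 => /eqP->; rewrite mul0r invr0 mulr0 rmorph0 mul0r.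
  exists (d + e)%N, (G * H'), (H * G'); split; [exact: ratM|exact: ratM|exact: nM|].
  by rewrite !to_fracM invf_div mulf_div.
Qed.

HB.instance Definition _ :=
  GRing.isDivringClosed.Build {fraction coord_ring} is_rational is_rational_divring.

Record function_field : Type := FunctionField {
  ff_val :> {fraction coord_ring};
  _ : is_rational ff_val
}.
HB.instance Definition _ := [isSub for ff_val].
HB.instance Definition _ := [Choice of function_field by <:].
HB.instance Definition _ := [SubChoice_isSubComNzRing of function_field by <:].

Lemma is_rational_inv (f : function_field) : is_rational (ff_val f)^-1.
Proof. by rewrite [is_rational _]rpredV; exact: valP f. Qed.

Definition ff_inv (f : function_field) : function_field :=
  FunctionField (is_rational_inv f).

Lemma ff_mulVf f : f != 0 -> ff_inv f * f = 1.
Proof.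
rewrite -(inj_eq val_inj) => f0; apply: val_inj.
by rewrite rmorphM rmorph1 /= mulVf // -(rmorph0 (ff_val : _ -> {fraction coord_ring})).
Qed.

Lemma ff_inv0 : ff_inv 0 = 0.
Proof. by apply: val_inj; rewrite /= invr0. Qed.

HB.instance Definition _ := GRing.ComNzRing_isField.Build function_field ff_mulVf ff_inv0.

HB.instance Definition _ :=
  GRing.isZmodMorphism.Build function_field {fraction coord_ring} ff_val
    (rmorphB (val : function_field -> {fraction coord_ring})).
HB.instance Definition _ :=
  GRing.isMonoidMorphism.Build function_field {fraction coord_ring} ff_val
    (rmorph1 (val : function_field -> {fraction coord_ring}),
     rmorphM (val : function_field -> {fraction coord_ring})).

Lemma constant_rational (c : K) : is_rational (to_frac c%:MP).
Proof.
apply/asboolP; exists 0%N, c%:MP, 1; split.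
- by rewrite -[c]mulr1 mpolyCM mul_mpolyC rpredZ ?mpolyC1 ?dhomog1.
- exact: dhomog1.
- exact: equation_proper.
- by rewrite to_frac1 divr1.
Qed.

Definition constant (c : K) : function_field := Sub (to_frac c%:MP) (constant_rational c).

Definition scale_ff (c : K) (f : function_field) : function_field := constant c * f.

Lemma scale_ffA a b f : scale_ff a (scale_ff b f) = scale_ff (a * b) f.
Proof. by apply: val_inj; rewrite /= mulrA -rmorphM /= -mpolyCM. Qed.

Lemma scale_ff1 : left_id 1 scale_ff.
Proof. by move=> f; apply: val_inj; rewrite /= mpolyC1 rmorph1 mul1r. Qed.

Lemma scale_ffDr : right_distributive scale_ff +%R.
Proof. by move=> a f g; rewrite /scale_ff mulrDr. Qed.

Lemma scale_ffDl f : {morph scale_ff^~ f : a b / a + b}.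
Proof.
by move=> a b; rewrite /scale_ff -mulrDl; congr (_ * _); apply: val_inj;
   rewrite /= mpolyCD rmorphD.
Qed.

HB.instance Definition _ := GRing.Zmodule_isLmodule.Build K function_field
  scale_ffA scale_ff1 scale_ffDr scale_ffDl.

Definition point : Type := {P : proj_plane K | (equation X).@[coords P] == 0}.
HB.instance Definition _ := Choice.on point.

Definition pcoords (P : point) : 'I_3 -> K := coords (val P).

(* f lies in the local ring O_P of X at P, and takes the value c at P. *)
Definition has_value (P : point) (f : function_field) (c : K) : Prop :=
  exists d (G H : {mpoly K[3]}),
    [/\ G \is d.-homog, H \is d.-homog, H.@[pcoords P] != 0,
        val f = to_frac G / to_frac H & c = G.@[pcoords P] / H.@[pcoords P]].

Definition regular_at (P : point) (f : function_field) : Prop :=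
  exists c, has_value P f c.

Definition unit_at (P : point) (f : function_field) : Prop :=
  exists2 c, c != 0 & has_value P f c.

(* t generates the maximal ideal of O_P. *)
Definition uniformizer (P : point) (t : function_field) : Prop :=
  has_value P t 0 /\
  forall f, has_value P f 0 -> exists2 g, regular_at P g & f = g * t.

(* ord_P(f) = k; this excludes f = 0. *)
Definition ord_at (P : point) (f : function_field) (k : int) : Prop :=
  exists t u, [/\ uniformizer P t, unit_at P u & f = u * t ^ k].

Definition divisor : Type := {freeg point / int}.

Definition is_div (f : function_field) (E : divisor) : Prop :=
  forall P, ord_at P f (coeff P E).

Definition div_le (D E : divisor) : Prop := forall P, coeff P D <= coeff P E.

Definition RR_space (D : divisor) (f : function_field) : Prop :=
  f = 0 \/ (f != 0 /\ exists2 E, is_div f E & div_le (- D) E).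

(* The divisor cut out on X by the form G of degree d: near P, X meets G = 0
   in the zeros of the local equation G / H. *)
Definition cut_divisor (d : nat) (G : {mpoly K[3]}) (D : divisor) : Prop :=
  forall P, exists (H : {mpoly K[3]}) (f : function_field),
    [/\ H \is d.-homog, H.@[pcoords P] != 0, val f = to_frac G / to_frac H
      & ord_at P f (coeff P D)].

Definition line_cuts (l : line K) (D : divisor) : Prop :=
  cut_divisor 1 (line_form l) D.

End CurveAlgebra.

Arguments point {K m} X.
Arguments divisor {K m} X.
Arguments function_field {K m} X.

Definition has_dim (K : fieldType) (V : lmodType K) (U : V -> Prop) (k : nat) : Prop :=
  exists b : 'I_k -> V,
    (forall c : 'I_k -> K, \sum_i c i *: b i = 0 -> forall i, c i = 0) /\
    (forall v, U v <-> exists c : 'I_k -> K, v = \sum_i c i *: b i).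

Definition same_dim (K : fieldType) (V : lmodType K) (U W : V -> Prop) : Prop :=
  exists2 k, has_dim U k & has_dim W k.

Definition has_card (T : eqType) (A : T -> Prop) (k : nat) : Prop :=
  exists s : seq T, [/\ uniq s, forall x, x \in s <-> A x & size s = k].

Section PureGaps.
Context (K : closedFieldType) (m : nat) (X : smooth_plane_curve K m).

(* g is the maximum of deg D + 1 - dim L(D) over all divisors D of X. *)
Definition is_genus (g : nat) : Prop :=
  (forall (D : divisor X) k, has_dim (RR_space D) k -> deg D + 1 - k%:Z <= g%:Z) /\
  (exists (D : divisor X) k, has_dim (RR_space D) k /\ deg D + 1 - k%:Z = g%:Z).

Definition point_divisor (r : nat) (Q : r.-tuple (point X)) (a : r.-tuple nat) :
  divisor X := \sum_(i < r) << tnth Q i >> *+ tnth a i.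

Definition pure_gap (r : nat) (Q : r.-tuple (point X)) (a : r.-tuple nat) : Prop :=
  forall j : 'I_r, same_dim (RR_space (point_divisor Q a))
                            (RR_space (point_divisor Q a - << tnth Q j >>)).

End PureGaps.

(* Main.v *)
(* For a line cutting [n P + Q] with [n >= 2] one has a tangent at [P],
   so a form vanishing to order [< n] at [P] has the same order at [P] as its
   restriction to the line.  This has two consequences.

   (1) A form [G] with [v_P(G) >= v_P(line)] for all [P] is divisible by the line modulo
   the equation, since on the line [G] is a multiple of the equation.  Every
   form divides a product of lines modulo the equation (a dimension count), so a
   function [f] such that [f W] is regular everywhere, [W] being a form of degree [e], is
   [A / W] for a form [A] of degree [e].  This computes the spaces [L(div W)], hence the
   genus: a divisor lies below one cut out by lines, and dropping a point lowers
   the dimension by at most one.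

   (2) Write [a = k n + j + r + 1], [b = i n + k + s + 1], [c = j n + i + t + 1] with
   [d = i + j + k].  If [f] is in [L(a P1 + b P2 + c P3)], then
   [A = f l1^k l2^i l3^j (l1 l2 l3)] is a form of degree [d + 3 <= n] of order at least
   [d + 3] at each [P_i].  On [l1] it vanishes to order [d + 3] at [P1] and also at [P2],
   so [l1] divides it; likewise [l2] and then [l3].  So [f = A' / (l1^k l2^i l3^j)], whatever
   [r, s, t] in the given range.  Conversely, if [(a, b, c)] is not of this shape, some
   Laurent monomial in [l1, l2, l3] lies in [L(a P1 + b P2 + c P3)] and has a pole of the
   maximal allowed order at one of the points, so that the triple is not a pure gap. *)

Require Import Defs.
From HB Require Import structures.
From mathcomp Require Import all_boot all_order all_algebra.
From mathcomp Require Import boolp mpoly freeg.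
From mathcomp Require Import ring zify.
Set Implicit Arguments.
Unset Strict Implicit.
Unset Printing Implicit Defensive.
Import Order.TTheory GRing.Theory Num.Theory.
Local Open Scope ring_scope.

(** * Forms, lines and their restrictions *)

(** Since an order is defined through a uniformizer and a unit, it is not clear that a nonzero
    function has an order at each point, nor that its divisor has finite support. Both come from
    lines: the order of a line at a point is the multiplicity of a root of the equation restricted
    to that line, and a form dividing a product of lines modulo the equation inherits a bound on its
    order at every point and a finite set of possible zeros. The bound [n - 3 - d] comes from
    comparing the degree [d + 3] of [A] with its order at [P1]. The product [l1 l2 l3] has order
    [n + 1] there, so for a divisor with coefficient [k n + j + r'] at [P1] the form [A] has order
    at least [n + 1 - r'], and this bound reaches [d + 3] exactly when [r' <= n - 2 - d]. Both
    [r' = r + 1], for the divisor of a gap, and [r' = r], after removing the point, must satisfy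
    this. Each [(i, j, k)] of sum [d] thus gives [(n - 2 - d)^3] gaps; summing these cubes gives a
    polynomial of degree 6 in [n], which is the cubic in [g = n (n - 1) / 2] of the theorem. *)

Section Homogeneous.
Context (K : fieldType).
Implicit Types (p q G : {mpoly K[3]}).

Lemma pihomogM d e p q : p \is d.-homog ->
  pihomog mdeg (d + e) (p * q) = p * pihomog mdeg e q.
Proof.
(* The decomposition of [q] is indexed beyond [e], so that a component of degree [e] is present even
   when [q] has lower degree. *)
move=> hp; pose k := maxn (msize q) e.+1.
have hk : (msize q <= k)%N by rewrite leq_maxl.
rewrite {1}(pihomog_partitionE hk) mulr_sumr raddf_sum /=.
have ek : (e < k)%N by rewrite leq_max ltnSn orbT.
rewrite (bigD1 (Ordinal ek)) //= big1 ?addr0.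
  by rewrite pihomog_dE // dhomogM // pihomogP.
move=> i ne; apply: (@pihomog_ne0 _ _ _ (d + i)%N).
  by rewrite eqn_add2l; apply: contraNneq ne => h; apply/eqP/val_inj.
by rewrite dhomogM // pihomogP.
Qed.

Lemma pihomogM_small d e p q : p \is d.-homog -> (e < d)%N ->
  pihomog mdeg e (p * q) = 0.
Proof.
move=> hp lt.
rewrite (pihomog_partitionE (leqnn (msize q))) mulr_sumr raddf_sum /= big1 // => i _.
apply: (@pihomog_ne0 _ _ _ (d + i)%N); last by rewrite dhomogM // pihomogP.
by apply: contraTneq lt => <-; rewrite -leqNgt leq_addr.
Qed.

(** Cofactors obtained from ideal membership or from division carry no degree; since multiplication
    by a form only shifts the grading, keeping the component of the right degree does not change the
    product. *)
Lemma homog_cofactor d e p q : p \is d.-homog -> p * q \is (d + e)%N.-homog ->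
  p * pihomog mdeg e q = p * q.
Proof. by move=> hp hpq; rewrite -(pihomogM _ _ hp) pihomog_dE. Qed.

Lemma meval_homog d G (v w : 'I_3 -> K) c : G \is d.-homog ->
  (forall i, v i = c * w i) -> G.@[v] = c ^+ d * G.@[w].
Proof.
move=> /dhomogP hG vw; rewrite !mevalE mulr_sumr; apply: eq_big_seq => m hm.
rewrite mulrCA; congr (_ * _).
have -> : d = (\sum_i m i)%N by rewrite -mdegE hG.
rewrite expr_sum -big_split /=; apply: eq_bigr => i _.
by rewrite vw exprMn.
Qed.

Definition lin (u : 'I_3 -> K) : {mpoly K[3]} := \sum_(i < 3) u i *: 'X_i.

Definition dot (u v : 'I_3 -> K) : K := \sum_(i < 3) u i * v i.

Lemma X_homog (i : 'I_3) : ('X_i : {mpoly K[3]}) \is 1.-homog.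
Proof. by rewrite dhomogX; apply/eqP; exact: mdeg1. Qed.

Lemma lin_homog u : lin u \is 1.-homog.
Proof. by apply: rpred_sum => i _; rewrite rpredZ // X_homog. Qed.

Lemma meval_lin u v : (lin u).@[v] = dot u v.
Proof. by rewrite raddf_sum; apply: eq_bigr => i _ /=; rewrite mevalZ mevalXU. Qed.

Lemma dotC u v : dot u v = dot v u.
Proof. by apply: eq_bigr => i _; rewrite mulrC. Qed.

Lemma mderiv_lin i u : mderiv i (lin u) = (u i)%:MP.
Proof.
rewrite raddf_sum (bigD1 i) //= big1 ?addr0 => [|j ne].
  rewrite mderivZ mderivX mnm1E eqxx scale1r.
  have -> : (U_(i) - U_(i))%MM = 0%MM :> 'X_{1..3}.
    by apply/mnmP => k; rewrite mnmBE subnn mnm0E.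
  by rewrite mpolyX0 -mul_mpolyC mulr1.
by rewrite mderivZ mderivX mnm1E (negbTE ne) scale0r scaler0.
Qed.

Lemma lin_eq0 u : (lin u == 0) = [forall i, u i == 0].
Proof.
apply/eqP/forallP => [h i|h]; last first.
  by rewrite /lin big1 // => i _; rewrite (eqP (h i)) scale0r.
have /eqP := mderiv_lin i u; rewrite h mderiv0 eq_sym mpolyC_eq0.
by [].
Qed.

Lemma lin0P u : (exists i, u i != 0) <-> lin u != 0.
Proof. by rewrite lin_eq0 negb_forall; split=> [h|/existsP//]; apply/existsP. Qed.

End Homogeneous.

Section Frames.
Context (K : fieldType).
Implicit Types (A B C la mu nu u v w : 'I_3 -> K) (G : {mpoly K[3]}).

(* [A, B, C] is a basis of [K^3], with dual basis [la, mu, nu]. *)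
Record frame A B C la mu nu : Prop := Frame {
  frame_id : forall i j, A i * la j + B i * mu j + C i * nu j = (i == j)%:R;
  frame_dual : [/\ dot la A = 1, dot la B = 0 & dot la C = 0] /\
    [/\ dot mu A = 0, dot mu B = 1 & dot mu C = 0] /\
    [/\ dot nu A = 0, dot nu B = 0 & dot nu C = 1] }.

Lemma frame_swapAB A B C la mu nu :
  frame A B C la mu nu -> frame B A C mu la nu.
Proof.
case=> h [[? ? ?] [[? ? ?] [? ? ?]]]; split=> [i j|]; last by do !split.
by rewrite -h; congr (_ + _); rewrite addrC.
Qed.

Lemma frame_swapBC A B C la mu nu :
  frame A B C la mu nu -> frame A C B la nu mu.
Proof.
case=> h [[? ? ?] [[? ? ?] [? ? ?]]]; split=> [i j|]; last by do !split.
by rewrite -h -!addrA; congr (_ + _); rewrite addrC.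
Qed.

Lemma dotDr u v w c : dot u (fun i => v i + c * w i) = dot u v + c * dot u w.
Proof.
by rewrite /dot mulr_sumr -big_split /=; apply: eq_bigr => i _; rewrite mulrDr mulrCA.
Qed.

Lemma dotDl u v w c : dot (fun i => v i + c * w i) u = dot v u + c * dot w u.
Proof. by rewrite dotC dotDr !(dotC u). Qed.

(** The line [nu = 0] is kept while the origin [A] slides along it, so local statements at [A] apply
    at every point [A + t B] of the line. *)
Lemma frame_shear A B C la mu nu t : frame A B C la mu nu ->
  frame (fun i => A i + t * B i) B C la (fun j => mu j + (- t) * la j) nu.
Proof.
case=> h [[h1 h2 h3] [[h4 h5 h6] [h7 h8 h9]]]; split=> [i j|].
  by rewrite -h; ring.
by do !split; rewrite ?dotDl ?dotDr ?h1 ?h2 ?h3 ?h4 ?h5 ?h6 ?h7 ?h8 ?h9; ring.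
Qed.

(** The kernel of [u] is a plane containing [v]: a second vector of it completes [v], and a third
    vector on which [u] is 1 makes [u] itself, not just a multiple, the last element of the dual
    basis. *)
Lemma frame_exists (v u : 'I_3 -> K) : (exists i, v i != 0) -> (exists i, u i != 0) ->
  dot u v = 0 -> exists B C la mu, frame v B C la mu u.
Proof.
move=> [i0 vi0] [j0 uj0] uv.
pose V : 'rV[K]_3 := \row_i v i; pose U : 'cV[K]_3 := \col_i u i.
have V0 : V != 0 by apply: contraNneq vi0 => /rowP/(_ i0); rewrite !mxE => ->.
have U0 : U != 0 by apply: contraNneq uj0 => /colP/(_ j0); rewrite !mxE => ->.
have rV1 : \rank V = 1%N by rewrite rank_rV V0.
have rU1 : \rank U = 1%N.
  apply/eqP; rewrite eqn_leq rank_leq_col lt0n mxrank_eq0 //.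
(* The kernel has rank 2 and [v] spans a space of rank 1, so some row of the kernel matrix is
   independent of [v]. *)
have nsub : ~~ (kermx U <= V)%MS.
  apply/negP => /mxrankS; rewrite mxrank_ker rV1 rU1 //.
have [b hb] : exists b, ~~ (row b (kermx U) <= V)%MS.
  by apply/existsP; rewrite -negb_forall; apply: contra nsub => /forallP h; apply/row_subP.
pose W := row b (kermx U).
have WU : W *m U = 0 by apply/sub_kermxP; exact: row_sub.
have VU : V *m U = 0.
  apply/matrixP => i j; rewrite !mxE -[RHS]uv; apply: eq_bigr => k _.
  by rewrite !mxE mulrC.
pose Z : 'rV[K]_3 := (u j0)^-1 *: delta_mx 0 j0.
have ZU : Z *m U = 1%:M.
  apply/matrixP => i j; rewrite !ord1 -scalemxAl -rowE !mxE /=.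
  by rewrite mulVf.
pose M : 'M[K]_3 := col_mx V (col_mx W Z : 'M[K]_(1 + 1, 3)) : 'M[K]_(1 + (1 + 1), 3).
(* In a relation between the rows, applying [U] kills [V] and [W], hence the coefficient of [Z]
   vanishes; the choice of [W] then forces its own coefficient to vanish. *)
have Mu : M \in unitmx.
  rewrite -row_free_unit -kermx_eq0; apply/rowV0P => x /sub_kermxP.
  pose x' : 'rV[K]_(1 + (1 + 1)) := x.
  pose a := lsubmx x'; pose c := lsubmx (rsubmx x'); pose d := rsubmx (rsubmx x').
  have -> : x = row_mx a (row_mx c d) by rewrite !hsubmxK.
  move=> hx; have {hx} h : a *m V + (c *m W + d *m Z) = 0.
    rewrite -[RHS]hx -(@mul_row_col _ 1 1 1 3 c d W Z).
    by rewrite -(@mul_row_col _ 1 1 (1 + 1) 3 a (row_mx c d) V (col_mx W Z)).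
  have d0 : d = 0.
    have := congr1 (mulmx^~ U) h; rewrite mul0mx !mulmxDl -!mulmxA VU WU ZU !mulmx0 !add0r mulmx1 //.
  move: h; rewrite d0 mul0mx addr0 => h.
  have c0 : c = 0.
    apply: contraNeq hb => c0.
    have cu : c 0 0 != 0 by apply: contraNneq c0 => e; apply/eqP/matrixP => i j; rewrite !ord1 e mxE.
    rewrite -/W; have -> : W = - (c 0 0)^-1 *: (a *m V).
      have -> : a *m V = - (c *m W) by apply/eqP; rewrite -addr_eq0 h.
      rewrite scalerN scaleNr opprK [c in c *m W]mx11_scalar mul_scalar_mx scalerA mulVf //.
      by rewrite scale1r.
    by rewrite scalemx_sub // submxMl.
  move: h; rewrite c0 mul0mx addr0 => h.
  have a0 : a = 0.
    have vi : V 0 i0 != 0 by rewrite mxE.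
    apply/matrixP => i j; rewrite !ord1 [RHS]mxE.
    move: h; rewrite [a in a *m V]mx11_scalar mul_scalar_mx => /rowP/(_ i0).
    rewrite mxE [RHS]mxE => /eqP; rewrite mulf_eq0 (negbTE vi) orbF => /eqP.
    by [].
  by rewrite a0 !row_mx0.
have NM := mulVmx Mu; have MN := mulmxV Mu.
set N := invmx M in NM MN.
pose r0 : 'I_3 := 0; pose r1 : 'I_3 := 1; pose r2 : 'I_3 := 2%:R.
have M0 k : M r0 k = v k.
  have -> : r0 = lshift 2 (0 : 'I_1) by apply/val_inj.
  by rewrite (@col_mxEu _ 1 2) mxE.
have M1 k : M r1 k = W 0 k.
  have -> : r1 = rshift 1 (lshift 1 (0 : 'I_1)) by apply/val_inj.
  by rewrite (@col_mxEd _ 1 2) (@col_mxEu _ 1 1).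
have M2 k : M r2 k = Z 0 k.
  have -> : r2 = rshift 1 (rshift 1 (0 : 'I_1)) by apply/val_inj.
  by rewrite (@col_mxEd _ 1 2) (@col_mxEd _ 1 1).
have sum3 (f : 'I_3 -> K) : \sum_i f i = f r0 + f r1 + f r2.
  rewrite !big_ord_recl big_ord0 addr0 addrA.
  by congr (f _ + f _ + f _); apply/val_inj.
have Nu k : N k r2 = u k.
  have MU : M *m U = delta_mx r2 0.
    apply/matrixP => i j; rewrite !ord1 mxE [RHS]mxE andbT.
    have : i \in [:: r0; r1; r2] by case: i => [[|[|[|]]]].
    rewrite !inE => /or3P[]/eqP->.
    - rewrite -[RHS]uv; apply: eq_bigr => l _; by rewrite M0 mxE mulrC.
    - have /matrixP/(_ 0 0) := WU; rewrite [LHS]mxE [RHS]mxE => e; rewrite -[RHS]e.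
      by apply: eq_bigr => l _; rewrite M1.
    - have /matrixP/(_ 0 0) := ZU; rewrite [LHS]mxE [RHS]mxE => e; rewrite -[RHS]e.
      by apply: eq_bigr => l _; rewrite M2.
  have <- : U k 0 = u k by rewrite mxE.
  by rewrite -[U]mul1mx -NM -mulmxA MU -colE mxE.
exists (W 0), (Z 0), (N^~ r0), (N^~ r1); split=> [i j|].
  have /matrixP/(_ j i) := NM; rewrite [LHS]mxE [RHS]mxE sum3 M0 M1 M2 Nu eq_sym => <-.
  ring.
have MN' a b0 : dot (N^~ b0) (M a) = (a == b0)%:R.
  have /matrixP/(_ a b0) := MN; rewrite !mxE => <-.
  by apply: eq_bigr => k _; rewrite mulrC.
have M0' b0 : dot b0 v = dot b0 (M r0) by apply: eq_bigr => k _; rewrite M0.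
have M1' b0 : dot b0 (W 0) = dot b0 (M r1) by apply: eq_bigr => k _; rewrite M1.
have M2' b0 : dot b0 (Z 0) = dot b0 (M r2) by apply: eq_bigr => k _; rewrite M2.
have U' w : dot u w = dot (N^~ r2) w by apply: eq_bigr => k _; rewrite Nu.
by do !split; rewrite ?U' ?M0' ?M1' ?M2' MN'.
Qed.

Lemma orth_exists (v : 'I_3 -> K) : (exists i, v i != 0) ->
  exists2 u : 'I_3 -> K, exists i, u i != 0 & dot u v = 0.
Proof.
move=> [i vi].
have [j ji] : exists j : 'I_3, j != i.
  by case: (eqVneq i 0) => [->|h]; [exists 1|exists 0; rewrite eq_sym].
exists (fun k => v j * (k == i)%:R - v i * (k == j)%:R).
  by exists j; rewrite eqxx (negbTE ji) mulr0 mulr1 sub0r oppr_eq0.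
rewrite /dot (bigD1 i) //= (bigD1 j) //= big1 => [|k /andP[ki kj]].
  by rewrite !eqxx (negbTE ji) eq_sym (negbTE ji) /=; ring.
by rewrite (negbTE ki) (negbTE kj) !mulr0 subrr mul0r.
Qed.

Lemma dot_neq0 u v : dot u v != 0 -> exists i, u i != 0.
Proof.
move=> uv; apply: contrapT => h; case/eqP: uv; rewrite /dot big1 // => i _.
case: (eqVneq (u i) 0) => [->|ui]; first by rewrite mul0r.
by case: h; exists i.
Qed.

Lemma frame_line_neq0 A B C la mu nu : frame A B C la mu nu -> exists i, nu i != 0.
Proof.
move=> fr; have [_ [_ [_ _ e]]] := frame_dual fr.
by apply: (@dot_neq0 _ C); rewrite e oner_neq0.
Qed.

Lemma frame_coords A B C la mu nu v i : frame A B C la mu nu ->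
  v i = dot la v * A i + dot mu v * B i + dot nu v * C i.
Proof.
move=> fr; have : v i = \sum_j (i == j)%:R * v j.
  rewrite (bigD1 i) //= eqxx mul1r big1 ?addr0 // => j ne.
  by rewrite eq_sym (negbTE ne) mul0r.
under eq_bigr do rewrite -(frame_id fr) !mulrDl -!mulrA.
rewrite !big_split /= -!mulr_sumr -/(dot la v) -/(dot mu v) -/(dot nu v) => ->.
by rewrite ![_ * dot _ _]mulrC.
Qed.

End Frames.

Section Restriction.
Context (K : fieldType).
Implicit Types (A B C la mu nu v w : 'I_3 -> K) (G : {mpoly K[3]}) (q : {poly K}).

(** The line through [A] and [B] is parametrized by [A + X B]: [A] sits at 0 and [B] at infinity. *)
Definition restriction A B G : {poly K} :=
  mmap (@polyC K) (fun i => (A i)%:P + B i *: 'X) G.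

HB.instance Definition _ A B := GRing.RMorphism.copy (restriction A B)
  (mmap (@polyC K) (fun i => (A i)%:P + B i *: 'X)).

(** The lift to the plane of the binary form of degree [d] attached to [q]: in a frame, [lin la] and
    [lin mu] restrict to 1 and ['X]. The degree is a parameter because [q] may have lower degree,
    which corresponds to zeros at [B]. *)
Definition homogenize la mu d q : {mpoly K[3]} :=
  \sum_(i < d.+1) q`_i *: (lin la ^+ (d - i) * lin mu ^+ i).

Lemma homogenize_homog la mu d q : homogenize la mu d q \is d.-homog.
Proof.
apply: rpred_sum => i _; rewrite rpredZ //.
have := dhomogM (dhomogMn (d - i) (lin_homog la)) (dhomogMn i (lin_homog mu)).
by rewrite !mul1n subnK // -ltnS.
Qed.

Lemma homogenizeD la mu d p q :
  homogenize la mu d (p + q) = homogenize la mu d p + homogenize la mu d q.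
Proof. by rewrite -big_split; apply: eq_bigr => i _; rewrite coefD scalerDl. Qed.

Lemma homogenizeZ la mu d c q : homogenize la mu d (c *: q) = c *: homogenize la mu d q.
Proof. by rewrite scaler_sumr; apply: eq_bigr => i _; rewrite coefZ scalerA. Qed.

Lemma homogenize0 la mu d : homogenize la mu d 0 = 0.
Proof. by rewrite -(scale0r 0) homogenizeZ scale0r. Qed.

Lemma homogenizeMX la mu d q :
  homogenize la mu d.+1 (q * 'X) = lin mu * homogenize la mu d q.
Proof.
rewrite /homogenize big_ord_recl /= coefMX /= scale0r add0r mulr_sumr.
apply: eq_bigr => i _; rewrite coefMX /= -scalerAr; congr (_ *: _).
by rewrite mulrCA -exprS.
Qed.

Lemma homogenizeS la mu d q : (size q <= d.+1)%N ->
  homogenize la mu d.+1 q = lin la * homogenize la mu d q.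
Proof.
move=> sq; rewrite /homogenize big_ord_recr /= nth_default // scale0r addr0 mulr_sumr.
apply: eq_bigr => i _; rewrite -scalerAr; congr (_ *: _).
by rewrite subSn ?exprS ?mulrA // -ltnS.
Qed.

Lemma homogenizeMXn la mu d k q :
  homogenize la mu (d + k) (q * 'X^k) = lin mu ^+ k * homogenize la mu d q.
Proof.
elim: k => [|k IH]; first by rewrite addn0 !expr0 mulr1 mul1r.
by rewrite addnS exprSr mulrA homogenizeMX IH exprS mulrA.
Qed.

Lemma homogenize1 la mu : homogenize la mu 0 1 = 1.
Proof. by rewrite /homogenize big_ord1 coefC /= scale1r !expr0 mulr1. Qed.

Lemma restriction_lin A B u : restriction A B (lin u) = (dot u A)%:P + dot u B *: 'X.
Proof.
rewrite raddf_sum /= rmorph_sum scaler_suml -big_split /=; apply: eq_bigr => i _.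
rewrite /restriction mmapZ mmapX mmap1U mul_polyC scalerDr scalerA polyCM.
by rewrite mul_polyC.
Qed.

Lemma restriction_eval A B G t : (restriction A B G).[t] = G.@[fun i => A i + t * B i].
Proof.
rewrite /restriction /mmap mevalE horner_sum; apply: eq_bigr => m _ /=.
rewrite mul_polyC hornerZ /mmap1 horner_prod; congr (_ * _); apply: eq_bigr => i _.
by rewrite horner_exp !hornerE mulrC.
Qed.

Lemma restriction_coef0 A B G : (restriction A B G)`_0 = G.@[A].
Proof. by rewrite -horner_coef0 restriction_eval; apply: meval_eq => i; rewrite mul0r addr0. Qed.

Lemma restriction_coef A B G d : G \is d.-homog ->
  (size (restriction A B G) <= d.+1)%N /\ (restriction A B G)`_d = G.@[B].
Proof.
(* The degree bound and the coefficient at that bound are carried together: the pair is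
   multiplicative, so it passes from the linear factors to monomials. *)
pose P e (p : {poly K}) c := (size p <= e.+1)%N /\ p`_e = c.
have PM e f p q a b : P e p a -> P f q b -> P (e + f)%N (p * q) (a * b).
  move=> [sp pa] [sq qb]; split.
    by rewrite (leq_trans (size_polyMleq _ _)) //; move: sp sq; lia.
  rewrite coefM (bigD1 (inord e)) //= big1 ?addr0 => [|i ne].
    by rewrite inordK ?ltnS ?leq_addr // addKn pa qb.
  case: (ltngtP i e) => h.
  - rewrite [q`__]nth_default ?mulr0 // (leq_trans sq) //; move: h (ltn_ord i); lia.
  - by rewrite nth_default ?mul0r // (leq_trans sp).
  - by case/eqP: ne; apply/val_inj; rewrite /= inordK // ltnS leq_addr.
have PX e p a k : P e p a -> P (e * k)%N (p ^+ k) (a ^+ k).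
  move=> h; elim: k => [|k IH]; first by split; rewrite muln0 expr0 ?size_poly1 ?coefC.
  by rewrite mulnS !exprS; apply: PM.
have Pm (m : 'X_{1..3}) : P (mdeg m) (mmap1 (fun i => (A i)%:P + B i *: 'X) m)
    (\prod_i B i ^+ m i).
  rewrite mdegE /mmap1.
  elim/big_rec3: _ => [|i a p k _ IH]; first by split; rewrite ?size_poly1 ?coefC.
  rewrite addnC [(_ + m i)%N]addnC; apply: PM => //; rewrite -[X in P X]mul1n; apply: PX; split.
    rewrite (leq_trans (size_polyD _ _)) // geq_max (leq_trans (size_polyC_leq1 _)) //=.
    by rewrite (leq_trans (size_scale_leq _ _)) // size_polyX.
  by rewrite coefD coefC coefZ coefX /= add0r mulr1.
move=> /dhomogP hG; rewrite /restriction /mmap mevalE big_seq.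
split.
  apply: (big_ind (fun p : {poly K} => size p <= d.+1)%N); rewrite ?size_poly0 //.
    by move=> p q sp sq; rewrite (leq_trans (size_polyD _ _)) // geq_max sp.
  move=> m hm; rewrite mul_polyC (leq_trans (size_scale_leq _ _)) //.
  by case: (Pm m); rewrite (hG m hm).
rewrite [RHS]big_seq coef_sum; apply: eq_bigr => m hm.
by rewrite coefCM; case: (Pm m); rewrite (hG m hm) => _ ->.
Qed.

Section WithFrame.
Context A B C la mu nu (fr : frame A B C la mu nu).

Lemma restriction_homogenize d q : (size q <= d.+1)%N -> restriction A B (homogenize la mu d q) = q.
Proof.
case: fr => _ [[h1 h2 _] [[h3 h4 _] _]] sq.
rewrite /homogenize raddf_sum /= -[RHS](take_poly_id sq) /take_poly poly_def.
apply: eq_bigr => i _; rewrite -mul_mpolyC rmorphM /= {1}/restriction mmapC mul_polyC.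
rewrite rmorphM !rmorphXn /= !restriction_lin h1 h2 h3 h4.
by rewrite scale0r addr0 scale1r add0r expr1n mul1r.
Qed.

Lemma homogenize_meval0 d q : (homogenize la mu d q).@[A] = q`_0.
Proof.
case: fr => _ [[h1 _ _] [[h3 _ _] _]].
rewrite /homogenize raddf_sum big_ord_recl big1 /= ?addr0 => [|i _].
  by rewrite mevalZ mevalM !rmorphXn /= !meval_lin h1 expr1n !mulr1.
by rewrite mevalZ mevalM !rmorphXn /= !meval_lin h3 expr0n /= !mulr0.
Qed.

Lemma frame_X (i : 'I_3) : 'X_i = A i *: lin la + B i *: lin mu + C i *: lin nu.
Proof.
rewrite /lin !scaler_sumr -!big_split /= (bigD1 i) //= big1 => [|j ne].
  by rewrite !scalerA -!scalerDl (frame_id fr) eqxx scale1r addr0.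
by rewrite !scalerA -!scalerDl (frame_id fr) eq_sym (negbTE ne) scale0r.
Qed.

(** Modulo [lin nu] every form is a binary form in [lin la] and [lin mu], and the restriction tells
    which one. By linearity monomials suffice, and these are built one variable at a time. *)
Lemma frame_decomp d G : G \is d.-homog ->
  exists G1, G = lin nu * G1 + homogenize la mu d (restriction A B G).
Proof.
have Hm (m : 'X_{1..3}) : exists G1,
    'X_[m] = lin nu * G1 + homogenize la mu (mdeg m) (restriction A B 'X_[m]).
  move e : (mdeg m) => k; elim: k m e => [|k IH] m e.
    move/eqP: e; rewrite mdeg_eq0 => /eqP->; rewrite mpolyX0 rmorph1 homogenize1.
    by exists 0; rewrite mulr0 add0r.
  have [i mi] : exists i, (0 < m i)%N.
    apply/existsP; apply: contraTT isT; rewrite negb_exists => /forallP h.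
    suff: mdeg m = 0%N by rewrite e.
    by rewrite mdegE big1 // => i _; apply/eqP; move: (h i); rewrite lt0n negbK.
  have im : (U_(i) <= m)%MM by apply/mnm_lepP => j; rewrite mnm1E; case: eqP => // <-.
  have mE : m = (U_(i) + (m - U_(i)))%MM by rewrite addmC submK.
  have e' : mdeg (m - U_(i))%MM = k by move: e; rewrite mE mdegD mdeg1 addmC addmK => -[].
  have [G1 hG1] := IH _ e'.
  set M := (m - U_(i))%MM in mE e' hG1.
  have sz : (size (restriction A B 'X_[M]) <= k.+1)%N.
    by apply: (proj1 (restriction_coef A B _)); rewrite dhomogX; apply/eqP.
  (* In the expansion of ['X_i] in the dual basis, the [la] and [mu] parts multiply the inductive
     cofactor, while the [nu] part contributes the whole of ['X_[M]]. *)
  exists ((A i *: lin la + B i *: lin mu) * G1 + C i *: 'X_[M]).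
  rewrite mE mpolyXD rmorphM /=.
  have -> : restriction A B 'X_i = (A i)%:P + B i *: 'X by rewrite /restriction mmapX mmap1U.
  rewrite [((A i)%:P + _) * _]mulrDl mul_polyC -scalerAl ['X * _]mulrC homogenizeD !homogenizeZ homogenizeMX.
  rewrite homogenizeS //.
  have -> : homogenize la mu k (restriction A B 'X_[M]) = 'X_[M] - lin nu * G1.
    by rewrite {2}hG1 addrC addKr.
  by rewrite (frame_X i) -!mul_mpolyC; ring.
move=> /dhomogP hG.
have [H hH] : exists H : 'X_{1..3} -> {mpoly K[3]}, forall m,
    'X_[m] = lin nu * H m + homogenize la mu (mdeg m) (restriction A B 'X_[m]).
  by exists (fun m => projT1 (cid (Hm m))) => m; exact: projT2 (cid (Hm m)).
exists (\sum_(m <- msupp G) G@_m *: H m).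
have eG := mpolyE G; rewrite {1 4}eG mulr_sumr raddf_sum /=.
have -> : homogenize la mu d (\sum_(m <- msupp G) restriction A B (G@_m *: 'X_[m])) =
    \sum_(m <- msupp G) homogenize la mu d (restriction A B (G@_m *: 'X_[m])).
  by apply: (big_morph _ (homogenizeD la mu d) (homogenize0 la mu d)).
rewrite -big_split /=; apply: eq_big_seq => m hm.
rewrite {1}hH scalerDr -scalerAr; congr (_ + _).
rewrite (hG m hm) -homogenizeZ; congr homogenize.
by rewrite -mul_mpolyC rmorphM /= {2}/restriction mmapC mul_polyC.
Qed.

Lemma frame_decomp_homog d G : G \is d.+1.-homog ->
  exists2 G1, G1 \is d.-homog & G = lin nu * G1 + homogenize la mu d.+1 (restriction A B G).
Proof.
move=> hG; have [G1 e] := frame_decomp hG.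
exists (pihomog mdeg d G1); first exact: pihomogP.
rewrite (@homog_cofactor _ 1) ?lin_homog // add1n.
have -> : lin nu * G1 = G - homogenize la mu d.+1 (restriction A B G) by rewrite {1}e addrK.
by rewrite rpredB // homogenize_homog.
Qed.

Lemma restriction_eq0 d G : G \is d.+1.-homog -> restriction A B G = 0 ->
  exists2 G1, G1 \is d.-homog & G = lin nu * G1.
Proof.
move=> hG e; have [G1 h1 h2] := frame_decomp_homog hG.
by exists G1; rewrite // {1}h2 e homogenize0 addr0.
Qed.

Lemma restriction_shear t G : restriction (fun i => A i + t * B i) B G = restriction A B G \Po ('X + t%:P).
Proof.
rewrite /restriction /mmap rmorph_sum /=; apply: eq_bigr => m _.
rewrite rmorphM /= comp_polyC; congr (_ * _); rewrite /mmap1 rmorph_prod /=.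
apply: eq_bigr => i _; rewrite rmorphXn /= comp_polyD comp_polyC comp_polyZ comp_polyX.
by rewrite polyCD polyCM -!mul_polyC; congr (_ ^+ _); ring.
Qed.

End WithFrame.
End Restriction.

Section FieldFractions.
Context (L : fieldType).
Implicit Types a b c d : L.

Lemma frac_eqP a b c d : b != 0 -> d != 0 -> a / b = c / d <-> a * d = c * b.
Proof.
move=> b0 d0; split=> [e|e]; last by apply/eqP; rewrite eqr_div // e.
by apply/eqP; rewrite -eqr_div // e.
Qed.

Lemma frac_add a b c d : b != 0 -> d != 0 -> a / b + c / d = (a * d + c * b) / (b * d).
Proof. exact: addf_div. Qed.

Lemma frac_mul a b c d : a / b * (c / d) = (a * c) / (b * d).
Proof. exact: mulf_div. Qed.

Lemma frac_inv a b : (a / b)^-1 = b / a.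
Proof. exact: invf_div. Qed.

Lemma frac_cancel a b c d : b != 0 -> a / b * (c * (b * d)) = a * (d * c).
Proof. by move=> b0; field. Qed.

Lemma frac_elim a b c d x y :
  (a * b + - (a * c / d) * x) / y = (b - c / d * x) / y * a.
Proof. by ring. Qed.

End FieldFractions.

(** * Local rings of the curve *)

Section Values.
Context (K : closedFieldType) (m : nat) (X : smooth_plane_curve K m).
Implicit Types (P : point X) (f g t u : function_field X) (G H : {mpoly K[3]}).
Local Notation F := (equation X).
Local Notation I := (ideal_of X).
Local Notation tofr := (to_frac X).

(** The default 0 is harmless: [ffracE] returns the true quotient as soon as [G] and [H] are forms
    of one degree and [H] is not in the ideal. *)
Definition ffrac G H : function_field X := insubd 0 (tofr G / tofr H).

Lemma ffracE d G H : G \is d.-homog -> H \is d.-homog -> H \notin I ->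
  val (ffrac G H) = tofr G / tofr H.
Proof.
move=> hG hH HI; rewrite insubdK //; apply/asboolP; by exists d, G, H.
Qed.

Lemma ff_cases f : exists d G H,
  [/\ G \is d.-homog, H \is d.-homog, H \notin I & f = ffrac G H].
Proof.
have /asboolP [d [G [H [hG hH HI e]]]] := valP f.
by exists d, G, H; split=> //; apply: val_inj; rewrite (ffracE hG hH HI).
Qed.

Lemma ideal_meval P G : G \in I -> G.@[pcoords P] = 0.
Proof. by move=> /ideal_ofP[Q ->]; rewrite mevalM (eqP (valP P)) mulr0. Qed.

Lemma meval_notin P G : G.@[pcoords P] != 0 -> G \notin I.
Proof. by apply: contra => /(ideal_meval P) ->. Qed.

Lemma notinM G H : G \notin I -> H \notin I -> G * H \notin I.
Proof. by move=> hA hB; rewrite prime_idealrM negb_or hA. Qed.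

Lemma ffrac_eq d e G H G' H' :
  G \is d.-homog -> H \is d.-homog -> H \notin I ->
  G' \is e.-homog -> H' \is e.-homog -> H' \notin I ->
  (ffrac G H = ffrac G' H') <-> (tofr (G * H') = tofr (G' * H)).
Proof.
move=> hG hH HI hG' hH' HI'; have [H0 H0'] : tofr H != 0 /\ tofr H' != 0.
  by rewrite !to_frac_eq0.
rewrite !to_fracM; split=> [e1|e1].
  have := congr1 val e1; rewrite (ffracE hG hH HI) (ffracE hG' hH' HI').
  by move/(frac_eqP _ _ H0 H0').
apply: val_inj; rewrite (ffracE hG hH HI) (ffracE hG' hH' HI').
exact/(frac_eqP _ _ H0 H0').
Qed.

Lemma has_value_frac P d G H : G \is d.-homog -> H \is d.-homog -> H.@[pcoords P] != 0 ->
  has_value P (ffrac G H) (G.@[pcoords P] / H.@[pcoords P]).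
Proof.
move=> hG hH HP; exists d, G, H; split=> //.
by rewrite (ffracE hG hH) // (meval_notin HP).
Qed.

Lemma has_value_cases P f c : has_value P f c -> exists d G H,
  [/\ G \is d.-homog, H \is d.-homog, H.@[pcoords P] != 0,
     f = ffrac G H & c = G.@[pcoords P] / H.@[pcoords P]].
Proof.
move=> [d [G [H [hG hH HP e ->]]]]; exists d, G, H; split=> //.
by apply: val_inj; rewrite (ffracE hG hH) // (meval_notin HP).
Qed.

(** Cross-multiplying two fractions for [f] gives forms that agree modulo the ideal, whose elements
    vanish at [P]. *)
Lemma has_value_uniq P f c c' : has_value P f c -> has_value P f c' -> c = c'.
Proof.
move=> /has_value_cases[d [G [H [hG hH HP -> ->]]]] /has_value_cases[d' [G' [H' [hG' hH' HP' e ->]]]].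
have := e; rewrite (ffrac_eq hG hH (meval_notin HP) hG' hH' (meval_notin HP')).
move/eqP; rewrite -subr_eq0 -rmorphB to_frac_eq0 => /(ideal_meval P).
rewrite mevalB !mevalM => /eqP; rewrite subr_eq0 => /eqP e1.
by apply/eqP; rewrite eqr_div // e1.
Qed.

Lemma has_valueD P f g c d : has_value P f c -> has_value P g d -> has_value P (f + g) (c + d).
Proof.
move=> [a [G [H [hG hH HP e ->]]]] [b [G' [H' [hG' hH' HP' e' ->]]]].
exists (a + b)%N, (G * H' + G' * H), (H * H'); split.
- by apply: rpredD; [exact: dhomogM|rewrite addnC; exact: dhomogM].
- exact: dhomogM.
- by rewrite mevalM mulf_neq0.
- have h : tofr H != 0 by rewrite to_frac_eq0 (meval_notin HP).
  have h' : tofr H' != 0 by rewrite to_frac_eq0 (meval_notin HP').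
  have := frac_add (tofr G) (tofr G') h h'; rewrite -e -e' -!to_fracM.
  by rewrite -[X in X / _]rmorphD.
- by rewrite addf_div // mevalD !mevalM.
Qed.

Lemma has_valueM P f g c d : has_value P f c -> has_value P g d -> has_value P (f * g) (c * d).
Proof.
move=> [a [G [H [hG hH HP e ->]]]] [b [G' [H' [hG' hH' HP' e' ->]]]].
exists (a + b)%N, (G * G'), (H * H'); split; try exact: dhomogM.
- by rewrite mevalM mulf_neq0.
- have := frac_mul (tofr G) (tofr H) (tofr G') (tofr H'); rewrite -e -e' -!to_fracM.
  by [].
- by rewrite mulf_div !mevalM.
Qed.

Lemma has_valueC P c : has_value P (Defs.constant X c) c.
Proof.
exists 0%N, c%:MP, 1; split; rewrite ?dhomog1 ?meval1 ?oner_neq0 //.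
- by rewrite -[c]mulr1 mpolyCM mul_mpolyC rpredZ // mpolyC1 dhomog1.
- by rewrite /= to_frac1 divr1.
- by rewrite mevalC divr1.
Qed.

Lemma constant1 : Defs.constant X 1 = 1.
Proof. by apply: val_inj; rewrite /= mpolyC1 rmorph1. Qed.

Lemma constant0 : Defs.constant X 0 = 0.
Proof. by apply: val_inj; rewrite /= mpolyC0 rmorph0. Qed.

Lemma has_value1 P : has_value P 1 1.
Proof. by rewrite -constant1; exact: has_valueC. Qed.

Lemma has_value0 P : has_value P 0 0.
Proof. by rewrite -constant0; exact: has_valueC. Qed.

Lemma has_valueZ P f c a : has_value P f c -> has_value P (a *: f) (a * c).
Proof. by move=> h; apply: has_valueM => //; exact: has_valueC. Qed.

Lemma has_valueN P f c : has_value P f c -> has_value P (- f) (- c).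
Proof. by move=> h; rewrite -(@scaleN1r K (function_field X)) -(mulN1r c); exact: has_valueZ. Qed.

Lemma has_valueV P f c : c != 0 -> has_value P f c -> has_value P f^-1 c^-1.
Proof.
move=> c0 [a [G [H [hG hH HP e ec]]]]; exists a, H, G; split=> //.
- by apply: contraNneq c0; rewrite ec => ->; rewrite mul0r.
- by have := frac_inv (tofr G) (tofr H); rewrite -e.
- by rewrite ec invf_div.
Qed.

Lemma has_value_neq0 P f c : c != 0 -> has_value P f c -> f != 0.
Proof.
by move=> c0 h; apply: contraNneq c0 => f0; rewrite f0 in h; rewrite (has_value_uniq h (has_value0 P)).
Qed.

Lemma regularD P f g : regular_at P f -> regular_at P g -> regular_at P (f + g).
Proof. by move=> [c hc] [d hd]; exists (c + d); exact: has_valueD. Qed.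

Lemma regularM P f g : regular_at P f -> regular_at P g -> regular_at P (f * g).
Proof. by move=> [c hc] [d hd]; exists (c * d); exact: has_valueM. Qed.

Lemma regularZ P f a : regular_at P f -> regular_at P (a *: f).
Proof. by move=> [c hc]; exists (a * c); exact: has_valueZ. Qed.

Lemma regular0 P : regular_at P 0. Proof. by exists 0; exact: has_value0. Qed.
Lemma regular1 P : regular_at P 1. Proof. by exists 1; exact: has_value1. Qed.

Lemma regularX P f k : regular_at P f -> regular_at P (f ^+ k).
Proof.
move=> h; elim: k => [|k IH]; first by rewrite expr0; exact: regular1.
by rewrite exprS; exact: regularM.
Qed.

Lemma unit_at_regular P u : unit_at P u -> regular_at P u.
Proof. by move=> [c _ h]; exists c. Qed.

Lemma unit_at1 P : unit_at P 1.
Proof. by exists 1; [exact: oner_neq0|exact: has_value1]. Qed.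

Lemma unit_atM P u g : unit_at P u -> unit_at P g -> unit_at P (u * g).
Proof. by move=> [c c0 h] [d d0 h']; exists (c * d); [exact: mulf_neq0|exact: has_valueM]. Qed.

Lemma unit_atV P u : unit_at P u -> unit_at P u^-1.
Proof. by move=> [c c0 h]; exists c^-1; [rewrite invr_eq0|exact: has_valueV]. Qed.

Lemma unit_at_neq0 P u : unit_at P u -> u != 0.
Proof. by move=> [c c0 h]; exact: has_value_neq0 c0 h. Qed.

Lemma unit_atXz P u (k : int) : unit_at P u -> unit_at P (u ^ k).
Proof.
have hn n (v : function_field X) : unit_at P v -> unit_at P (v ^+ n).
  move=> h; elim: n => [|n IH]; first by rewrite expr0; exact: unit_at1.
  by rewrite exprS; exact: unit_atM.
move=> h; case: k => n; first by rewrite -exprnP; exact: hn.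
by rewrite NegzE -exprnN -exprVn; apply: hn; exact: unit_atV.
Qed.

Lemma has_value0_not_unit P f : has_value P f 0 -> ~ unit_at P f.
Proof. by move=> h [c c0 h']; move: c0; rewrite (has_value_uniq h' h) eqxx. Qed.

Lemma regular_unit_or0 P f : regular_at P f -> unit_at P f \/ has_value P f 0.
Proof.
by move=> [c h]; case: (eqVneq c 0) => [e|c0]; [right; rewrite -e|left; exists c].
Qed.

End Values.

(** * Products of lines divisible by a given form modulo the equation *)

Section Dependence.
Context (K : fieldType) (V : vectType K).

Lemma linear_dependence (T : finType) (w : T -> V) : (dim V < #|T|)%N ->
  exists c : T -> K, \sum_i c i *: w i = 0 /\ exists i, c i != 0.
Proof.
move=> lt; pose Y := [tuple w (enum_val i) | i < #|T|].
have nf : ~~ free Y.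
  apply/negP => /eqP fr; move: lt; rewrite ltnNge -{1}(size_tuple Y) -fr.
  by rewrite -(dimvf V) dimvS // subvf.
have [c [e [i ci]]] : exists c : 'I_#|T| -> K, \sum_i c i *: Y`_i = 0 /\ exists i, c i != 0.
  apply: contrapT => h; case/negP: nf; apply/freeP => c e i.
  by apply/eqP; apply: contrapT => /negP ci; apply: h; exists c; split=> //; exists i.
exists (fun x => c (enum_rank x)); split; last by exists (enum_val i); rewrite enum_valK.
rewrite -[RHS]e (reindex_onto (@enum_val T predT) (@enum_rank T)) /=; last by move=> ? _; rewrite enum_rankK.
rewrite (eq_bigl predT); last by move=> x; rewrite enum_valK eqxx.
apply: eq_bigr => x _; rewrite enum_valK -[in RHS](tnth_nth 0 Y) tnth_mktuple. exact: erefl.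
Qed.

End Dependence.

Lemma mul2_bin2 e : (2 * 'C(e + 2, e) = (e + 2) * (e + 1))%N.
Proof.
rewrite -bin_sub ?leq_addr // addKn addn2 addn1.
by rewrite -(mul_bin_diag e.+2 1) /= bin1.
Qed.

Lemma dim_form (K : fieldType) d : dim (dhomog 3 K d) = 'C(d + 2, d).
Proof. by []. Qed.

Section HomogenizeFactor.
Context (K : closedFieldType).
Implicit Types (la mu : 'I_3 -> K).

(** The [d - size rs] missing roots lie at infinity and account for the factors [lin la]. *)
Lemma homogenize_prod la mu (rs : seq K) d : (size rs <= d)%N ->
  homogenize la mu d (\prod_(r <- rs) ('X - r%:P)) =
  lin la ^+ (d - size rs) * \prod_(r <- rs) lin (fun i => mu i - r * la i).
Proof.
have linB r : lin (fun i => mu i - r * la i) = lin mu - r *: lin la.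
  rewrite /lin scaler_sumr -sumrB; apply: eq_bigr => i _.
  by rewrite scalerA scalerBl.
elim: rs d => [|r rs IH] d; rewrite ?big_nil ?big_cons /=.
  move=> _; rewrite mulr1 subn0 /homogenize (bigD1 0) //= big1 ?addr0 => [|i i0].
    by rewrite coefC eqxx scale1r expr0 mulr1 subn0.
  by rewrite coefC -val_eqE /= in i0 *; rewrite (negbTE i0) scale0r.
case: d => // d; rewrite ltnS subSS => le.
rewrite mulrBl mulrC mul_polyC -scaleNr homogenizeD homogenizeZ homogenizeMX.
rewrite homogenizeS; last by rewrite size_prod_XsubC.
by rewrite !IH // linB scaleNr -!mul_mpolyC; ring.
Qed.

Lemma homogenize_lines d (p : {poly K}) (i j : 'I_3) : i != j -> p != 0 -> (size p <= d.+1)%N ->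
  exists c (us : seq ('I_3 -> K)), [/\ c != 0, size us = d,
    forall u, List.In u us -> exists i, u i != 0
  & homogenize (fun k => (k == i)%:R) (fun k => (k == j)%:R) d p = c *: \prod_(u <- us) lin u].
Proof.
move=> ij p0 sp; have [rs pE] := closed_field_poly_normal p.
set la := fun k => (k == i)%:R : K; set mu := fun k => (k == j)%:R : K.
have sr : (size rs <= d)%N.
  by rewrite -ltnS -(size_prod_XsubC _ id) -(size_scale _ (_ : lead_coef p != 0)) ?lead_coef_eq0 // -pE.
exists (lead_coef p), (nseq (d - size rs) la ++ map (fun r i => mu i - r * la i) rs); split.
- by rewrite lead_coef_eq0.
- by rewrite size_cat size_nseq size_map subnK.
- move=> u; elim: (d - size rs)%N => [|k IH] /=.
    elim: (rs) => //= r s IH [<-|//]; exists j.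
    by rewrite /mu /la eqxx (eq_sym j i) (negbTE ij) mulr0 subr0 oner_neq0.
  by case=> [<-|//]; exists i; rewrite /la eqxx oner_neq0.
rewrite {1}pE homogenizeZ homogenize_prod // big_cat big_map /=; congr (_ *: (_ * _)).
by rewrite big_nseq iter_mulr_1.
Qed.

End HomogenizeFactor.

Section LinesMultiple.
Context (K : closedFieldType) (m : nat) (X : smooth_plane_curve K m).
Implicit Types (G H : {mpoly K[3]}).
Local Notation F := (equation X).
Local Notation I := (ideal_of X).
Local Notation tofr := (to_frac X).

Lemma equation_neq0 : F != 0.
Proof.
apply/eqP => F0; have [|//|i] := @equation_smooth _ _ X (fun=> 1); first by exists 0; rewrite oner_neq0.
  by rewrite F0 meval0.
by rewrite F0 mderiv0 meval0 eqxx.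
Qed.

Lemma form_notin d G : G \is d.-homog -> G != 0 -> (d < m)%N -> G \notin I.
Proof.
move=> hG G0 dm; apply: contra G0 => /ideal_ofP[Q e].
by rewrite -(pihomog_dE hG) e mulrC (pihomogM_small _ (equation_homog X) dm).
Qed.

Lemma form_in d G : G \is (m + d).-homog -> G \in I ->
  exists2 Q, Q \is d.-homog & G = F * Q.
Proof.
move=> hG /ideal_ofP[Q e]; exists (pihomog mdeg d Q); first exact: pihomogP.
by rewrite (homog_cofactor (equation_homog X)) mulrC -?e.
Qed.

(* If [e] is large, there are more products of a binary form of degree [e - b d] with
   [G^b], for [b <= m], and multiples of [F] than [dim S_e]; a linear relation between
   them, divided by the smallest power of [G], is a binary form in the ideal [(G, F)]. *)
Lemma lines_multiple d G : (0 < m)%N -> G \is d.-homog -> G \notin I ->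
  exists (us : seq ('I_3 -> K)) e U, [/\ forall u, List.In u us -> exists i, u i != 0,
    U \is e.-homog, size us = (d + e)%N & tofr (\prod_(u <- us) lin u) = tofr (G * U)].
Proof.
move=> m0 hG GI.
(* The difference [dim S_e - dim S_(e-m)] is [m e + m (3 - m) / 2]. With [e = m d + M] it is smaller
   than [(m + 1) M], the number of products involving a power of [G], because [M] exceeds
   [m^2 d + m (3 - m) / 2]. Also [e - b d >= M] for [b <= m], so polynomials with [M] coefficients
   fit in degree [e - b d]. *)
pose M := (m ^ 2 * d + 2 * m + 1)%N; pose e := (m * d + M)%N.
have me : (m <= e)%N by rewrite /e /M; nia.
pose i0 : 'I_3 := 0; pose i1 : 'I_3 := 1.
pose la k : K := (k == i0)%:R; pose mu k : K := (k == i1)%:R.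
have hw1 (b : 'I_m.+1) (p : {poly K}) : homogenize la mu (e - b * d) p * G ^+ b \is e.-homog.
  have := dhomogM (homogenize_homog la mu (e - b * d) p) (dhomogMn b hG).
  rewrite [(d * b)%N]mulnC subnK // (leq_trans _ (leq_addr _ _)) // leq_mul2r.
  by rewrite -ltnS ltn_ord orbT.
pose S : vectType K := dhomog 3 K (e - m).
pose sb := vbasis (fullv : {vspace S}).
have hw2 (j : 'I_(\dim (fullv : {vspace S}))) : F * mpoly_of_dhomog (tnth sb j) \is e.-homog.
  by have := dhomogM (equation_homog X) (dhomog_is_dhomog (tnth sb j)); rewrite (subnKC me).
pose w (x : 'I_m.+1 * 'I_M + 'I_(\dim (fullv : {vspace S}))) : dhomog 3 K e := match x with
  | inl ba => DHomog (hw1 ba.1 'X^(ba.2))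
  | inr j => DHomog (hw2 j) end.
have [|c [c0 [x cx]]] := @linear_dependence _ _ _ w.
  rewrite card_sum card_prod !card_ord dimvf !dim_form.
  have := mul2_bin2 e; have := mul2_bin2 (e - m).
  by rewrite /e /M; nia.
pose p (b : 'I_m.+1) : {poly K} := \sum_(a < M) c (inl (b, a)) *: 'X^a.
pose B (b : 'I_m.+1) := homogenize la mu (e - b * d) (p b).
pose Q : S := \sum_j c (inr j) *: tnth sb j.
have BE b : B b = \sum_(a < M) c (inl (b, a)) *: homogenize la mu (e - b * d) 'X^a.
  rewrite /B /p (big_morph _ (homogenizeD la mu _) (homogenize0 la mu _)).
  by apply: eq_bigr => a _; rewrite homogenizeZ.
have rel : \sum_b B b * G ^+ b + F * mpoly_of_dhomog Q = 0.
  have := congr1 (@mpoly_of_dhomog _ _ _) c0; rewrite raddf0 raddf_sum big_sumType /= => e0; rewrite -[RHS]e0.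
  congr (_ + _).
    transitivity (\sum_(b < m.+1) \sum_(a < M)
      c (inl (b, a)) *: (homogenize la mu (e - b * d) 'X^a * G ^+ b)).
      apply: eq_bigr => b _; rewrite BE mulr_suml; apply: eq_bigr => a _.
      by rewrite -scalerAl.
    by rewrite pair_bigA /=; apply: eq_bigr => -[b a] _.
  by rewrite raddf_sum mulr_sumr; apply: eq_bigr => j _; rewrite /= -scalerAr.
have pcoef b a : (p b)`_(nat_of_ord a) = c (inl (b, a)).
  rewrite coef_sum (bigD1 a) //= coefZ coefXn eqxx mulr1 big1 ?addr0 // => a' ne.
  rewrite coefZ coefXn; case: eqP => [h|]; last by rewrite mulr0.
  by case/eqP: ne; apply/val_inj.
(* If no binary form occurred, the relation would reduce to [F * Q = 0], and the freeness of the
   basis of [S] would make it trivial. *)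
have [b1 pb1] : exists b, p b != 0.
  apply: contrapT => h; have p0 b : p b = 0.
    by apply/eqP; apply: contrapT => /negP pb; apply: h; exists b.
  have Q0 : Q = 0.
    move: rel; rewrite big1 ?add0r => [|b _]; last by rewrite /B p0 homogenize0 mul0r.
    move/eqP; rewrite mulf_eq0 (negbTE equation_neq0) /= => /eqP Q0.
    exact/val_inj.
  have fr : free sb by exact: basis_free (vbasisP _).
  case: x cx => [[b a]|j]; first by rewrite -pcoef p0 coef0 eqxx.
  suff -> : c (inr j) = 0 by rewrite eqxx.
  have /freeP/(_ (fun j => c (inr j))) h2 := fr; apply: h2; rewrite -[RHS]Q0; apply: eq_bigr => i _.
  by rewrite -tnth_nth.
(* With [b0] minimal, [G ^+ b0] factors out of the relation; it can be cancelled because the ideal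
   is prime and does not contain [G]. What remains says that [B b0] is a multiple of [G] modulo the
   equation. *)
case: (@arg_minnP _ b1 (fun b => p b != 0) (@nat_of_ord _) pb1) => b0 pb0 minb.
have bm : (b0 <= m)%N by rewrite -ltnS.
pose U := \sum_(b < m.+1 | (b0 < b)%N) B b * G ^+ (b - b0.+1).
have sumE : \sum_b B b * G ^+ b = G ^+ b0 * (B b0 + G * U).
  rewrite (bigD1 b0) //= mulrDr [B b0 * _]mulrC; congr (_ + _).
  rewrite /U mulrA -exprSr mulr_sumr [RHS]big_mkcond [LHS]big_mkcond.
  apply: eq_bigr => b _; case: (ltngtP b b0) => [h|h|/val_inj->]; last by rewrite eqxx.
    case: eqP => //= _; have [h0|/minb] := eqVneq (p b) 0; last by rewrite leqNgt h.
    by rewrite /B h0 homogenize0 mul0r.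
  case: eqP => [e1|_]; first by move: h; rewrite e1 ltnn.
  by rewrite /= mulrCA -exprD subnKC.
have BUI : B b0 + G * U \in I.
  have : G ^+ b0 * (B b0 + G * U) \in I.
    apply/ideal_ofP; exists (- mpoly_of_dhomog Q); rewrite -sumE mulNr [_ * F]mulrC.
    by apply/eqP; rewrite -addr_eq0 rel.
  rewrite prime_idealrM => /orP[|//].
  elim: (nat_of_ord b0) => [|k IH]; first by rewrite expr0 (negbTE (equation_proper X)).
  by rewrite exprS prime_idealrM (negbTE GI) => /IH.
have dB : (b0 * d + d + m <= e)%N by rewrite /e /M; nia.
have sp : (size (p b0) <= (e - b0 * d).+1)%N.
  have : (size (p b0) <= M)%N.
    apply: (big_ind (fun q : {poly K} => size q <= M)%N); rewrite ?size_poly0 //.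
      by move=> q r sq sr; rewrite (leq_trans (size_polyD _ _)) // geq_max sq.
    by move=> a _; rewrite (leq_trans (size_scale_leq _ _)) // size_polyXn.
  by rewrite /e; nia.
have i01 : i0 != i1 by [].
have [c1 [us [c10 sus hus eB]]] := homogenize_lines i01 pb0 sp.
exists us, (e - b0.+1 * d)%N, (- c1^-1 *: U); split=> //.
- rewrite rpredZ // rpred_sum // => b hb.
  have := dhomogM (homogenize_homog la mu (e - b * d) (p b)) (dhomogMn (b - b0.+1) hG).
  suff -> : (e - b * d + d * (b - b0.+1) = e - b0.+1 * d)%N by [].
  have bb : (b <= m)%N by rewrite -ltnS.
  have bd : (b * d <= e)%N by rewrite /e (leq_trans _ (leq_addr _ _)) // leq_mul2r bb orbT.
  by rewrite [(d * _)%N]mulnC mulnBl; have : (b0.+1 * d <= b * d)%N; [rewrite leq_mul2r hb orbT|lia].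
- by rewrite sus mulSn; lia.
apply/eqP; rewrite -subr_eq0 -rmorphB to_frac_eq0.
have -> : \prod_(u <- us) lin u - G * (- c1^-1 *: U) = c1^-1%:MP * (B b0 + G * U).
  by rewrite /B eB mul_mpolyC scalerDr scalerA mulVf // scale1r scalerAr scaleNr mulrN opprK.
by rewrite idealMr.
Qed.

End LinesMultiple.

Section LocalForms.
Context (K : closedFieldType) (m : nat) (X : smooth_plane_curve K m).
Implicit Types (P : point X) (f g t u : function_field X) (G H : {mpoly K[3]}).
Local Notation F := (equation X).
Local Notation I := (ideal_of X).
Local Notation tofr := (to_frac X).

Lemma pcoords_neq0 P : exists i, pcoords P i != 0.
Proof.
have /existsP[i /andP[/eqP h _]] := valP (val P).
by exists i; rewrite /pcoords /coords h oner_neq0.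
Qed.

Definition chart P : {mpoly K[3]} := 'X_(xchoose (pcoords_neq0 P)).

Lemma chart_homog P : chart P \is 1.-homog. Proof. exact: X_homog. Qed.

Lemma chart_neq0 P : (chart P).@[pcoords P] != 0.
Proof. by rewrite /chart mevalXU (xchooseP (pcoords_neq0 P)). Qed.

Lemma chartX_homog P d : chart P ^+ d \is d.-homog.
Proof. by have := dhomogMn d (chart_homog P); rewrite mul1n. Qed.

Lemma chartX_neq0 P d : (chart P ^+ d).@[pcoords P] != 0.
Proof. by rewrite rmorphXn expf_neq0 // chart_neq0. Qed.

Lemma chartX_notin P d : chart P ^+ d \notin I.
Proof. exact: meval_notin (chartX_neq0 P d). Qed.

(* The germ at [P] of the degree-[d] form [G], trivialised by a power of a coordinate
   not vanishing at [P]. *)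
Definition form_at P d G : function_field X := ffrac X G (chart P ^+ d).

Lemma form_atE P d G : G \is d.-homog -> val (form_at P d G) = tofr G / tofr (chart P ^+ d).
Proof. by move=> hG; rewrite (ffracE hG) ?chartX_homog ?chartX_notin. Qed.

Lemma form_at_tofr P d G H : tofr G = tofr H -> form_at P d G = form_at P d H.
Proof. by move=> e; rewrite /form_at /ffrac e. Qed.

Lemma form_atM P d e G H : G \is d.-homog -> H \is e.-homog ->
  form_at P (d + e) (G * H) = form_at P d G * form_at P e H.
Proof.
move=> hG hH; apply: val_inj.
have -> : val (form_at P d G * form_at P e H) = val (form_at P d G) * val (form_at P e H) by [].
rewrite !form_atE ?dhomogM // exprD !to_fracM.
by rewrite frac_mul.
Qed.

Lemma form_atD P d G H : G \is d.-homog -> H \is d.-homog ->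
  form_at P d (G + H) = form_at P d G + form_at P d H.
Proof.
move=> hG hH; apply: val_inj.
have -> : val (form_at P d G + form_at P d H) = val (form_at P d G) + val (form_at P d H) by [].
by rewrite !form_atE ?rpredD // rmorphD mulrDl.
Qed.

Lemma form_at_val P d G : G \is d.-homog ->
  has_value P (form_at P d G) (G.@[pcoords P] / (chart P ^+ d).@[pcoords P]).
Proof. by move=> hG; apply: has_value_frac hG (chartX_homog P d) (chartX_neq0 P d). Qed.

Lemma form_at_reg P d G : G \is d.-homog -> regular_at P (form_at P d G).
Proof. by move=> hG; eexists; exact: form_at_val. Qed.

Lemma form_at_unit P d G : G \is d.-homog -> G.@[pcoords P] != 0 -> unit_at P (form_at P d G).
Proof.
move=> hG G0; exists (G.@[pcoords P] / (chart P ^+ d).@[pcoords P]); last exact: form_at_val.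
by rewrite mulf_neq0 // invr_eq0 chartX_neq0.
Qed.

Lemma form_at_val0 P d G : G \is d.-homog -> G.@[pcoords P] = 0 -> has_value P (form_at P d G) 0.
Proof. by move=> hG G0; have := form_at_val P hG; rewrite G0 mul0r. Qed.

Lemma form_at_val0E P d G : G \is d.-homog -> has_value P (form_at P d G) 0 -> G.@[pcoords P] = 0.
Proof.
move=> hG /(has_value_uniq (form_at_val P hG))/eqP.
by rewrite mulf_eq0 invr_eq0 (negbTE (chartX_neq0 P d)) orbF => /eqP.
Qed.

Lemma form_at_eq0 P d G : G \is d.-homog -> (form_at P d G == 0) = (G \in I).
Proof.
move=> hG; rewrite -(inj_eq val_inj) form_atE //.
have -> : val (0 : function_field X) = 0 by [].
by rewrite mulf_eq0 invr_eq0 !to_frac_eq0 (negbTE (chartX_notin P d)) orbF.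
Qed.

Lemma form_at_I P d G : G \is d.-homog -> G \in I -> form_at P d G = 0.
Proof. by move=> hG GI; apply/eqP; rewrite form_at_eq0. Qed.

(** The chart itself has germ 1, so the degree of a form can be raised without changing its germ;
    this serves where a decomposition needs positive degree. *)
Lemma form_at_chart P d e G : G \is d.-homog ->
  form_at P (d + e) (G * chart P ^+ e) = form_at P d G.
Proof.
move=> hG; rewrite form_atM ?chartX_homog //.
suff -> : form_at P e (chart P ^+ e) = 1 by rewrite mulr1.
apply: val_inj; rewrite form_atE ?chartX_homog // divff //.
by rewrite to_frac_eq0 chartX_notin.
Qed.

Lemma ffrac_form_at P d G H : G \is d.-homog -> H \is d.-homog -> H \notin I ->
  ffrac X G H = form_at P d G / form_at P d H.
Proof.
move=> hG hH HI; apply: (mulIf (_ : form_at P d H != 0)); first by rewrite form_at_eq0.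
rewrite mulfVK ?form_at_eq0 //; apply: val_inj.
have -> : val (ffrac X G H * form_at P d H) = val (ffrac X G H) * val (form_at P d H) by [].
rewrite !form_atE // (ffracE hG hH HI) frac_mul.
have h1 : tofr H != 0 by rewrite to_frac_eq0.
have h2 : tofr (chart P ^+ d) != 0 by rewrite to_frac_eq0 chartX_notin.
by apply/(frac_eqP _ _ (mulf_neq0 h1 h2) h2); ring.
Qed.

(** Points carry normalized coordinates, whereas vectors such as [A + t B] are arbitrary
    representatives; this relation connects the two. *)
Definition ray P (A : 'I_3 -> K) := exists2 c, c != 0 & forall i, pcoords P i = c * A i.

Lemma ray_meval P A d G : ray P A -> G \is d.-homog -> (G.@[pcoords P] == 0) = (G.@[A] == 0).
Proof.
move=> [c c0 h] hG; rewrite (meval_homog hG h) mulf_eq0 expf_eq0 (negbTE c0).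
by rewrite andbF.
Qed.

Lemma ray_pcoords P : ray P (pcoords P).
Proof. by exists 1 => [|i]; rewrite ?oner_neq0 ?mul1r. Qed.

End LocalForms.

Section Uniformizers.
Context (K : closedFieldType) (m : nat) (X : smooth_plane_curve K m) (hm : (0 < m)%N).
Implicit Types (P : point X) (f g t u : function_field X) (G H : {mpoly K[3]}).
Local Notation F := (equation X).
Local Notation I := (ideal_of X).

Section AtFrame.
Context P A B C la mu nu (fr : frame A B C la mu nu) (PA : ray P A).

(** The restriction to the line has no constant term, so its lift is a multiple of [lin mu]. *)
Lemma vanishing_decomp d G : G \is d.+1.-homog -> G.@[A] = 0 ->
  exists G1 G2, [/\ G1 \is d.-homog, G2 \is d.-homog & G = lin nu * G1 + lin mu * G2].
Proof.
move=> hG GA; have [G1 hG1 e] := frame_decomp_homog fr hG.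
have /factor_theorem[q qE] : root (restriction A B G) 0.
  by rewrite rootE horner_coef0 restriction_coef0 GA.
exists G1, (homogenize la mu d q); split; rewrite ?homogenize_homog //.
by rewrite {1}e qE subr0 homogenizeMX.
Qed.

(* On the curve [mu = - nu F1 / F2] near [A], so [nu] alone generates the maximal ideal. *)
Lemma frame_uniformizer F1 F2 : F1 \is m.-1.-homog -> F2 \is m.-1.-homog ->
  F = lin nu * F1 + lin mu * F2 -> F2.@[A] != 0 ->
  uniformizer P (form_at P 1 (lin nu)).
Proof.
move=> hF1 hF2 eF F20; have [_ [_ [nuA _ _]]] := frame_dual fr.
have hn := lin_homog nu; have hmu := lin_homog mu.
have nuP : (lin nu).@[pcoords P] = 0.
  by apply/eqP; rewrite (ray_meval PA hn) meval_lin nuA.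
split; first exact: form_at_val0.
move=> f /has_value_cases[d [G [H [hG hH HP -> /esym e0]]]].
have GP : G.@[pcoords P] = 0.
  by move/eqP: e0; rewrite mulf_eq0 invr_eq0 (negbTE HP) orbF => /eqP.
rewrite (ffrac_form_at P hG hH (meval_notin HP)) -(form_at_chart P 1 hG).
have hGh := dhomogM hG (chartX_homog P 1).
have [||G1 [G2 [hG1 hG2 ->]]] := @vanishing_decomp d (G * chart P ^+ 1).
- by move: hGh; rewrite addn1.
- by apply/eqP; rewrite -(ray_meval PA hGh) mevalM GP mul0r.
have u2 : unit_at P (form_at P m.-1 F2).
  by apply: form_at_unit => //; rewrite (ray_meval PA hF2).
have uH : unit_at P (form_at P d H) by exact: form_at_unit.
have em : form_at P 1 (lin mu) =
    - (form_at P 1 (lin nu) * form_at P m.-1 F1 / form_at P m.-1 F2).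
  have h : form_at P (1 + m.-1) (lin nu * F1 + lin mu * F2) = 0.
    apply: form_at_I; first by rewrite rpredD ?dhomogM.
    by rewrite -eF; apply/ideal_ofP; exists 1; rewrite mul1r.
  move: h; rewrite form_atD ?dhomogM // !form_atM // => h.
  apply: (mulIf (unit_at_neq0 u2)); rewrite mulNr mulfVK ?(unit_at_neq0 u2) //.
  by apply/eqP; rewrite -addr_eq0 addrC; apply/eqP.
exists ((form_at P d G1 - form_at P m.-1 F1 / form_at P m.-1 F2 * form_at P d G2)
        / form_at P d H).
  apply: regularM; last exact: unit_at_regular (unit_atV uH).
  apply: regularD; first exact: form_at_reg.
  rewrite -mulNr -mulN1r; apply: regularM; last exact: form_at_reg.
  apply: regularM; first by exists (-1); apply: has_valueN; exact: has_value1.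
  by apply: regularM; [exact: form_at_reg|exact: unit_at_regular (unit_atV u2)].
rewrite addnC form_atD ?dhomogM // !form_atM // em.
exact: frac_elim.
Qed.

(** By the product rule the gradient of [F] at [A] is [F1(A) nu + F2(A) mu], since [nu] and [mu]
    vanish at [A]; the Jacobian criterion forbids it to be zero. *)
Lemma frame_smooth F1 F2 : F = lin nu * F1 + lin mu * F2 ->
  F1.@[A] != 0 \/ F2.@[A] != 0.
Proof.
move=> eF; have [[laA _ _] [[muA _ _] [nuA _ _]]] := frame_dual fr.
have [i Ai] : exists i, A i != 0 by apply: (@dot_neq0 _ _ la); rewrite dotC laA oner_neq0.
have [||j] := @equation_smooth _ _ X A; first by exists i.
  by rewrite eF mevalD !mevalM !meval_lin nuA muA !mul0r addr0.
rewrite eF mderivD !mderivM !mderiv_lin mevalD !mevalD !mevalM !mevalC !meval_lin nuA muA.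
rewrite !mul0r !addr0 => h.
case: (eqVneq F1.@[A] 0) => [e1|]; last by left.
by right; apply: contraNneq h => ->; rewrite e1 !mulr0 addr0.
Qed.

End AtFrame.

Lemma frame_at P (u : 'I_3 -> K) : (exists i, u i != 0) -> dot u (pcoords P) = 0 ->
  exists B C la mu, frame (pcoords P) B C la mu u.
Proof. by move=> u0 uP; apply: frame_exists => //; exact: pcoords_neq0. Qed.

Lemma some_frame_at P : exists B C la mu nu, frame (pcoords P) B C la mu nu.
Proof.
have [u u0 uP] := orth_exists (pcoords_neq0 P).
by have [B [C [la [mu fr]]]] := frame_at u0 uP; exists B, C, la, mu, u.
Qed.

Lemma pcoords_F P : F.@[pcoords P] = 0. Proof. exact/eqP/(valP P). Qed.

Lemma uniformizer_exists P : exists2 u : 'I_3 -> K, exists i, u i != 0 &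
  uniformizer P (form_at P 1 (lin u)).
Proof.
have [B [C [la [mu [nu fr]]]]] := some_frame_at P.
have hF : F \is m.-1.+1.-homog by rewrite prednK // equation_homog.
have [F1 [F2 [h1 h2 eF]]] := vanishing_decomp fr hF (pcoords_F P).
have fr' := frame_swapBC fr.
case: (frame_smooth fr eF) => h.
  exists mu; first exact: frame_line_neq0 fr'.
  by apply: (frame_uniformizer fr' (ray_pcoords P) h2 h1) => //; rewrite addrC.
exists nu; first exact: frame_line_neq0 fr.
exact: (frame_uniformizer fr (ray_pcoords P) h1 h2).
Qed.

End Uniformizers.

(** * Orders of functions at points *)

Section Valuations.
Context (K : closedFieldType) (m : nat) (X : smooth_plane_curve K m) (hm : (1 < m)%N).
Implicit Types (P : point X) (f g t u : function_field X) (G H : {mpoly K[3]}).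
Local Notation F := (equation X).
Local Notation I := (ideal_of X).
Local Notation tofr := (to_frac X).

Let m0 : (0 < m)%N. Proof. exact: ltnW. Qed.

Lemma line_notin (w : 'I_3 -> K) : (exists i, w i != 0) -> lin w \notin I.
Proof. by move=> /lin0P w0; apply: (form_notin X (lin_homog w)). Qed.

Lemma uniformizers_assoc P t t' : uniformizer P t -> uniformizer P t' -> t != 0 ->
  exists2 u, unit_at P u & t = u * t'.
Proof.
move=> [h1 h2] [h1' h2'] t0; have [g [c hc] e] := h2' _ h1; have [g' [c' hc'] e'] := h2 _ h1'.
exists g; rewrite // ; exists c; rewrite //.
have gg : g * g' = 1.
  by apply: (mulIf t0); rewrite mul1r -mulrA -e' -e.
have cc : c * c' = 1 by apply: (has_value_uniq (has_valueM hc hc')); rewrite gg; exact: has_value1.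
by apply: contraTneq isT => c0; move/eqP: cc; rewrite c0 mul0r eq_sym oner_eq0.
Qed.

Lemma line_uniformizer P : exists t, uniformizer P t /\ t != 0.
Proof.
have [w w0 h] := uniformizer_exists m0 P; exists (form_at P 1 (lin w)); split=> //.
by rewrite form_at_eq0 ?lin_homog // line_notin.
Qed.

Lemma uniformizer_neq0 P t : uniformizer P t -> t != 0.
Proof.
move=> h; have [t' [h' t0']] := line_uniformizer P.
by have [u _ e] := uniformizers_assoc h' h t0'; apply: contraNneq t0' => t0; rewrite e t0 mulr0.
Qed.

(** Fixing one uniformizer per point turns orders into equations [f = u * unif P ^ k]. The default 0
    is ruled out by [unifP]. *)
Definition unif P : function_field X :=
  if pselect (exists t, uniformizer P t) is left e then projT1 (cid e) else 0.

Lemma unifP P : uniformizer P (unif P).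
Proof.
rewrite /unif; case: pselect => [e|[]]; first exact: projT2 (cid e).
by have [t [h _]] := line_uniformizer P; exists t.
Qed.

Lemma unif_neq0 P : unif P != 0. Proof. exact/uniformizer_neq0/unifP. Qed.

Lemma ord_at_unif P f k : ord_at P f k <-> exists2 u, unit_at P u & f = u * unif P ^ k.
Proof.
split=> [[t [u [ht hu ->]]]|[u hu ->]]; last by exists (unif P), u; split=> //; exact: unifP.
have [w hw ->] := uniformizers_assoc ht (unifP P) (uniformizer_neq0 ht).
exists (u * w ^ k); first by apply: unit_atM => //; exact: unit_atXz.
by rewrite expfzMl mulrA.
Qed.

Lemma unif_Xn_val P n : (0 < n)%N -> has_value P (unif P ^+ n) 0.
Proof.
case: n => // n _; rewrite exprS.
have [h _] := unifP P; have [c hc] := regularX n (ex_intro _ 0 h : regular_at P (unif P)).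
by rewrite -(mul0r c); exact: has_valueM.
Qed.

Lemma ord_at_uniq P f k l : ord_at P f k -> ord_at P f l -> k = l.
Proof.
wlog kl : k l / k <= l => [hw h1 h2|].
  by case/orP: (le_total k l) => h; [exact: hw|symmetry; exact: hw].
move=> /ord_at_unif[u hu ->] /ord_at_unif[w hw e]; apply/eqP; apply: contrapT => /negP ne.
have [n n0 ln] : exists2 n : nat, (0 < n)%N & l = k + n%:Z.
  by exists `|l - k|%N; lia.
have tk : unif P ^ k != 0 by rewrite expfz_neq0 // unif_neq0.
have e2 : u = w * unif P ^+ n.
  by apply: (mulIf tk); rewrite e ln expfzDr ?unif_neq0 // [unif P ^ k * _]mulrC mulrA.
have [c hc] := unit_at_regular hw.
have h0 : has_value P u 0 by rewrite e2 -(mulr0 c); apply: has_valueM => //; exact: unif_Xn_val.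
exact: has_value0_not_unit h0 hu.
Qed.

Lemma ord_at_unit P u : unit_at P u -> ord_at P u 0.
Proof. by move=> hu; apply/ord_at_unif; exists u; rewrite // expr0z mulr1. Qed.

Lemma ord_atM P f g k l : ord_at P f k -> ord_at P g l -> ord_at P (f * g) (k + l).
Proof.
move=> /ord_at_unif[u hu ->] /ord_at_unif[w hw ->]; apply/ord_at_unif; exists (u * w); first exact: unit_atM.
by rewrite expfzDr ?unif_neq0 // mulrACA.
Qed.

Lemma ord_atV P f k : ord_at P f k -> ord_at P f^-1 (- k).
Proof.
move=> /ord_at_unif[u hu ->]; apply/ord_at_unif; exists u^-1; first exact: unit_atV.
by rewrite invfM invr_expz.
Qed.

Lemma ord_at_neq0 P f k : ord_at P f k -> f != 0.
Proof.
move=> /ord_at_unif[u hu ->]; rewrite mulf_neq0 //; first exact: unit_at_neq0 hu.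
by rewrite expfz_neq0 // unif_neq0.
Qed.

(** Otherwise [F] would be the product of a line and a form of degree [m - 1], both of degree less
    than [m] and hence outside the prime ideal. *)
Lemma equation_not_line A B C la mu nu : frame A B C la mu nu -> restriction A B F != 0.
Proof.
move=> fr; apply/eqP => e.
have hF : F \is m.-1.+1.-homog by rewrite prednK // equation_homog.
have [G1 h1 eF] := restriction_eq0 fr hF e.
have : lin nu * G1 \in I by rewrite -eF; apply/ideal_ofP; exists 1; rewrite mul1r.
have := equation_neq0 X; rewrite {1}eF mulf_eq0 negb_or => /andP[n0 g0].
rewrite prime_idealrM (negbTE (form_notin X (lin_homog nu) n0 hm)).
by rewrite (negbTE (form_notin X h1 g0 _)) // prednK.
Qed.

Lemma form_at1 P : form_at P 0 1 = 1.
Proof.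
apply: val_inj; rewrite form_atE ?dhomog1 // expr0 divff //.
by rewrite to_frac1 oner_neq0.
Qed.

(** Lifting the factorization gives [F = nu F1 + mu^k Q] with [Q(A) <> 0]. For [k = 1] this makes
    [nu] a uniformizer. For [k > 1] smoothness forces [F1(A) <> 0], so [mu] is a uniformizer and
    [nu = - mu^k Q / F1] on the curve. *)
Lemma line_order P A B C la mu nu k q : frame A B C la mu nu -> ray P A ->
  restriction A B F = q * 'X^k -> q`_0 != 0 -> (0 < k)%N ->
  ord_at P (form_at P 1 (lin nu)) k /\ ((1 < k)%N -> uniformizer P (form_at P 1 (lin mu))).
Proof.
move=> fr PA rF q0 k0.
have hF : F \is m.-1.+1.-homog by rewrite prednK // equation_homog.
have [F1 hF1 eF] := frame_decomp_homog fr hF.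
have [_ [[muA _ _] [nuA _ _]]] := frame_dual fr.
have qn0 : q != 0 by apply: contraNneq q0 => ->; rewrite coef0.
have [km sq] : (k <= m)%N /\ (size q <= (m - k).+1)%N.
  have [] := restriction_coef A B (equation_homog X); rewrite rF size_Mmonic ?monicXn // size_polyXn => h _.
  by have : (0 < size q)%N by [rewrite size_poly_gt0]; lia.
pose Q := homogenize la mu (m - k) q.
have hQ : Q \is (m - k).-homog by exact: homogenize_homog.
have QA : Q.@[A] != 0 by rewrite (homogenize_meval0 fr).
have hmu : lin mu ^+ k \is k.-homog by have := dhomogMn k (lin_homog mu); rewrite mul1n.
have eF' : F = lin nu * F1 + lin mu ^+ k * Q.
  by rewrite {1}eF rF prednK // -{1}(subnK km) homogenizeMXn.
have uQ : unit_at P (form_at P (m - k) Q) by apply: form_at_unit; rewrite // (ray_meval PA hQ).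
have hk1 : lin mu ^+ k.-1 * Q \is m.-1.-homog.
  have := dhomogM (dhomogMn k.-1 (lin_homog mu)) hQ; rewrite mul1n.
  by have -> : (k.-1 + (m - k) = m.-1)%N by lia.
have eF2 : F = lin nu * F1 + lin mu * (lin mu ^+ k.-1 * Q).
  by rewrite mulrA -exprS prednK.
case: (eqVneq k 1%N) => [k1|kn1].
  split; last by rewrite k1.
  rewrite k1 /=; exists (form_at P 1 (lin nu)), 1; rewrite mul1r expr1z; split=> //; last exact: unit_at1.
  apply: (frame_uniformizer fr PA hF1 hk1 eF2).
  by rewrite k1 expr0 mul1r.
have k2 : (1 < k)%N by rewrite ltn_neqAle eq_sym kn1.
have F1A : F1.@[A] != 0.
  case: (frame_smooth fr eF2) => //.
  rewrite mevalM rmorphXn /= meval_lin muA expr0n mulf_eq0.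
  by rewrite -subn1 subn_eq0 leqNgt k2 eqxx.
have um : uniformizer P (form_at P 1 (lin mu)).
  apply: (frame_uniformizer (frame_swapBC fr) PA hk1 hF1) => //.
  by rewrite addrC.
split=> //.
have uF1 : unit_at P (form_at P m.-1 F1) by apply: form_at_unit; rewrite // (ray_meval PA hF1).
have rel : form_at P 1 (lin nu) * form_at P m.-1 F1 + form_at P 1 (lin mu) ^+ k * form_at P (m - k) Q = 0.
  have ek : form_at P k (lin mu ^+ k) = form_at P 1 (lin mu) ^+ k.
    elim: (k) => [|j IH]; last first.
      rewrite !exprS -(add1n j) form_atM ?lin_homog ?IH //.
      by have := dhomogMn j (lin_homog mu); rewrite mul1n.
    by rewrite !expr0 form_at1.
  rewrite -ek -!form_atM ?lin_homog //.
  have e1 : (1 + m.-1 = m)%N by rewrite add1n prednK.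
  have e2 : (k + (m - k) = m)%N by exact: subnKC.
  rewrite e1 e2 -form_atD.
  - apply: form_at_I; first by rewrite -eF' equation_homog.
    by rewrite -eF'; apply/ideal_ofP; exists 1; rewrite mul1r.
  - by rewrite -e1 in hF1 *; exact: dhomogM (lin_homog _) hF1.
  - by have := dhomogM hmu hQ; rewrite e2.
exists (form_at P 1 (lin mu)), (- (form_at P (m - k) Q / form_at P m.-1 F1)); split=> //.
  have [c c0 hc] := unit_atM uQ (unit_atV uF1).
  by exists (- c); [rewrite oppr_eq0|exact: has_valueN].
apply: (mulIf (unit_at_neq0 uF1)); move/eqP: rel; rewrite addr_eq0 => /eqP->.
by rewrite !mulNr mulrAC mulfVK ?(unit_at_neq0 uF1) // mulrC.
Qed.

Lemma restriction_factor A B C la mu nu : frame A B C la mu nu -> exists k q,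
  restriction A B F = q * 'X^k /\ q`_0 != 0.
Proof.
move=> fr; have [k [q qr e]] := multiplicity_XsubC (restriction A B F) 0.
exists k, q; split; first by rewrite e subr0.
by move: qr; rewrite (equation_not_line fr) /= rootE horner_coef0.
Qed.

Lemma line_ord_exists P w : (exists i, w i != 0) -> exists k : nat, ord_at P (form_at P 1 (lin w)) k.
Proof.
move=> w0; case: (eqVneq (dot w (pcoords P)) 0) => [wP|wP]; last first.
  by exists 0%N; apply: ord_at_unit; apply: form_at_unit; rewrite ?lin_homog // meval_lin.
have [B [C [la [mu fr]]]] := frame_at w0 wP.
have [k [q [e q0]]] := restriction_factor fr.
exists k; have [|//] := line_order fr (ray_pcoords P) e q0.
rewrite lt0n; apply: contraNneq q0 => k0.
by have := restriction_coef0 (pcoords P) B F; rewrite pcoords_F e k0 expr0 mulr1 => ->.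
Qed.

(* Multiples of a germ bound the number of times a uniformizer can be divided out. *)
Lemma ord_of_factor P f g j : regular_at P f -> regular_at P g ->
  ord_at P (g * f) (Posz j) -> exists i : nat, ord_at P f i.
Proof.
elim: j f => [|j IH] f rf rg h.
  case: (regular_unit_or0 rf) => [uf|f0]; first by exists 0%N; exact: ord_at_unit.
  move: h => /ord_at_unif[u hu]; rewrite expr0z mulr1 => e.
  have [c hc] := rg; have : has_value P u 0 by rewrite -e -(mulr0 c); exact: has_valueM.
  by move/has_value0_not_unit; case.
case: (regular_unit_or0 rf) => [uf|f0]; first by exists 0%N; exact: ord_at_unit.
have [f' rf' e] := (unifP P).2 _ f0.
have [|i hi] := IH f' rf' rg.
  move: h => /ord_at_unif[u hu e2]; apply/ord_at_unif; exists u => //.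
  apply: (mulIf (unif_neq0 P)); rewrite -mulrA -e e2 -mulrA -exprSzr ?unif_neq0 //.
exists i.+1; rewrite e -addn1 PoszD; apply: ord_atM => //.
by apply/ord_at_unif; exists 1; [exact: unit_at1|rewrite mul1r expr1z].
Qed.

Lemma prod_lines_homog (us : seq ('I_3 -> K)) : \prod_(w <- us) lin w \is (size us).-homog.
Proof.
elim: us => [|w us IH]; first by rewrite big_nil dhomog1.
by rewrite big_cons; have := dhomogM (lin_homog w) IH; rewrite add1n.
Qed.

(** A product of lines has a finite order by [line_order], and [G] divides such a product modulo the
    equation, so the descent of [ord_of_factor] terminates. *)
Lemma form_ord_exists P d G : G \is d.-homog -> G \notin I ->
  exists k : nat, ord_at P (form_at P d G) k.
Proof.
move=> hG GI; have [us [e [U [us0 hU su eU]]]] := lines_multiple m0 hG GI.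
have [k hk] : exists k : nat, ord_at P (form_at P (size us) (\prod_(w <- us) lin w)) k.
  elim: (us) us0 => [|w s IH] us0.
    by exists 0%N; rewrite big_nil form_at1; exact/ord_at_unit/unit_at1.
  have [k hk] := IH (fun w h => us0 w (or_intror h)).
  have [l hl] := line_ord_exists P (us0 w (or_introl erefl)).
  exists (l + k)%N; rewrite big_cons /= -(add1n (size s)) form_atM ?lin_homog ?prod_lines_homog // PoszD.
  exact: ord_atM.
apply: (@ord_of_factor P _ (form_at P e U) k); try exact: form_at_reg.
by rewrite mulrC -form_atM // -su -(form_at_tofr P _ eU).
Qed.

Lemma ord_at_exists P f : f != 0 -> exists k, ord_at P f k.
Proof.
have [d [G [H [hG hH HI ->]]]] := ff_cases f; rewrite (ffrac_form_at P hG hH HI) => f0.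
have GI : G \notin I.
  by rewrite -(form_at_eq0 P hG); apply: contraNneq f0 => ->; rewrite mul0r.
have [k hk] := form_ord_exists P hG GI; have [l hl] := form_ord_exists P hH HI.
by exists (k%:Z - l%:Z); apply: ord_atM => //; exact: ord_atV.
Qed.

(** The zero function has no order and receives the default 0, hence the hypotheses [f != 0] in the
    rules below. *)
Definition val_at P f : int :=
  if pselect (exists k, ord_at P f k) is left e then projT1 (cid e) else 0.

Lemma val_atP P f : f != 0 -> ord_at P f (val_at P f).
Proof.
by move=> f0; rewrite /val_at; case: pselect => [e|[]]; [exact: projT2 (cid e)|exact: ord_at_exists].
Qed.

Lemma val_at_eq P f k : ord_at P f k -> val_at P f = k.
Proof. by move=> h; exact: ord_at_uniq (val_atP P (ord_at_neq0 h)) h. Qed.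

Lemma val_atM P f g : f != 0 -> g != 0 -> val_at P (f * g) = val_at P f + val_at P g.
Proof. by move=> f0 g0; apply: val_at_eq; apply: ord_atM; exact: val_atP. Qed.

Lemma val_atV P f : f != 0 -> val_at P f^-1 = - val_at P f.
Proof. by move=> f0; apply: val_at_eq; apply: ord_atV; exact: val_atP. Qed.

Lemma val_at1 P : val_at P 1 = 0.
Proof. exact/val_at_eq/ord_at_unit/unit_at1. Qed.

Lemma val_atXz P f (k : int) : f != 0 -> val_at P (f ^ k) = k * val_at P f.
Proof.
move=> f0; have hn n : val_at P (f ^+ n) = n%:Z * val_at P f.
  elim: n => [|n IH]; first by rewrite expr0 val_at1 mul0r.
  by rewrite exprS val_atM ?expf_neq0 // IH intS; ring.
case: k => n; first by rewrite -exprnP hn.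
by rewrite NegzE -exprnN val_atV ?expf_neq0 // hn mulNr.
Qed.

(** Unlike [k <= val_at P f], this condition holds for [f = 0] whatever [k] is, so it is stable
    under linear combinations. *)
Definition vge P (k : int) f := regular_at P (f * unif P ^ (- k)).

Lemma vge0 P k : vge P k 0.
Proof. by rewrite /vge mul0r; exact: regular0. Qed.

Lemma vgeD P k f g : vge P k f -> vge P k g -> vge P k (f + g).
Proof. by rewrite /vge mulrDl; exact: regularD. Qed.

Lemma vgeZ P k c f : vge P k f -> vge P k (c *: f).
Proof. by move=> h; rewrite /vge -[c *: f]/(_ * f) -mulrA; exact: regularZ. Qed.

Lemma regular_val P f : f != 0 -> regular_at P f <-> 0 <= val_at P f.
Proof.
move=> f0; have /ord_at_unif[u hu e] := val_atP P f0; split=> [[c rf]|].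
  rewrite leNgt; apply/negP => lt.
  have e2 : u = f * unif P ^+ `|val_at P f|%N.
    rewrite {1}e exprnP -mulrA -expfzDr ?unif_neq0 //.
    have -> : val_at P f + `|val_at P f|%N = 0 by lia.
    by rewrite expr0z mulr1.
  apply: (@has_value0_not_unit _ _ _ P u) => //; rewrite e2 -(mulr0 c); apply: has_valueM => //.
  by apply: unif_Xn_val; lia.
case: (val_at P f) e => // n e _; rewrite e -exprnP.
apply: regularM; first exact: unit_at_regular.
by apply: regularX; exists 0; case: (unifP P).
Qed.

Lemma vgeP P k f : f != 0 -> vge P k f <-> k <= val_at P f.
Proof.
move=> f0; have t0 : unif P ^ (- k) != 0 by apply: expfz_neq0; exact: unif_neq0.
rewrite /vge (regular_val P (mulf_neq0 f0 t0)) (val_atM P f0 t0) (val_atXz P _ (unif_neq0 P)).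
have -> : val_at P (unif P) = 1.
  by apply: val_at_eq; apply/ord_at_unif; exists 1; [exact: unit_at1|rewrite mul1r expr1z].
by rewrite mulr1 subr_ge0.
Qed.

Lemma val_unit P u : unit_at P u -> val_at P u = 0.
Proof. by move=> hu; apply: val_at_eq; exact: ord_at_unit. Qed.

Lemma has_value0_val P f : f != 0 -> has_value P f 0 <-> 1 <= val_at P f.
Proof.
move=> f0; split=> [h|h].
  have := (regular_val P f0).1 (ex_intro _ 0 h); rewrite le_eqVlt => /predU1P[e|//].
  have /ord_at_unif[u hu] := val_atP P f0; rewrite -e expr0z mulr1 => fu.
  by rewrite fu in h; case: (has_value0_not_unit h hu).
have rf : regular_at P f by apply/regular_val => //; exact: le_trans h.
by case: (regular_unit_or0 rf) => // /val_unit e; rewrite e in h.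
Qed.

End Valuations.

Lemma normalized_uniq (K : fieldType) (u v : 'rV[K]_3) c : normalized u -> normalized v ->
  c != 0 -> (forall j, u 0 j = c * v 0 j) -> u = v.
Proof.
move=> /existsP[i /andP[/eqP Pi /forallP Pj]] /existsP[i' /andP[/eqP Qi /forallP Qj]] c0 e.
have ii : i = i'.
  apply/val_inj; apply/eqP; rewrite eqn_leq; apply/andP; split; rewrite leqNgt; apply/negP => lt.
    by have := implyP (Pj i') lt; rewrite e Qi mulr1; exact/negP.
  have := implyP (Qj i) lt; move: Pi; rewrite e => Pi /eqP Q0.
  by move/eqP: Pi; rewrite Q0 mulr0 eq_sym oner_eq0.
by apply/rowP => j; have := e i; rewrite Pi ii Qi mulr1 e => <-; rewrite mul1r.
Qed.

(** * Intersection with lines *)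

Section ClosedPoly.
Context (K : closedFieldType).
Implicit Types (p g : {poly K}).

(** One root is stripped at a time with its full multiplicity; what remains of [p] is coprime to
    that power, so the two factors may be tested separately. *)
Lemma closed_dvdp p g : p != 0 ->
  (forall a, root p a -> ('X - a%:P) ^+ mup a p %| g) -> p %| g.
Proof.
have [k] := ubnP (size p); elim: k p => // k IH p; rewrite ltnS => sp p0 h.
case: (eqVneq (size p) 1%N) => [s1|/closed_rootP[a ra]].
  have /size_poly1P[c c0 ->] : size p == 1%N by apply/eqP.
  by rewrite -[c%:P]mulr1 mul_polyC dvdpZl // dvd1p.
have [l [q qr e]] := multiplicity_XsubC p a; rewrite p0 /= in qr.
have q0 : q != 0 by apply: contraNneq qr => ->; rewrite root0.
have lE : l = mup a p.
  rewrite e mupM ?q0 ?expf_neq0 ?polyXsubC_eq0 // mupNroot // mup_XsubCX eqxx.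
  by rewrite add0n.
have l0 : (0 < l)%N by rewrite lE -XsubC_dvd // dvdp_XsubCl.
have := h a ra; rewrite -lE => hl.
rewrite e Gauss_dvdp ?coprimep_expr ?coprimep_XsubC // hl andbT.
apply: IH => // [|b rb].
  move: sp; rewrite e size_Mmonic ?monic_exp ?monicXsubC // size_exp_XsubC.
  by have : (0 < size q)%N by [rewrite size_poly_gt0]; lia.
apply: dvdp_trans (h b _); last by rewrite e rootM rb.
rewrite dvdp_exp2l // e mupM ?q0 ?expf_neq0 ?polyXsubC_eq0 //.
exact: leq_addr.
Qed.

Lemma mup_prod (rs : seq K) a : mup a (\prod_(r <- rs) ('X - r%:P)) = count_mem a rs.
Proof.
elim: rs => [|r rs IH]; first by rewrite big_nil mupNroot // root1.
rewrite big_cons mupM ?polyXsubC_eq0 //; last first.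
  by rewrite prodf_seq_neq0; apply/allP => b _; rewrite polyXsubC_eq0.
rewrite IH /= -['X - r%:P]expr1 mup_XsubCX.
by rewrite eq_sym; case: eqP.
Qed.

End ClosedPoly.

Section Lines.
Context (K : closedFieldType) (m : nat) (X : smooth_plane_curve K m) (hm : (1 < m)%N).
Implicit Types (P : point X) (f g u : function_field X) (G H : {mpoly K[3]}).
Local Notation F := (equation X).
Local Notation I := (ideal_of X).
Local Notation tofr := (to_frac X).

Lemma ray_uniq P Q A : ray P A -> ray Q A -> P = Q.
Proof.
move=> [c c0 hc] [d d0 hd]; apply/val_inj.
apply/val_inj/(@normalized_uniq _ _ _ (c / d) (valP (val P)) (valP (val Q))).
  by rewrite mulf_neq0 // invr_eq0.
move=> j; have := hc j; have := hd j; rewrite /pcoords /coords => -> ->.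
by rewrite mulrA mulfVK.
Qed.

Lemma ray_exists (v : 'I_3 -> K) : (exists i, v i != 0) -> F.@[v] = 0 ->
  exists P, ray P v.
Proof.
move=> [i0 vi0] Fv.
case: (@arg_minnP _ i0 (fun i => v i != 0) (@nat_of_ord _) vi0) => i vi mini.
pose r : 'rV[K]_3 := \row_k ((v i)^-1 * v k).
have nr : normalized r.
  apply/existsP; exists i; rewrite mxE mulVf // eqxx /=.
  apply/forallP => j; apply/implyP => ji; rewrite mxE.
  have -> : v j = 0 by apply/eqP; apply: contraTT ji => /mini; rewrite -leqNgt.
  by rewrite mulr0.
pose p : proj_plane K := exist _ r nr.
have pE k : coords p k = (v i)^-1 * v k by rewrite /coords /= mxE.
have Fp : F.@[coords p] == 0.
  by rewrite (meval_homog (equation_homog X) pE) Fv mulr0.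
exists (exist _ p Fp : point X), (v i)^-1 => [|k]; first by rewrite invr_eq0.
exact: pE.
Qed.

(** The restriction of [F] is a nonzero polynomial, so some point of the line is off the curve;
    putting it at infinity makes every intersection point finite and gives the restriction full
    degree [m]. *)
Lemma line_frame (w : 'I_3 -> K) : (exists i, w i != 0) ->
  exists A B C la mu, frame A B C la mu w /\ F.@[B] != 0.
Proof.
move=> w0; have [a a0 aw] := orth_exists w0.
have [B [C [la [mu fr]]]] := frame_exists a0 w0 (etrans (dotC _ _) aw).
have /closed_nonrootP[t nr] := equation_not_line X hm fr.
exists B, (fun i => a i + t * B i), C, (fun j => mu j + (- t) * la j), la; split.
  exact/frame_swapAB/frame_shear.
by rewrite -restriction_eval.
Qed.

Lemma ord_mul_reg P f g (k l : int) : ord_at P f k -> l <= k -> regular_at P g -> vge P l (f * g).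
Proof.
move=> hf lk rg; case: (eqVneq g 0) => [->|g0]; first by rewrite mulr0; exact: vge0.
have f0 := ord_at_neq0 hm hf.
apply/(vgeP hm P l (mulf_neq0 f0 g0)); rewrite (val_atM hm P f0 g0) (val_at_eq hm hf).
by rewrite -[l]addr0 lerD //; exact: (regular_val hm P g0).1 rg.
Qed.

(* Write [G = nu G1 + mu^j R] with [R(A) <> 0].  If [j < k], then [mu] is a uniformizer while
   [nu] has order [k], so [G] has order exactly [j]. *)
Lemma restriction_vanishing P A B C la mu nu k q d e G :
  frame A B C la mu nu -> ray P A -> restriction A B F = q * 'X^k -> q`_0 != 0 -> (0 < k)%N ->
  G \is d.-homog -> (e <= k)%N -> vge P e (form_at P d G) -> 'X^e %| restriction A B G.
Proof.
move=> fr PA rF q0 k0 hG ek vG.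
case: (eqVneq (restriction A B G) 0) => [->|g0]; first exact: dvdp0.
have [j [r rr rE]] := multiplicity_XsubC (restriction A B G) 0.
rewrite g0 polyC0 subr0 /= rootE horner_coef0 in rr rE.
case: (leqP e j) => [ej|je]; first by rewrite rE dvdp_mull // dvdp_exp2l.
exfalso.
have rn0 : r != 0 by apply: contraNneq rr => ->; rewrite coef0.
have not_unit u : unit_at P u -> ~ vge P 1 u.
  move=> hu /(vgeP hm P 1 (unit_at_neq0 hu)); rewrite (val_unit hm hu).
  by [].
(* The case [j = 0] is apart: then [k] may be 1 and [mu] need not be a uniformizer, but [G] does not
   vanish at [P]. *)
case: (posnP j) => [j0|j0].
  have uG : unit_at P (form_at P d G).
    apply: form_at_unit; rewrite // (ray_meval PA hG) -(restriction_coef0 A B) rE j0 expr0 mulr1 //.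
  apply: (not_unit _ uG); apply/(vgeP hm P _ (unit_at_neq0 uG)).
  apply: le_trans ((vgeP hm P _ (unit_at_neq0 uG)).1 vG); rewrite lez_nat.
  by rewrite j0 in je.
have [jd sr] : (j <= d)%N /\ (size r <= (d - j).+1)%N.
  have [] := restriction_coef A B hG; rewrite rE size_Mmonic ?monicXn // size_polyXn => h _.
  have h1 : ((size r + j.+1).-1 <= d.+1)%N := h; have h2 : (0 < size r)%N by rewrite size_poly_gt0.
  by clear -h1 h2; lia.
have d0 : (0 < d)%N by exact: leq_trans j0 jd.
have hG' : G \is d.-1.+1.-homog by rewrite prednK.
have [G1 hG1 eG] := frame_decomp_homog fr hG'.
pose R := homogenize la mu (d - j) r.
have hR : R \is (d - j).-homog by exact: homogenize_homog.
have RA : R.@[A] != 0 by rewrite (homogenize_meval0 fr).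
have hmu : lin mu ^+ j \is j.-homog by have := dhomogMn j (lin_homog mu); rewrite mul1n.
have eG' : G = lin nu * G1 + lin mu ^+ j * R.
  by rewrite {1}eG rE prednK // -{1}(subnK jd) homogenizeMXn.
have uR : unit_at P (form_at P (d - j) R) by apply: form_at_unit; rewrite // (ray_meval PA hR).
have [ordn /(_ _) um] := line_order hm fr PA rF q0 k0.
have {}um : uniformizer P (form_at P 1 (lin mu)) by apply: um; clear -j0 je ek; lia.
have ordj : ord_at P (form_at P j (lin mu ^+ j)) j.
  elim: (j) => [|i IH]; first by rewrite expr0 form_at1; exact/ord_at_unit/unit_at1.
  rewrite exprS -(add1n i) form_atM ?lin_homog //; last first.
    by have := dhomogMn i (lin_homog mu); rewrite mul1n.
  rewrite PoszD; apply: ord_atM => //.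
  exists (form_at P 1 (lin mu)), 1; rewrite mul1r expr1z; split=> //; exact: unit_at1.
have e1 : (1 + d.-1 = d)%N by clear -d0; lia.
have e2 : (j + (d - j) = d)%N by clear -jd; lia.
have eqn : form_at P d G = form_at P 1 (lin nu) * form_at P d.-1 G1
    + form_at P j (lin mu ^+ j) * form_at P (d - j) R.
  rewrite -!form_atM ?lin_homog // e1 e2 -form_atD -?eG' //.
    by have := dhomogM (lin_homog nu) hG1; rewrite e1.
  by have := dhomogM hmu hR; rewrite e2.
have ordR : ord_at P (form_at P j (lin mu ^+ j) * form_at P (d - j) R) j.
  by rewrite -[Posz j]addr0; apply: ord_atM => //; exact: ord_at_unit.
have n0 := ord_at_neq0 hm ordR.
(* Both [G], of order at least [e > j], and [nu G1], of order at least [k > j], vanish to order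
   [j + 1]; so would their difference, whose order is [j]. *)
have : vge P j.+1 (form_at P j (lin mu ^+ j) * form_at P (d - j) R).
  have -> : form_at P j (lin mu ^+ j) * form_at P (d - j) R =
      form_at P d G + (- 1 : K) *: (form_at P 1 (lin nu) * form_at P d.-1 G1).
    by rewrite (@scaleN1r K (function_field X)) eqn [X in X - _]addrC addrK.
  apply: vgeD.
    case: (eqVneq (form_at P d G) 0) => [->|G0]; first exact: vge0.
    by apply/(vgeP hm P _ G0); apply: le_trans ((vgeP hm P _ G0).1 vG); rewrite lez_nat.
  apply: vgeZ; apply: ord_mul_reg ordn _ (form_at_reg P hG1).
  by rewrite lez_nat; exact: leq_trans je ek.
move/(vgeP hm P _ n0); by rewrite (val_at_eq hm ordR) lez_nat ltnn.
Qed.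

Section OnLine.
Context A B C la mu w (fr : frame A B C la mu w) (FB : F.@[B] != 0).

Lemma frame_point_neq0 (t : K) : exists i, A i + t * B i != 0.
Proof.
have [[laA laB _] _] := frame_dual fr.
by apply: (@dot_neq0 _ _ la); rewrite dotC dotDr laA laB mulr0 addr0 oner_neq0.
Qed.

Lemma shear_restriction_factor (t : K) : root (restriction A B F) t ->
  exists q, [/\ restriction (fun i => A i + t * B i) B F = q * 'X^(mup t (restriction A B F)), q`_0 != 0
   & (0 < mup t (restriction A B F))%N].
Proof.
move=> rt; have p0 := equation_not_line X hm fr.
have [k [q qr e]] := multiplicity_XsubC (restriction A B F) t; rewrite p0 /= in qr.
have q0 : q != 0 by apply: contraNneq qr => ->; rewrite root0.
have kE : mup t (restriction A B F) = k.
  by rewrite e mupM ?q0 ?expf_neq0 ?polyXsubC_eq0 // mupNroot // mup_XsubCX eqxx.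
exists (q \Po ('X + t%:P)); split.
- rewrite restriction_shear kE {1}e comp_polyM rmorphXn /= comp_polyB comp_polyX comp_polyC.
  by rewrite addrK.
- by rewrite -horner_coef0 horner_comp !hornerE.
- by rewrite -XsubC_dvd // dvdp_XsubCl.
Qed.

Lemma line_val P (t : K) : root (restriction A B F) t -> ray P (fun i => A i + t * B i) ->
  val_at P (form_at P 1 (lin w)) = mup t (restriction A B F).
Proof.
move=> rt Pt; have [q [e q0 k0]] := shear_restriction_factor rt.
by apply: (val_at_eq hm); case: (line_order hm (frame_shear t fr) Pt e q0 k0).
Qed.

(** The [la]-coordinate of [P] is nonzero, for otherwise [P] would be [B], which is off the curve;
    dividing by it gives the parameter. *)
Lemma on_line P : dot w (pcoords P) = 0 -> exists t, root (restriction A B F) t /\ ray P (fun i => A i + t * B i).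
Proof.
move=> wP; set v := pcoords P in wP *.
have vE i : v i = dot la v * A i + dot mu v * B i.
  by rewrite {1}(frame_coords v i fr) wP mul0r addr0.
have l0 : dot la v != 0.
  apply: contraNneq FB => l0; have vE' i : v i = dot mu v * B i by rewrite {1}vE l0 mul0r add0r.
  have := pcoords_F P; rewrite -/v (meval_homog (equation_homog X) vE') => /eqP.
  rewrite mulf_eq0 => /orP[|/eqP //]; rewrite expf_eq0 => /andP[_ /eqP m0].
  have [i] := pcoords_neq0 P; rewrite -/v vE' m0 mul0r; by rewrite eqxx.
have Pt : ray P (fun i => A i + dot mu v / dot la v * B i).
  exists (dot la v) => // i; rewrite -/v vE mulrDr; congr (_ + _).
  by rewrite mulrA mulrCA mulfV // mulr1.
exists (dot mu v / dot la v); split=> //.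
rewrite rootE restriction_eval; rewrite -(ray_meval Pt (equation_homog X)).
by rewrite pcoords_F.
Qed.

(** This is Noether's theorem for a line. Vanishing on the intersection scheme makes the restriction
    of [G] a multiple of that of [F]; after subtracting a multiple of [F] the form vanishes on the
    line and is divisible by it. *)
Lemma line_residual d G : G \is d.+1.-homog ->
  (forall P k, ord_at P (form_at P 1 (lin w)) k -> vge P k (form_at P d.+1 G)) ->
  exists2 G', G' \is d.-homog & tofr G = tofr (lin w) * tofr G'.
Proof.
move=> hG hv.
have p0 := equation_not_line X hm fr; set p := restriction A B F in p0.
have [sF cF] := restriction_coef A B (equation_homog X).
have szp : size p = m.+1.
  apply/eqP; rewrite eqn_leq sF ltnNge; apply: contra FB => le.
  by rewrite -cF nth_default.
have /dvdpP[q qE] : p %| restriction A B G.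
  (* Each root is the parameter of a point of the curve. The shear moves it to the origin, where the
     multiplicity of the root is the order of the line, so the hypothesis on [G] there transfers to
     its restriction. *)
  apply: closed_dvdp => // t rt.
  have [P Pt] : exists P, ray P (fun i => A i + t * B i).
    by apply: ray_exists; [exact: frame_point_neq0|rewrite -restriction_eval; exact/eqP].
  have [r [e r0 k0]] := shear_restriction_factor rt.
  have [ordn _] := line_order hm (frame_shear t fr) Pt e r0 k0.
  have := restriction_vanishing (frame_shear t fr) Pt e r0 k0 hG (leqnn _) (hv _ _ ordn).
  rewrite restriction_shear => /dvdpP[s sE]; apply/dvdpP; exists (s \Po ('X - t%:P)).
  have -> : restriction A B G = (restriction A B G \Po ('X + t%:P)) \Po ('X - t%:P).
    by rewrite -comp_polyA comp_polyD comp_polyX comp_polyC subrK comp_polyXr.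
  by rewrite sE comp_polyM rmorphXn /= comp_polyX.
(* When [q] is nonzero, comparing degrees gives [m <= d + 1], which is needed to lift [q] to a form
   of degree [d + 1 - m]. *)
case: (eqVneq q 0) => [q0|q0].
  have g0 : restriction A B G = 0 by rewrite qE q0 mul0r.
  have [G1 h1 e1] := restriction_eq0 fr hG g0.
  by exists G1 => //; rewrite e1 to_fracM.
have [sG _] := restriction_coef A B hG.
have sq : (m <= d.+1)%N /\ (size q <= (d.+1 - m).+1)%N.
  have h1 : ((size q + m.+1).-1 <= d.+2)%N by move: sG; rewrite qE size_mul // szp.
  have h2 : (0 < size q)%N by rewrite size_poly_gt0.
  by clear -h1 h2; lia.
pose Q := homogenize la mu (d.+1 - m) q.
have hQ : Q \is (d.+1 - m).-homog by exact: homogenize_homog.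
have hQF : Q * F \is d.+1.-homog by have := dhomogM hQ (equation_homog X); rewrite subnK; case: sq.
have hD : G - Q * F \is d.+1.-homog by rewrite rpredB.
have [|G1 h1 e1] := restriction_eq0 fr hD.
  rewrite rmorphB rmorphM /= (restriction_homogenize fr) ?qE -/p ?subrr //; by case: sq.
exists G1 => //; rewrite -to_fracM -e1 rmorphB /=.
suff /eqP-> : tofr (Q * F) == 0 by rewrite subr0.
by rewrite to_frac_eq0; apply/ideal_ofP; exists Q.
Qed.

(** As [B] is off the curve, the restriction of [F] has exactly [m] roots with multiplicity; each
    contributes one point. *)
Lemma line_divisor_at : exists D : divisor X, deg D = m%:Z /\
  forall P, ord_at P (form_at P 1 (lin w)) (coeff P D).
Proof.
have p0 := equation_not_line X hm fr.
have [rs e] := closed_field_poly_normal (restriction A B F).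
have l0 : lead_coef (restriction A B F) != 0 by rewrite lead_coef_eq0.
have mupE t : mup t (restriction A B F) = count_mem t rs.
  rewrite e -mul_polyC mupMr ?mup_prod // rootC //.
have rsr t : t \in rs -> root (restriction A B F) t.
  by move=> h; rewrite e rootZ // root_prod_XsubC.
have [sF cF] := restriction_coef A B (equation_homog X).
have szp : size (restriction A B F) = m.+1.
  apply/eqP; rewrite eqn_leq sF ltnNge; apply: contra FB => le.
  by rewrite -cF nth_default.
have sr : size rs = m.
  by apply/eqP; rewrite -eqSS -szp e size_scale // size_prod_XsubC.
have [D [dD cD]] : exists D : divisor X, deg D = (size rs)%:Z /\
    forall P, coeff P D = (count (fun t => `[< ray P (fun i => A i + t * B i) >]) rs)%:Z.
  elim: (rs) rsr => [|t s IH] hr.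
    by exists 0; rewrite deg0; split=> // P; rewrite coeff0.
  have [|D [dD cD]] := IH; first by move=> b bs; apply: hr; rewrite inE bs orbT.
  have [P Pt] : exists P, ray P (fun i => A i + t * B i).
    apply: ray_exists; [exact: frame_point_neq0|rewrite -restriction_eval; apply/eqP/hr].
    exact: mem_head.
  exists (<<P>> + D); rewrite degD degU dD; split=> [|Q]; first by rewrite -PoszD.
  rewrite coeffD coeffU cD /= PoszD mul1r; congr (_ + _).
  case: asboolP => [Qt|nQ]; first by rewrite (ray_uniq Pt Qt) eqxx.
  by case: eqP => // PQ; case: nQ; rewrite -PQ.
exists D; rewrite dD sr; split=> // P; rewrite cD.
have w0 := frame_line_neq0 fr.
have [[laA laB _] [[muA muB _] [wA wB _]]] := frame_dual fr.
case: (eqVneq (dot w (pcoords P)) 0) => [wP|wP]; last first.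
  suff -> : count (fun t => `[< ray P (fun i => A i + t * B i) >]) rs = 0%N.
    by apply: ord_at_unit => //; apply: form_at_unit; rewrite ?lin_homog // meval_lin.
  apply/eqP; rewrite -leqn0 leqNgt -has_count; apply: contra wP => /hasP[t _ /asboolP Pt].
  by rewrite -meval_lin (ray_meval Pt (lin_homog w)) meval_lin dotDr wA wB mulr0 addr0.
have [t0 [rt0 Pt0]] := on_line wP.
(* Distinct parameters give distinct points, so the roots landing on [P] are the copies of [t0]. *)
have -> : count (fun t => `[< ray P (fun i => A i + t * B i) >]) rs = count_mem t0 rs.
  apply: eq_count => t /=; apply/asboolP/eqP => [Pt|->//].
  case: Pt0 => c c0 hc; case: Pt => c' c0' hc'.
  have hh i : c * (A i + t0 * B i) = c' * (A i + t * B i) by rewrite -hc -hc'.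
  have hd v : dot v (fun i => 0 + c * (A i + t0 * B i)) = dot v (fun i => 0 + c' * (A i + t * B i)).
    by apply: eq_bigr => i _; rewrite hh.
  have hd' v : c * (dot v A + t0 * dot v B) = c' * (dot v A + t * dot v B).
    by have := hd v; rewrite !dotDr => /addrI.
  have := hd' la; have := hd' mu; rewrite laA laB muA muB !mulr0 !mulr1 !addr0 !add0r => e1 e2.
  by move: e1; rewrite !mulr1 in e2; rewrite -e2 => /(mulfI c0) ->.
by rewrite -mupE -(line_val rt0 Pt0); apply: val_atP => //; rewrite form_at_eq0 ?lin_homog // line_notin.
Qed.

End OnLine.

Lemma line_divides (w : 'I_3 -> K) d G : (exists i, w i != 0) -> G \is d.+1.-homog ->
  (forall P k, ord_at P (form_at P 1 (lin w)) k -> vge P k (form_at P d.+1 G)) ->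
  exists2 G', G' \is d.-homog & tofr G = tofr (lin w) * tofr G'.
Proof.
move=> w0; have [A [B [C [la [mu [fr FB]]]]]] := line_frame w0.
exact: line_residual fr FB d G.
Qed.

Lemma line_divisor (w : 'I_3 -> K) : (exists i, w i != 0) -> exists D : divisor X,
  deg D = m%:Z /\ forall P, ord_at P (form_at P 1 (lin w)) (coeff P D).
Proof.
move=> w0; have [A [B [C [la [mu [fr FB]]]]]] := line_frame w0.
exact: line_divisor_at fr FB.
Qed.

End Lines.

(** * Riemann-Roch spaces and the genus *)

Section RiemannRoch.
Context (K : closedFieldType) (m : nat) (X : smooth_plane_curve K m) (hm : (1 < m)%N).
Implicit Types (P : point X) (f g u : function_field X) (G H A W : {mpoly K[3]}).
Implicit Types (D E : divisor X).
Local Notation F := (equation X).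
Local Notation I := (ideal_of X).
Local Notation tofr := (to_frac X).

Lemma mul_form_at P d f G H : G \is d.-homog -> H \is d.-homog ->
  val f * tofr G = tofr H -> f * form_at P d G = form_at P d H.
Proof.
move=> hG hH e; apply: val_inj.
have -> : val (f * form_at P d G) = val f * val (form_at P d G) by [].
by rewrite !form_atE // mulrA e.
Qed.

Lemma vge_mul P f g (k : int) : ord_at P g k -> (vge P (- k) f <-> regular_at P (f * g)).
Proof.
move=> og; have g0 := ord_at_neq0 hm og.
case: (eqVneq f 0) => [->|f0].
  by rewrite mul0r; split=> _; [exact: regular0|exact: vge0].
have fg := mulf_neq0 f0 g0.
split=> h.
  apply/(regular_val hm P fg); rewrite (val_atM hm P f0 g0) (val_at_eq hm og).
  by rewrite -lerBlDr sub0r; exact: (vgeP hm P _ f0).1 h.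
apply/(vgeP hm P _ f0); have := (regular_val hm P fg).1 h.
by rewrite (val_atM hm P f0 g0) (val_at_eq hm og) -lerBlDr sub0r.
Qed.

(** As [f W] is regular everywhere, [G] vanishes at least as much as the first remaining line, so
    that line can be divided out of both sides. *)
Lemma remove_lines f W e (us : seq ('I_3 -> K)) G :
  (forall w, List.In w us -> exists i, w i != 0) -> W \is e.-homog ->
  (forall P, regular_at P (f * form_at P e W)) ->
  G \is (e + size us).-homog -> val f * tofr (W * \prod_(w <- us) lin w) = tofr G ->
  exists2 A, A \is e.-homog & val f * tofr W = tofr A.
Proof.
move=> us0 hW reg; elim: us us0 G => [|w us IH] us0 G /=.
  by rewrite addn0 big_nil mulr1 => hG e1; exists G.
rewrite addnS big_cons => hG e1.
have hp1 := prod_lines_homog us; set p := \prod_(w <- us) lin w in hp1 e1 *.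
have hV : W * (lin w * p) \is (e + (1 + size us)).-homog.
  by rewrite !dhomogM // lin_homog.
have hG' : G \is (e + (1 + size us)).-homog by rewrite add1n addnS.
have w0 : exists i, w i != 0 by apply: us0; left.
have [|G' hG2 e2] := line_divides (X := X) hm w0 hG.
  move=> P k ok.
  have := mul_form_at P hV hG' e1; rewrite !form_atM ?dhomogM ?lin_homog // => e3.
  have -> : form_at P (e + size us).+1 G = form_at P (e + (1 + size us)) G.
    by rewrite add1n addnS.
  rewrite -e3 mulrA mulrCA; apply: (ord_mul_reg hm ok (lexx _)).
  by apply: regularM; [exact: reg|exact: form_at_reg].
apply: (IH (fun v hv => us0 v (or_intror hv)) G' hG2).
have l0 : tofr (lin w) != 0 by rewrite to_frac_eq0 line_notin.
apply: (mulfI l0); rewrite -e2 -e1 !to_fracM; rewrite mulrCA; congr (_ * _).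
by rewrite mulrCA.
Qed.

(** If [f = G / H] and [H U] is a product of lines on the curve, then [f W] times these lines is the
    form [G U W]; the lines are then removed one by one. *)
Lemma regular_section f W e : W \is e.-homog ->
  (forall P, regular_at P (f * form_at P e W)) ->
  exists2 A, A \is e.-homog & val f * tofr W = tofr A.
Proof.
move=> hW reg; have [d [G [H [hG hH HI fE]]]] := ff_cases f.
have [us [e' [U [us0 hU su eU]]]] := lines_multiple (ltnW hm) hH HI.
apply: (@remove_lines f W e us (G * (U * W))) => //.
  rewrite su; have := dhomogM hG (dhomogM hU hW).
  suff -> : (d + (e' + e) = e + (d + e'))%N by [].
  by rewrite addnA addnC.
rewrite fE (ffracE hG hH HI) !to_fracM eU to_fracM.
have h0 : tofr H != 0 by rewrite to_frac_eq0.
exact: frac_cancel.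
Qed.

Lemma lines_divisor (us : seq ('I_3 -> K)) : (forall w, List.In w us -> exists i, w i != 0) ->
  exists D, deg D = (m * size us)%:Z /\
    forall P, ord_at P (form_at P (size us) (\prod_(w <- us) lin w)) (coeff P D).
Proof.
elim: us => [|w us IH] us0.
  exists 0; rewrite deg0 muln0; split=> // P; rewrite coeff0 big_nil form_at1.
  exact/(ord_at_unit hm)/unit_at1.
have [|D [dD oD]] := IH; first by move=> v hv; apply: us0; right.
have w0 : exists i, w i != 0 by apply: us0; left.
have [D' [dD' oD']] := line_divisor X hm w0.
exists (D' + D); rewrite degD dD dD' mulnS PoszD; split=> // P.
rewrite coeffD big_cons /= -(add1n (size us)) form_atM ?lin_homog ?prod_lines_homog //.
exact: ord_atM.
Qed.

Lemma prod_lines_notin (us : seq ('I_3 -> K)) :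
  (forall w, List.In w us -> exists i, w i != 0) -> \prod_(w <- us) lin w \notin I.
Proof.
elim: us => [|w us IH] us0; first by rewrite big_nil (equation_proper X).
rewrite big_cons notinM ?line_notin //; first by apply: us0; left.
by apply: IH => v hv; apply: us0; right.
Qed.

(** The order of [G] lies between 0 and that of a product of lines it divides, so its support is
    inside that of the divisor of the lines. *)
Lemma form_divisor d G : G \is d.-homog -> G \notin I ->
  exists E, forall P, ord_at P (form_at P d G) (coeff P E).
Proof.
move=> hG GI; have [us [e [U [us0 hU su eU]]]] := lines_multiple (ltnW hm) hG GI.
have [D [_ oD]] := lines_divisor us0.
pose v P := val_at P (form_at P d G).
have g0 P : form_at P d G != 0 by rewrite form_at_eq0.
have UI : U \notin I.
  have := prod_lines_notin us0; rewrite -!to_frac_eq0 eU to_fracM mulf_eq0 negb_or.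
  by case/andP.
have vE P : val_at P (form_at P d G) + val_at P (form_at P e U) = coeff P D.
  have u0 : form_at P e U != 0 by rewrite form_at_eq0.
  rewrite -(val_atM hm P (g0 P) u0); apply: (val_at_eq hm).
  by rewrite -form_atM // -su -(form_at_tofr P _ eU); exact: oD.
have v_ge0 P : 0 <= v P <= coeff P D.
  have u0 : form_at P e U != 0 by rewrite form_at_eq0.
  have h1 := (regular_val hm P (g0 P)).1 (form_at_reg P hG).
  have h2 := (regular_val hm P u0).1 (form_at_reg P hU).
  by rewrite h1 -vE lerDl.
exists (\sum_(Q <- dom D) << v Q *g Q >>) => P.
suff -> : coeff P (\sum_(Q <- dom D) << v Q *g Q >>) = v P by exact: val_atP.
rewrite raddf_sum /=; case: (boolP (P \in dom D)) => PD.
  rewrite (bigD1_seq P) ?uniq_dom //= coeffU eqxx mulr1 big1 ?addr0 // => Q ne.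
  by rewrite coeffU (negbTE ne) mulr0.
have := v_ge0 P; rewrite (coeff_outdom PD) => h.
have -> : v P = 0 by apply/le_anti; rewrite andbC.
rewrite big_seq big1 // => Q QD; rewrite coeffU; case: eqP => [e1|]; last by rewrite mulr0.
by rewrite -e1 QD in PD.
Qed.

Lemma divisor_exists f : f != 0 -> exists E, is_div f E.
Proof.
have [d [G [H [hG hH HI ->]]]] := ff_cases f => f0.
have GI : G \notin I.
  apply: contra f0 => GI; apply/eqP; apply: val_inj; rewrite (ffracE hG hH HI).
  by move: GI; rewrite -to_frac_eq0 => /eqP->; rewrite mul0r.
have [E oE] := form_divisor hG GI; have [E' oE'] := form_divisor hH HI.
exists (E - E') => P; rewrite (ffrac_form_at P hG hH HI) coeffB.
by apply: ord_atM => //; exact: ord_atV.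
Qed.

(** The divisor demanded by the definition exists for every nonzero function, so membership becomes
    a family of local linear conditions. *)
Lemma RR_spaceP D f : RR_space D f <-> forall P, vge P (- coeff P D) f.
Proof.
split=> [[->|[f0 [E dE leE]]] P|h].
- exact: vge0.
- apply/(vgeP hm P _ f0); rewrite (val_at_eq hm (dE P)).
  by have := leE P; rewrite coeffN.
case: (eqVneq f 0) => [->|f0]; [by left|right; split=> //].
have [E dE] := divisor_exists f0; exists E => // P.
by rewrite coeffN -(val_at_eq hm (dE P)); exact: (vgeP hm P _ f0).1 (h P).
Qed.

Lemma RR_space_forms D e W f : W \is e.-homog -> W \notin I ->
  (forall P, ord_at P (form_at P e W) (coeff P D)) ->
  RR_space D f <-> exists2 A, A \is e.-homog & val f * tofr W = tofr A.
Proof.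
move=> hW WI oD; rewrite RR_spaceP; split=> [h|[A hA eA] P].
  by apply: regular_section => // P; apply/(vge_mul f (oD P)).
apply/(vge_mul f (oD P)); rewrite (mul_form_at P hW hA eA).
exact: form_at_reg.
Qed.

Section Sections.
Context e W (hW : W \is e.-homog) (WI : W \notin I).

Definition section_of (A : dhomog 3 K e) : function_field X := ffrac X A W.

Lemma section_ofE (A : dhomog 3 K e) : val (section_of A) = tofr (mpoly_of_dhomog A) / tofr W.
Proof. by rewrite (ffracE (dhomog_is_dhomog A) hW WI). Qed.

Lemma section_of_sum (J : finType) (c : J -> K) (A : J -> dhomog 3 K e) :
  section_of (\sum_j c j *: A j) = \sum_j c j *: section_of (A j).
Proof.
have sD : {morph section_of : A B / A + B}.
  move=> B C; apply: val_inj; rewrite section_ofE.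
  have -> : val (section_of B + section_of C) = val (section_of B) + val (section_of C) by [].
  have -> : mpoly_of_dhomog (B + C) = mpoly_of_dhomog B + mpoly_of_dhomog C by [].
  by rewrite !section_ofE rmorphD mulrDl.
have s0 : section_of 0 = 0 by apply: val_inj; rewrite section_ofE rmorph0 mul0r.
rewrite (big_morph _ sD s0); apply: eq_bigr => j _; apply: val_inj.
have -> : val (c j *: section_of (A j)) = tofr (c j)%:MP * val (section_of (A j)) by [].
by rewrite !section_ofE mulrA -to_fracM mul_mpolyC.
Qed.

Lemma section_of_eq0 (A : dhomog 3 K e) : (section_of A == 0) = (mpoly_of_dhomog A \in I).
Proof.
rewrite -(inj_eq val_inj) section_ofE.
have -> : val (0 : function_field X) = 0 by [].
by rewrite mulf_eq0 invr_eq0 !to_frac_eq0 (negbTE WI) orbF.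
Qed.

Lemma section_ofP f : (exists2 A, A \is e.-homog & val f * tofr W = tofr A) <->
  exists A : dhomog 3 K e, f = section_of A.
Proof.
have w0 : tofr W != 0 by rewrite to_frac_eq0.
split=> [[A hA eA]|[A ->]].
  by exists (DHomog hA); apply: val_inj; rewrite section_ofE -eA mulfK.
by exists A; [exact: dhomog_is_dhomog|rewrite section_ofE mulfVK].
Qed.

(** In degree below [m] the ideal contains no nonzero form, so distinct forms give distinct
    sections. *)
Lemma sections_has_dim (U : function_field X -> Prop) : (e < m)%N ->
  (forall f, U f <-> exists2 A, A \is e.-homog & val f * tofr W = tofr A) ->
  has_dim U 'C(e + 2, e).
Proof.
move=> em hU; pose V : vectType K := dhomog 3 K e.
have dV : \dim (fullv : {vspace V}) = 'C(e + 2, e) by rewrite dimvf dim_form.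
rewrite -dV; pose b := vbasis (fullv : {vspace V}).
exists (fun i => section_of (tnth b i)); split=> [c|f].
  rewrite -section_of_sum => /eqP; rewrite section_of_eq0 => AI i.
  have /freeP/(_ c) := basis_free (vbasisP (fullv : {vspace V})); apply.
  apply/eqP; apply: contraTT AI => A0.
  under eq_bigr do rewrite (tnth_nth 0).
  apply: (form_notin X (dhomog_is_dhomog _) _ em).
  by apply: contra A0 => /eqP h; apply/eqP/val_inj.
rewrite hU section_ofP; split=> [[A ->]|[c ->]].
  exists (fun i => coord b i A); rewrite -section_of_sum; congr section_of.
  rewrite {1}(coord_vbasis (memvf A)); apply: eq_bigr => i _.
  by rewrite (tnth_nth 0).
by exists (\sum_i c i *: tnth b i); rewrite section_of_sum.
Qed.

Lemma independent_sections : (m <= e)%N ->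
  exists N (b : 'I_N -> function_field X),
    [/\ ('C(e + 2, e) <= N + 'C(e - m + 2, e - m))%N,
      forall c, \sum_i c i *: b i = 0 -> forall i, c i = 0 &
      forall i, exists2 A, A \is e.-homog & val (b i) * tofr W = tofr A].
Proof.
move=> me; pose V : vectType K := dhomog 3 K e; pose S : vectType K := dhomog 3 K (e - m).
have hF (B : S) : F * mpoly_of_dhomog B \is e.-homog.
  by have := dhomogM (equation_homog X) (dhomog_is_dhomog B); rewrite subnKC.
pose fF (B : S) : V := DHomog (hF B).
pose sb := vbasis (fullv : {vspace S}).
(* The forms of degree [e] vanishing on the curve are the multiples of [F]; a basis of a complement
   stays independent after division by [W]. *)
pose U0 : {vspace V} := <<[seq fF B | B <- sb]>>%VS.
have IU0 (A : V) : mpoly_of_dhomog A \in I -> A \in U0.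
  move=> AI; have hA : mpoly_of_dhomog A \is (m + (e - m)).-homog by rewrite subnKC //; exact: dhomog_is_dhomog.
  have [Q hQ eQ] := form_in hA AI.
  have [c eQ'] : exists c, Q = \sum_(j < \dim (fullv : {vspace S})) c j *: mpoly_of_dhomog (tnth sb j).
    exists (fun j => coord sb j (DHomog hQ : S)).
    have := congr1 (@mpoly_of_dhomog _ _ _) (coord_vbasis (memvf (DHomog hQ : S))).
    rewrite raddf_sum => e1; apply: (etrans e1); apply: eq_bigr => j _.
    by rewrite (tnth_nth 0).
  have -> : A = \sum_j c j *: fF (tnth sb j).
    apply: val_inj; rewrite /= eQ raddf_sum eQ' mulr_sumr; apply: eq_bigr => j _.
    by rewrite -scalerAr.
  rewrite rpred_sum // => j _; rewrite rpredZ // memv_span //.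
  by apply: map_f; exact: mem_tnth.
pose bs := vbasis (U0^C)%VS.
exists (\dim (U0^C)%VS), (fun i => section_of (tnth bs i)); split.
- have h1 : (\dim U0 <= 'C(e - m + 2, e - m))%N.
    by apply: leq_trans (dim_span _) _; rewrite size_map size_tuple dimvf dim_form.
  have := dimv_compl U0; rewrite dimvf dim_form => ->.
  by move: h1; lia.
- move=> c; rewrite -section_of_sum => /eqP; rewrite section_of_eq0 => AI i.
  have /freeP/(_ c) := basis_free (vbasisP (U0^C)%VS); apply.
  apply/eqP; rewrite -memv0 -(capv_compl U0) memv_cap; apply/andP; split.
    by move: (IU0 _ AI); under eq_bigr do rewrite (tnth_nth 0).
  by rewrite rpred_sum // => j _; rewrite rpredZ // vbasis_mem // mem_nth // size_tuple.
- by move=> i; apply/section_ofP; exists (tnth bs i).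
Qed.

End Sections.

End RiemannRoch.

(** * Dimension arguments for subspaces of an arbitrary vector space *)

Section Dimension.
Context (K : fieldType) (V : lmodType K).
Implicit Types (U W : V -> Prop).

Definition independent N (b : 'I_N -> V) :=
  forall c : 'I_N -> K, \sum_i c i *: b i = 0 -> forall i, c i = 0.

Lemma independent_le_dim U k N (b : 'I_N -> V) : has_dim U k -> independent b ->
  (forall i, U (b i)) -> (N <= k)%N.
Proof.
move=> [u [_ hu]] ib hb; rewrite leqNgt; apply/negP => kN.
have [M hM] : exists M : 'M[K]_(N, k), forall i, b i = \sum_j M i j *: u j.
  have h i : exists c : 'I_k -> K, b i = \sum_j c j *: u j by exact/(hu _).1/hb.
  exists (\matrix_(i, j) projT1 (cid (h i)) j) => i.
  by rewrite {1}(projT2 (cid (h i))); apply: eq_bigr => j _; rewrite mxE.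
have : kermx M != 0.
  rewrite -mxrank_eq0 mxrank_ker subn_eq0 -ltnNge.
  exact: leq_ltn_trans (rank_leq_col M) kN.
move/rowV0Pn => [x /sub_kermxP xM]; apply/negP; rewrite negbK.
apply/eqP/rowP => i; rewrite [RHS]mxE; apply: (ib (fun i => x 0 i)).
under eq_bigr do rewrite hM scaler_sumr.
rewrite exchange_big big1 //= => j _.
under eq_bigr do rewrite scalerA.
rewrite -scaler_suml.
have /rowP/(_ j) := xM; rewrite !mxE => ->.
by rewrite scale0r.
Qed.

(** A vector of [U] outside [W], added to a basis of [W], would give [k + 1] independent vectors in
    [U]. *)
Lemma same_dim_sub U W k : has_dim U k -> has_dim W k -> (forall v, W v -> U v) ->
  forall v, U v -> W v.
Proof.
move=> dU [w [iw hw]] WU v Uv; apply: contrapT => nW.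
have Ww i : W (w i).
  apply/hw; exists (fun j => (j == i)%:R); rewrite (bigD1 i) //= eqxx scale1r.
  by rewrite big1 ?addr0 // => j /negbTE->; rewrite scale0r.
pose b (i : 'I_k.+1) := if unlift ord0 i is Some j then w j else v.
have bU i : U (b i) by rewrite /b; case: unliftP => [j _|_] //; exact: WU.
suff ib : independent b by have := independent_le_dim dU ib bU; rewrite ltnn.
rewrite /b.
move=> c; rewrite big_ord_recl unlift_none.
under eq_bigr do rewrite liftK.
move=> e; have c0 : c ord0 = 0.
  apply/eqP; apply: contrapT => /negP c0; apply: nW; apply/hw.
  exists (fun j => - (c ord0)^-1 * c (fintype.lift ord0 j)).
  move/eqP: e; rewrite addr_eq0 => /eqP e; apply: (scalerI c0); rewrite e.
  rewrite scaler_sumr -sumrN; apply: eq_bigr => j _.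
  by rewrite scalerA mulrA mulrN mulfV // mulN1r scaleNr.
move: e; rewrite c0 scale0r add0r => /iw h i.
by case: (unliftP ord0 i) => [j ->|->].
Qed.

End Dimension.

Section Genus.
Context (K : closedFieldType) (m : nat) (X : smooth_plane_curve K m) (hm : (1 < m)%N).
Implicit Types (P : point X) (f g u : function_field X) (G H A W : {mpoly K[3]}).
Implicit Types (D E : divisor X).
Local Notation I := (ideal_of X).
Local Notation tofr := (to_frac X).

Lemma scale_ffM (a : K) f g : (a *: f) * g = a *: (f * g).
Proof. by rewrite -[a *: f]/(_ * f) -mulrA. Qed.

(* The leading coefficient at [P] is a linear form with kernel [L(D - P)]. *)
Lemma drop_point N (b : 'I_N.+1 -> function_field X) D P :
  independent b -> (forall i, RR_space D (b i)) ->
  exists b' : 'I_N -> function_field X, independent b' /\ forall i, RR_space (D - <<P>>) (b' i).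
Proof.
move=> ib hb; set k := coeff P D.
have hc i : exists c, has_value P (b i * unif P ^ k) c.
  by have := (RR_spaceP hm D (b i)).1 (hb i) P; rewrite /vge opprK.
pose c i := projT1 (cid (hc i)); have cE i : has_value P (b i * unif P ^ k) (c i) := projT2 (cid (hc i)).
(* The pivot [i0] has a nonzero leading coefficient if there is one. If all of them vanish, any
   index satisfies the identity. *)
have [i0 hi0] : exists i0, forall i, c i - c i / c i0 * c i0 = 0.
  case: (pselect (exists i0, c i0 != 0)) => [[i0 h]|h].
    by exists i0 => i; rewrite mulfVK // subrr.
  exists ord0 => i; have -> : c i = 0 by apply/eqP; apply: contrapT => /negP hi; apply: h; exists i.
  by rewrite !mul0r subrr.
pose r j := - (c (fintype.lift i0 j) / c i0).
exists (fun j => b (fintype.lift i0 j) + r j *: b i0); split=> [a|j].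
  under eq_bigr do rewrite scalerDr scalerA.
  rewrite big_split /= -scaler_suml => e j.
  pose a' i := if unlift i0 i is Some j then a j else \sum_j a j * r j.
  have : \sum_i a' i *: b i = 0.
    rewrite (bigD1_ord i0) //= {1}/a' unlift_none addrC -[RHS]e; congr (_ + _).
    by apply: eq_bigr => l _; rewrite /a' liftK.
  by move/ib/(_ (fintype.lift i0 j)); rewrite /a' liftK.
apply/(RR_spaceP hm) => Q; rewrite coeffB coeffU mul1r.
have vD Q' : vge Q' (- coeff Q' D) (b (fintype.lift i0 j) + r j *: b i0).
  by apply: vgeD; [|apply: vgeZ]; exact: (RR_spaceP hm _ _).1 (hb _) Q'.
case: (eqVneq P Q) => [<-|_]; last by rewrite subr0; exact: vD.
have v0 : has_value P ((b (fintype.lift i0 j) + r j *: b i0) * unif P ^ k) 0.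
  rewrite -(hi0 (fintype.lift i0 j)) mulrDl scale_ffM -mulNr; apply: has_valueD; first exact: cE.
  by apply: has_valueZ; exact: cE.
have [g rg e] := (unifP hm P).2 _ v0.
rewrite /vge opprK -/k /=.
suff -> : (b (fintype.lift i0 j) + r j *: b i0) * unif P ^ (k - 1) = g by [].
have t0 := unif_neq0 hm P.
apply: (mulIf t0); rewrite -e -mulrA; congr (_ * _).
by rewrite -[X in _ * X]expr1z -expfzDr // subrK.
Qed.

Lemma drop_divisor (d : nat) E D N (b : 'I_(N + d) -> function_field X) :
  (forall P, 0 <= coeff P E) -> deg E = d%:Z ->
  independent b -> (forall i, RR_space D (b i)) ->
  exists b' : 'I_N -> function_field X, independent b' /\ forall i, RR_space (D - E) (b' i).
Proof.
elim: d E D b => [|d IH] E D b E0 dE ib hb.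
  have -> : E = 0 by apply: fgpos_eq0P => //; apply/fgposP.
  by rewrite subr0; move: b ib hb; rewrite addn0 => b ib hb; exists b.
have [P PE] : exists P, P \in dom E.
  case e : (dom E) => [|P s]; last by exists P; rewrite mem_head.
  by move/eqP: e; rewrite dom_eq0 => /eqP E00; rewrite E00 deg0 in dE.
have cP : 1 <= coeff P E by move: PE (E0 P); rewrite mem_dom; lia.
move: b ib hb; rewrite addnS => b ib hb.
have [b1 [ib1 hb1]] := drop_point P ib hb.
have [|| b2 [ib2 hb2]] := IH (E - <<P>>) _ b1 _ _ ib1 hb1.
- move=> Q; rewrite coeffB coeffU mul1r; case: (eqVneq P Q) => [<-|_] /=.
    by rewrite subr_ge0; exact: cP.
  by rewrite subr0; exact: E0.
- by rewrite degB degU dE -addn1 PoszD addrK.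
exists b2; split=> // i; suff -> : D - E = D - <<P>> - (E - <<P>>) by [].
by rewrite opprB addrA subrK.
Qed.

Lemma deg_ge0 E : (forall P, 0 <= coeff P E) -> 0 <= deg E.
Proof.
move=> h; rewrite -[E]freeg_sumE raddf_sum sumr_ge0 // => P _ /=.
by rewrite degU.
Qed.

Lemma line_through P : exists2 w : 'I_3 -> K, exists i, w i != 0 & dot w (pcoords P) = 0.
Proof. exact/orth_exists/pcoords_neq0. Qed.

Lemma form_val_ge0 P d G : G \is d.-homog -> G \notin I -> 0 <= val_at P (form_at P d G).
Proof.
move=> hG GI; have g0 : form_at P d G != 0 by rewrite form_at_eq0.
exact: (regular_val hm P g0).1 (form_at_reg P hG).
Qed.

Definition lines_val P (us : seq ('I_3 -> K)) :=
  val_at P (form_at P (size us) (\prod_(w <- us) lin w)).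

Lemma lines_val_cat P us vs :
  (forall w, List.In w us -> exists i, w i != 0) ->
  (forall w, List.In w vs -> exists i, w i != 0) ->
  lines_val P (us ++ vs) = lines_val P us + lines_val P vs.
Proof.
move=> hu hv; rewrite /lines_val big_cat size_cat form_atM ?prod_lines_homog //.
by apply: (val_atM hm); rewrite form_at_eq0 ?prod_lines_homog // (prod_lines_notin X hm).
Qed.

Lemma lines_val_ge0 P us : (forall w, List.In w us -> exists i, w i != 0) -> 0 <= lines_val P us.
Proof.
by move=> hu; apply: form_val_ge0; [exact: prod_lines_homog|exact: prod_lines_notin].
Qed.

Lemma In_nseq (w v : 'I_3 -> K) k : List.In v (nseq k w) -> v = w.
Proof. by elim: k => //= k IH [->|/IH]. Qed.

Lemma In_cat (v : 'I_3 -> K) us vs : List.In v (us ++ vs) -> List.In v us \/ List.In v vs.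
Proof. exact: (@List.in_app_or _ us vs v). Qed.

(** For each term of coefficient [k] at [P], the absolute value of [k] copies of a line through [P]
    are enough. *)
Lemma lines_above D : exists us : seq ('I_3 -> K),
  (forall w, List.In w us -> exists i, w i != 0) /\ forall P, coeff P D <= lines_val P us.
Proof.
elim/freeg_ind_dom0: D => [|k P D _ _ [us [us0 hus]]].
  by exists [::]; split=> // P; rewrite coeff0; apply: lines_val_ge0.
have [w w0 wP] := line_through P.
have ns0 : forall v, List.In v (nseq `|k|%N w) -> exists i, v i != 0 by move=> v /In_nseq->.
exists (nseq `|k|%N w ++ us); split=> [v|Q].
  by case/In_cat => [/ns0|/us0].
rewrite lines_val_cat // coeffD coeffU; apply: lerD; last exact: hus.
case: (eqVneq P Q) => [<-|_]; last by rewrite mulr0 lines_val_ge0.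
rewrite mulr1; suff h n : n%:Z <= lines_val P (nseq n w) by apply: le_trans (h _); lia.
elim: n => [|n IH]; first exact: lines_val_ge0.
have w1 : forall v, List.In v [:: w] -> exists i, v i != 0 by move=> v /= [<-|].
rewrite -addn1 addnC nseqD PoszD; apply: le_trans (_ : 1 + lines_val P (nseq n w) <= _).
  by rewrite lerD2l.
rewrite (lines_val_cat P w1); last by move=> v /In_nseq->.
rewrite lerD2r /lines_val big_cons big_nil mulr1.
have l0 : form_at P 1 (lin w) != 0 by rewrite form_at_eq0 ?lin_homog // line_notin.
apply: (has_value0_val hm P l0).1; apply: form_at_val0; first exact: lin_homog.
by rewrite meval_lin.
Qed.

Lemma bin_genus : 2 * ('C(m.-1, 2))%:Z = (m%:Z - 1) * (m%:Z - 2).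
Proof.
have := mul_bin_diag m.-1 1; rewrite bin1 => h.
have -> : 2 * ('C(m.-1, 2))%:Z = (m.-1 * m.-2)%N%:Z by rewrite h PoszM.
by rewrite PoszM; congr (_ * _); lia.
Qed.

Lemma bin2_int e : 2 * ('C(e + 2, e))%:Z = (e%:Z + 2) * (e%:Z + 1).
Proof. by have := mul2_bin2 e; lia. Qed.

(** For a product [W] of [e >= m] lines, [L(div W)] contains [C(e+2, 2) - C(e-m+2, 2) = m e + 1 -
    C(m-1, 2)] independent sections. Descending from [div W] to [D] costs at most one dimension per
    point removed. *)
Lemma riemann_inequality D k : has_dim (RR_space D) k ->
  deg D + 1 - k%:Z <= ('C(m.-1, 2))%:Z.
Proof.
move=> dk; have [us [us0 hus]] := lines_above D.
have [w w0] : exists w : 'I_3 -> K, exists i, w i != 0.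
  by exists (fun=> 1); exists 0; rewrite oner_neq0.
(* The [m] extra lines only serve to put the degree in the range [m <= e]. *)
pose vs := nseq m w ++ us.
have ns0 : forall v, List.In v (nseq m w) -> exists i, v i != 0 by move=> v /In_nseq->.
have vs0 : forall v, List.In v vs -> exists i, v i != 0 by move=> v; case/In_cat => [/ns0|/us0].
have hvs P : coeff P D <= lines_val P vs.
  rewrite lines_val_cat //; apply: le_trans (hus P) _.
  by rewrite lerDr lines_val_ge0.
set e := size vs; have me : (m <= e)%N by rewrite /e size_cat size_nseq leq_addr.
have [DW [dW oW]] := lines_divisor X hm vs0.
have hW := prod_lines_homog vs; have WI := prod_lines_notin X hm vs0.
have [N0 [b [hN ib hb]]] := independent_sections hm hW WI me.
have hb' i : RR_space DW (b i) by apply/(RR_space_forms hm _ hW WI oW).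
have E0 P : 0 <= coeff P (DW - D).
  by rewrite coeffB subr_ge0 -(val_at_eq hm (oW P)); exact: hvs.
have := deg_ge0 E0; case dE : (deg (DW - D)) => [d|//] _.
have dD : deg D = (m * e)%:Z - d%:Z by rewrite -dE degB dW opprB addrC subrK.
have key : (m * e)%:Z + 1 - N0%:Z <= ('C(m.-1, 2))%:Z.
  have := bin_genus; have := bin2_int e; have := bin2_int (e - m); have := hN.
  have -> : (e - m)%:Z = e%:Z - m%:Z by rewrite subzn.
  rewrite PoszM -lez_nat PoszD.
  move: ('C(m.-1, 2))%:Z ('C(e + 2, e))%:Z ('C(e - m + 2, e - m))%:Z => x y z.
  by clear; nia.
(* If [d] exceeds [N0] no section need survive, but then [deg D + 1] is already within the bound. *)
rewrite dD; case: (leqP d N0) => dN.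
  move: b ib hb hb'; rewrite -(subnK dN) => b ib hb hb'.
  have [b' [ib' hb2]] := drop_divisor E0 dE ib hb'.
  have := independent_le_dim dk ib'.
  have eD : DW - (DW - D) = D by rewrite opprB addrC subrK.
  rewrite eD in hb2 => /(_ hb2).
  by move: key dN; clear; lia.
by move: key dN; clear; lia.
Qed.

(** The bound is attained by [m - 2] lines: the divisor has degree [m (m - 2)], and as [m - 2 < m]
    the dimension is exactly [C(m, 2)]. *)
Lemma plane_curve_genus : is_genus X 'C(m.-1, 2).
Proof.
split; first exact: riemann_inequality.
have [w w0] : exists w : 'I_3 -> K, exists i, w i != 0.
  by exists (fun=> 1); exists 0; rewrite oner_neq0.
pose us := nseq m.-2 w.
have us0 : forall v, List.In v us -> exists i, v i != 0 by move=> v /In_nseq->.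
have [D [dD oD]] := lines_divisor X hm us0.
have hW := prod_lines_homog us; have WI := prod_lines_notin X hm us0.
have lt : (size us < m)%N by rewrite size_nseq; lia.
exists D, 'C(size us + 2, size us); split.
  by apply: (sections_has_dim hW WI lt) => f; exact: RR_space_forms.
have := bin_genus; have := bin2_int (size us); rewrite dD size_nseq PoszM.
have -> : m.-2%:Z = m%:Z - 2 by lia.
by clear; nia.
Qed.

End Genus.

(** * Tangent lines, and divisibility of a form by a line of high contact *)

Section Divisibility.
Context (K : closedFieldType) (m : nat) (X : smooth_plane_curve K m) (hm : (1 < m)%N).
Implicit Types (P Q : point X) (f g u : function_field X) (G H A : {mpoly K[3]}).
Implicit Types (D E : divisor X).
Local Notation F := (equation X).
Local Notation I := (ideal_of X).
Local Notation tofr := (to_frac X).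

Lemma cut_divisor_ord d G D : G \is d.-homog -> cut_divisor d G D ->
  forall P, ord_at P (form_at P d G) (coeff P D).
Proof.
move=> hG cD P; have [H [f [hH HP e oD]]] := cD P.
have H0 : tofr H != 0 by rewrite to_frac_eq0 (meval_notin HP).
have e1 : val f * tofr H = tofr G by rewrite e mulfVK.
rewrite -(mul_form_at P hH hG e1) -[coeff P D]addr0; apply: ord_atM => //.
by apply: ord_at_unit => //; exact: form_at_unit.
Qed.

Lemma line_coords_neq0 (l : line K) : exists i, coords l i != 0.
Proof.
have /existsP[i /andP[/eqP h _]] := valP l.
by exists i; rewrite /coords h oner_neq0.
Qed.

(** In [F = w F1 + mu F2], a nonzero [F2(P)] would make [w] a uniformizer, of order 1. So
    [F2(P) = 0] and only [F1(P) w] is left of the gradient. *)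
Lemma tangent_gradient P w (k : int) : (exists i, w i != 0) ->
  ord_at P (form_at P 1 (lin w)) k -> 1 < k ->
  exists2 c, c != 0 & forall i, (mderiv i F).@[pcoords P] = c * w i.
Proof.
move=> w0 ok k1.
have l0 := ord_at_neq0 hm ok.
have wP : dot w (pcoords P) = 0.
  rewrite -meval_lin; apply: (form_at_val0E (lin_homog w)).
  by apply/(has_value0_val hm P l0); rewrite (val_at_eq hm ok); exact: ltW.
have [B [C [la [mu fr]]]] := frame_at w0 wP.
have hF : F \is m.-1.+1.-homog by rewrite prednK ?equation_homog // ltnW.
have [F1 [F2 [h1 h2 eF]]] := vanishing_decomp fr hF (pcoords_F P).
have F20 : F2.@[pcoords P] = 0.
  apply/eqP; apply: contrapT => /negP F20.
  have un := frame_uniformizer fr (ray_pcoords P) h1 h2 eF F20.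
  have o1 : ord_at P (form_at P 1 (lin w)) 1.
    by exists (form_at P 1 (lin w)), 1; split=> //; [exact: unit_at1|rewrite mul1r expr1z].
  by move: k1; rewrite (ord_at_uniq hm ok o1).
exists F1.@[pcoords P].
  by case: (frame_smooth fr eF) => //; rewrite F20 eqxx.
have [_ [[muA _ _] _]] := frame_dual fr.
move=> i; rewrite eF mderivD !mderivM !mderiv_lin mevalD !mevalD !mevalM !mevalC !meval_lin.
by rewrite wP muA F20 mulr0 !mul0r !addr0 mulrC.
Qed.

Lemma tangent_uniq P (l l' : line K) (k k' : int) :
  ord_at P (form_at P 1 (line_form l)) k -> 1 < k ->
  ord_at P (form_at P 1 (line_form l')) k' -> 1 < k' -> l = l'.
Proof.
move=> ok k1 ok' k1'.
have [c c0 h] := tangent_gradient (line_coords_neq0 l) ok k1.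
have [c' c0' h'] := tangent_gradient (line_coords_neq0 l') ok' k1'.
apply/val_inj/(@normalized_uniq _ _ _ (c^-1 * c') (valP l) (valP l')).
  by rewrite mulf_neq0 // invr_eq0.
move=> j; have := h j; rewrite h' => e.
by rewrite -mulrA -/(coords l' j) e mulKf.
Qed.

Lemma vge_div P d e G H (k x : int) : G \is d.-homog -> H \is e.-homog ->
  ord_at P (form_at P d G) k -> vge P (k + x) (form_at P (d + e) (G * H)) ->
  vge P x (form_at P e H).
Proof.
move=> hG hH ok; rewrite form_atM //.
case: (eqVneq (form_at P e H) 0) => [->|h0] v; first exact: vge0.
have g0 := ord_at_neq0 hm ok.
apply/(vgeP hm P _ h0).
have := (vgeP hm P _ (mulf_neq0 g0 h0)).1 v.
by rewrite (val_atM hm P g0 h0) (val_at_eq hm ok) lerD2l.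
Qed.

Lemma contact_frame w P (k : nat) : (exists i, w i != 0) ->
  ord_at P (form_at P 1 (lin w)) k -> (0 < k)%N ->
  exists B C la mu, frame (pcoords P) B C la mu w.
Proof.
move=> w0 ok k0; apply: frame_at w0 _.
rewrite -meval_lin; apply: (form_at_val0E (lin_homog w)).
have l0 := ord_at_neq0 hm ok.
by apply/(has_value0_val hm P l0); rewrite (val_at_eq hm ok) lez_nat.
Qed.

Lemma contact_restriction w P B C la mu (k e d : nat) G :
  frame (pcoords P) B C la mu w ->
  ord_at P (form_at P 1 (lin w)) k -> (0 < k)%N -> (e <= k)%N ->
  G \is d.-homog -> vge P e (form_at P d G) -> 'X^e %| restriction (pcoords P) B G.
Proof.
move=> fr ok k0 ek hG vG.
have [k' [q [e1 q0]]] := restriction_factor X hm fr.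
have k0' : (0 < k')%N.
  rewrite lt0n; apply: contraNneq q0 => k00.
  by have := restriction_coef0 (pcoords P) B F; rewrite pcoords_F e1 k00 expr0 mulr1 => ->.
have [ok' _] := line_order hm fr (ray_pcoords P) e1 q0 k0'.
have [kk] := ord_at_uniq hm ok ok'; rewrite -kk in e1 k0' *.
exact: restriction_vanishing fr (ray_pcoords P) e1 q0 k0' hG ek vG.
Qed.

(** The restriction to the line has degree at most [e + 1] and is divisible by ['X^(e + 2)], so it
    is zero. *)
Lemma divides_of_contact w P (k e : nat) G : (exists i, w i != 0) ->
  ord_at P (form_at P 1 (lin w)) k -> (0 < k)%N -> (e.+2 <= k)%N ->
  G \is e.+1.-homog -> vge P e.+2 (form_at P e.+1 G) ->
  exists2 G', G' \is e.-homog & G = lin w * G'.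
Proof.
move=> w0 ok k0 ek hG vG.
have [B [C [la [mu fr]]]] := contact_frame w0 ok k0.
apply: (restriction_eq0 fr hG); have dv := contact_restriction fr ok k0 ek hG vG.
have [sz _] := restriction_coef (pcoords P) B hG.
by apply/eqP; apply: contraTT sz => r0; have := dvdp_leq r0 dv; rewrite size_polyXn -ltnNge.
Qed.

(** Here contact equals the degree, one short of what forces divisibility; the additional zero at
    [Q] supplies the missing condition. *)
Lemma divides_of_contact2 w P Q (k e : nat) (k' : int) G : (exists i, w i != 0) -> P != Q ->
  ord_at P (form_at P 1 (lin w)) k -> (0 < k)%N -> (e.+1 <= k)%N ->
  ord_at Q (form_at Q 1 (lin w)) k' -> 1 <= k' ->
  G \is e.+1.-homog -> vge P e.+1 (form_at P e.+1 G) -> vge Q 1 (form_at Q e.+1 G) ->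
  exists2 G', G' \is e.-homog & G = lin w * G'.
Proof.
move=> w0 PQ ok k0 ek ok' k1 hG vG vQ.
have [B0 [C [la0 [mu fr0]]]] := contact_frame w0 ok k0.
have wQ : dot w (pcoords Q) = 0.
  rewrite -meval_lin; apply: (form_at_val0E (lin_homog w)).
  have l0 := ord_at_neq0 hm ok'.
  by apply/(has_value0_val hm Q l0); rewrite (val_at_eq hm ok').
have GQ : G.@[pcoords Q] = 0.
  case: (eqVneq (form_at Q e.+1 G) 0) => [|g0].
    by move=> /eqP; rewrite form_at_eq0 // => /(ideal_meval Q).
  apply: (form_at_val0E hG); apply/(has_value0_val hm Q g0).
  exact: (vgeP hm Q _ g0).1 vQ.
set A := pcoords P in fr0 *; set v := pcoords Q in wQ GQ *.
have vE i : v i = dot la0 v * A i + dot mu v * B0 i.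
  by rewrite {1}(frame_coords v i fr0) wQ mul0r addr0.
have m0 : dot mu v != 0.
  apply: contraNneq PQ => m0; apply/eqP/(@ray_uniq _ _ X P Q A); first exact: ray_pcoords.
  exists (dot la0 v) => [|i]; last by rewrite -/v vE m0 mul0r addr0.
  have [i vi] := pcoords_neq0 Q; apply: contraNneq vi => l00.
  by rewrite -/v vE l00 m0 !mul0r addr0.
(* The second vector is sheared so that [Q] becomes the point at infinity; vanishing at [Q] then
   lowers the degree of the restriction by one. *)
pose s := dot la0 v / dot mu v; pose B i := B0 i + s * A i.
have fr : frame A B C (fun j => la0 j + (- s) * mu j) mu w.
  exact/frame_swapAB/frame_shear/frame_swapAB.
have vB i : v i = dot mu v * B i.
  by rewrite vE /B /s mulrDr addrC; congr (_ + _); rewrite mulrA mulrCA mulfV // mulr1.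
have GB : G.@[B] = 0.
  move: GQ; rewrite (meval_homog hG vB) => /eqP; rewrite mulf_eq0 expf_eq0 (negbTE m0) andbF.
  by move/eqP.
apply: (restriction_eq0 fr hG); have dv := contact_restriction fr ok k0 ek hG vG.
have [sz cf] := restriction_coef A B hG; rewrite GB in cf.
have sz' : (size (restriction A B G) <= e.+1)%N.
  apply/leq_sizeP => j; rewrite leq_eqVlt => /predU1P[<- //|ej].
  by rewrite nth_default // (leq_trans sz).
by apply/eqP; apply: contraTT sz' => r0; have := dvdp_leq r0 dv; rewrite size_polyXn -ltnNge.
Qed.

End Divisibility.

(** * Pure gaps *)

Section Exponents.
Context (n : nat) (hn : (2 < n)%N).

(* No [l1^u l2^v l3^w] with [u + v + w = 0] lies in [L(a P1 + b P2 + c P3)] and has a pole of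
   order exactly [a] at [P1]; the cyclic images of [(a, b, c)] handle [P2] and [P3]. *)
Definition no_extremal_monomial (a b c : nat) :=
  forall u v w : int, u + v + w = 0 -> n%:Z * v + u >= - b%:Z -> n%:Z * w + v >= - c%:Z ->
  n%:Z * u + w <> - a%:Z.

(** A pole of order exactly [a = k n + p + 1] at [P1] means [n u + w = -a], solved by [u = -k],
    [w = -p - 1]. For [p < j] the pole [n (p + 1)] this causes at [P3] is absorbed by the term [j n]
    of [c]. *)
Lemma no_extremal_lower a b c k i j p q p' :
  a = (k * n + p + 1)%N -> b = (i * n + q + 1)%N -> c = (j * n + p' + 1)%N ->
  no_extremal_monomial a b c -> (j <= p)%N.
Proof.
move=> -> -> -> h; rewrite leqNgt; apply/negP => pj.
by case: (h (- k%:Z) (k%:Z + p%:Z + 1) (- p%:Z - 1)); nia.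
Qed.

(** The next solution of [n u + w = -a] is [u = -k - 1], [w = n - 1 - p], so that
    [v = k + p + 2 - n]. If the conclusion failed, [v] would be at least [-i], and the poles at [P2]
    and [P3] would be within [b] and [c]. *)
Lemma no_extremal_upper a b c k i j p q p' :
  a = (k * n + p + 1)%N -> b = (i * n + q + 1)%N -> c = (j * n + p' + 1)%N ->
  (p < n)%N -> (j <= p)%N -> (k <= q)%N -> (i <= p')%N ->
  no_extremal_monomial a b c -> (p + i + k + 3 <= n)%N.
Proof.
move=> -> -> -> pn jp kq ip h; rewrite leqNgt; apply/negP => pj.
by case: (h (-1 - k%:Z) (k%:Z + p%:Z + 2 - n%:Z) (n%:Z - 1 - p%:Z)); nia.
Qed.

Lemma no_extremal_pos b c : ~ no_extremal_monomial 0 b c.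
Proof. by move=> h; apply: (h 0 0 0); lia. Qed.

(** The parameters [k], [i], [j] are the quotients of [a - 1], [b - 1], [c - 1] by [n]. The lower
    bounds on the remainders make [r], [s], [t] nonnegative, and the upper bounds give
    [n - 3 - d]. *)
Lemma no_extremal_parameters a b c :
  no_extremal_monomial a b c -> no_extremal_monomial b c a -> no_extremal_monomial c a b ->
  exists d i j k r s t : nat,
    [/\ [/\ (i + j + k = d)%N & (d <= n - 3)%N],
        [/\ (r <= n - 3 - d)%N, (s <= n - 3 - d)%N & (t <= n - 3 - d)%N],
        a = (k * n + j + r + 1)%N,
        b = (i * n + k + s + 1)%N
      & c = (j * n + i + t + 1)%N].
Proof.
move=> ha hb hc.
case: a ha hb hc => [/no_extremal_pos//|a] ha hb hc.
case: b ha hb hc => [|b] ha hb hc; first by case: (no_extremal_pos hb).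
case: c ha hb hc => [|c] ha hb hc; first by case: (no_extremal_pos hc).
have n0 : (0 < n)%N by lia.
have ea : a.+1 = (a %/ n * n + a %% n + 1)%N by rewrite -divn_eq addn1.
have eb : b.+1 = (b %/ n * n + b %% n + 1)%N by rewrite -divn_eq addn1.
have ec : c.+1 = (c %/ n * n + c %% n + 1)%N by rewrite -divn_eq addn1.
have la := no_extremal_lower ea eb ec ha.
have lb := no_extremal_lower eb ec ea hb.
have lc := no_extremal_lower ec ea eb hc.
have ua := no_extremal_upper ea eb ec (ltn_pmod a n0) la lb lc ha.
have ub := no_extremal_upper eb ec ea (ltn_pmod b n0) lb lc la hb.
have uc := no_extremal_upper ec ea eb (ltn_pmod c n0) lc la lb hc.
set k := (a %/ n)%N in ea la lb lc ua ub uc *; set i := (b %/ n)%N in eb la lb lc ua ub uc *.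
set j := (c %/ n)%N in ec la lb lc ua ub uc *.
exists (i + j + k)%N, i, j, k, (a %% n - j)%N, (b %% n - k)%N, (c %% n - i)%N.
move: ea eb ec la lb lc ua ub uc; clear.
move: (a %% n)%N (b %% n)%N (c %% n)%N => p q p' -> -> ->.
move: (k * n)%N (i * n)%N (j * n)%N => x y z.
by split; [split|split|..]; lia.
Qed.

(** Since [j + r], [k + s] and [i + t] are less than [n], Euclidean division recovers first [k],
    [i], [j] and then [r], [s], [t]. *)
Lemma parameters_inj i j k r s t i' j' k' r' s' t' :
  (i + j + k <= n - 3)%N -> (r <= n - 3 - (i + j + k))%N ->
  (s <= n - 3 - (i + j + k))%N -> (t <= n - 3 - (i + j + k))%N ->
  (i' + j' + k' <= n - 3)%N -> (r' <= n - 3 - (i' + j' + k'))%N ->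
  (s' <= n - 3 - (i' + j' + k'))%N -> (t' <= n - 3 - (i' + j' + k'))%N ->
  (k * n + j + r + 1 = k' * n + j' + r' + 1)%N ->
  (i * n + k + s + 1 = i' * n + k' + s' + 1)%N ->
  (j * n + i + t + 1 = j' * n + i' + t' + 1)%N ->
  [/\ i = i', j = j', k = k' & [/\ r = r', s = s' & t = t']].
Proof.
have dv x y x' y' : (x * n + y = x' * n + y')%N -> (y < n)%N -> (y' < n)%N -> x = x' /\ y = y'.
  move=> e yn yn'; have n0 : (0 < n)%N by lia.
  have xx : x = x'.
    have := congr1 (fun z => z %/ n)%N e.
    by rewrite !divnMDl // !divn_small // !addn0.
  by split=> //; apply: (@addnI (x * n)); rewrite e xx.
move=> h1 h2 h3 h4 h1' h2' h3' h4' ea eb ec.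
have [|||k1 e1] := dv k (j + r)%N k' (j' + r')%N; try lia.
have [|||i1 e2] := dv i (k + s)%N i' (k' + s')%N; try lia.
have [|||j1 e3] := dv j (i + t)%N j' (i' + t')%N; try lia.
by split=> //; split; lia.
Qed.

End Exponents.

(** * Counting the parameters *)

Section Counting.

(** By truncated subtraction and [f 0 = 0], the sum over [i < n] of [f (N - i)] is [f 1 + ... + f N]
    whenever [N <= n]; this is its recurrence in [N]. *)
Lemma sum_shift (f : nat -> nat) N n : (N < n)%N -> f 0%N = 0%N ->
  (\sum_(i < n) f (N.+1 - i) = f N.+1 + \sum_(i < n) f (N - i))%N.
Proof.
case: n => // n Nn f0; rewrite big_ord_recl subn0; congr (_ + _)%N.
rewrite [RHS]big_ord_recr /= (_ : N - n = 0)%N ?f0 ?addn0; last by lia.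
by apply: eq_bigr => i _; rewrite subSS.
Qed.

Lemma sum_closed_form (f : nat -> nat) (g G : rat -> rat) n :
  (forall N, (N <= n)%N -> (f N)%:R = g N%:R) -> f 0%N = 0%N -> G 0 = 0 ->
  (forall x, G (x + 1) = G x + g (x + 1)) ->
  forall N, (N <= n)%N -> (\sum_(i < n) f (N - i))%:R = G N%:R.
Proof.
move=> fg f0 G0 GS; elim=> [|N IH] Nn.
  by rewrite big1 ?G0 // => i _; rewrite sub0n.
rewrite sum_shift // natrD fg // IH; last exact: ltnW.
by rewrite -natr1 GS addrC.
Qed.

Lemma sum_cubes n : (2 < n)%N ->
  (\sum_(i < n) \sum_(j < n) \sum_(k < n) (n - 2 - i - j - k) ^ 3)%:R =
  (n%:R - 2) * (n%:R - 1) * n%:R * (n%:R + 1) * (n%:R ^+ 2 - n%:R - 1) / 120%:R :> rat.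
Proof.
move=> hn.
(* Each polynomial is the discrete primitive of the previous one, vanishing at 0; the last is
   evaluated at [n - 2]. *)
pose g1 (x : rat) := x ^+ 3.
pose g2 (x : rat) := x ^+ 2 * (x + 1) ^+ 2 / 4%:R.
pose g3 (x : rat) := x * (x + 1) * (x + 2) * (3%:R * x ^+ 2 + 6%:R * x + 1) / 60%:R.
pose g4 (x : rat) := x * (x + 1) * (x + 2) * (x + 3%:R) * (x ^+ 2 + 3%:R * x + 1) / 120%:R.
have h1 N : (N <= n)%N -> (N ^ 3)%:R = g1 N%:R by rewrite natrX.
have h2 : forall N, (N <= n)%N -> (\sum_(k < n) (N - k) ^ 3)%:R = g2 N%:R.
  apply: (@sum_closed_form (fun N => N ^ 3)%N g1) => // x.
  by rewrite /g2 /g1; field.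
have h3 : forall N, (N <= n)%N -> (\sum_(j < n) \sum_(k < n) (N - j - k) ^ 3)%:R = g3 N%:R.
  apply: (@sum_closed_form (fun N => \sum_(k < n) (N - k) ^ 3)%N g2) => //.
  - by rewrite big1 // => k _; rewrite sub0n.
  - by move=> x; rewrite /g3 /g2; field.
have h4 : forall N, (N <= n)%N ->
    (\sum_(i < n) \sum_(j < n) \sum_(k < n) (N - i - j - k) ^ 3)%:R = g4 N%:R.
  apply: (@sum_closed_form (fun N => \sum_(j < n) \sum_(k < n) (N - j - k) ^ 3)%N g3) => //.
  - by rewrite big1 // => j _; rewrite big1 // => k _; rewrite !sub0n.
  - by move=> x; rewrite /g4 /g3; field.
rewrite h4 ?leq_subr // natrB; last exact: ltnW.
by rewrite /g4; field.
Qed.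

End Counting.

Section CountParameters.
Context (n : nat) (hn : (2 < n)%N).

(** With truncated subtraction, [r < n - 2 - i - j - k] encodes both [i + j + k <= n - 3] and
    [r <= n - 3 - d]. All six parameters are then below [n]. *)
Definition admissible (x : 'I_n * ('I_n * 'I_n) * ('I_n * ('I_n * 'I_n))) : bool :=
  let: ((i, (j, k)), (r, (s, t))) := x in
  [&& (r < n - 2 - i - j - k)%N, (s < n - 2 - i - j - k)%N & (t < n - 2 - i - j - k)%N].

Lemma card_ord_lt (N : nat) : (N <= n)%N -> (\sum_(r < n) (r < N) = N)%N.
Proof.
move=> Nn; have := @big_ord_widen _ 0%N addn N n (fun=> 1%N) Nn.
rewrite sum1_card card_ord => e; rewrite [RHS]e [RHS]big_mkcond.
by apply: eq_bigr => r _; case: ltnP.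
Qed.

Lemma sum_pair (I J : finType) (f : I * J -> nat) :
  (\sum_p f p = \sum_i \sum_j f (i, j))%N.
Proof. by rewrite pair_bigA; apply: eq_bigr => -[]. Qed.

Lemma card_admissible :
  (#|admissible| = \sum_(i < n) \sum_(j < n) \sum_(k < n) (n - 2 - i - j - k) ^ 3)%N.
Proof.
rewrite -sum1_card big_mkcond /=.
rewrite sum_pair sum_pair; apply: eq_bigr => i _.
rewrite sum_pair; apply: eq_bigr => j _; apply: eq_bigr => k _.
set M := (n - 2 - i - j - k)%N; have Mn : (M <= n)%N by rewrite /M; lia.
rewrite sum_pair.
transitivity (\sum_(r < n) (r < M) * (M * M))%N.
  apply: eq_bigr => r _.
  rewrite sum_pair.
  transitivity (\sum_(s < n) (s < M) * ((r < M) * M))%N.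
    apply: eq_bigr => s _.
    transitivity (\sum_(t < n) (t < M) * ((s < M) * (r < M)))%N.
      apply: eq_bigr => t _; rewrite unfold_in /= -/M.
      by case: (r < M)%N; case: (s < M)%N; case: (t < M)%N.
    by rewrite -big_distrl /= card_ord_lt // mulnC -mulnA.
  by rewrite -big_distrl /= card_ord_lt // mulnCA.
by rewrite -big_distrl /= card_ord_lt // !expnS expn0 muln1.
Qed.

End CountParameters.

(** * The triangle of the three lines *)

Section Configuration.
Context (K : closedFieldType) (n : nat) (hn : (2 < n)%N) (X : smooth_plane_curve K (n + 1)).
Context (P1 P2 P3 : point X) (l1 l2 l3 : line K) (hl : uniq [:: l1; l2; l3]).
Context (hl1 : line_cuts l1 (<<P1>> *+ n + <<P2>> : divisor X)).
Context (hl2 : line_cuts l2 (<<P2>> *+ n + <<P3>> : divisor X)).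
Context (hl3 : line_cuts l3 (<<P3>> *+ n + <<P1>> : divisor X)).
Implicit Types (R : point X) (f : function_field X) (D : divisor X).
Local Notation I := (ideal_of X).
Local Notation tofr := (to_frac X).
Local Notation L1 := (line_form l1).
Local Notation L2 := (line_form l2).
Local Notation L3 := (line_form l3).

Let hm : (1 < n + 1)%N. Proof. by rewrite addn1 ltnS ltnW // ltnW. Qed.

Lemma line_form_homog (l : line K) : line_form l \is 1.-homog.
Proof. exact: lin_homog. Qed.

Lemma line_form_notin (l : line K) : line_form l \notin I.
Proof. exact: (line_notin X hm (line_coords_neq0 l)). Qed.

Lemma flex_ord (l : line K) (P Q R : point X) :
  line_cuts l (<<P>> *+ n + <<Q>> : divisor X) ->
  ord_at R (form_at R 1 (line_form l)) (n%:Z * (P == R)%:Z + (Q == R)%:Z).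
Proof.
move=> h; have := cut_divisor_ord hm (line_form_homog l) h R.
by rewrite coeffD coeffMn !coeffU !mul1r -[_ *+ n]mulr_natl !natz.
Qed.

Let o1 R := flex_ord R hl1.
Let o2 R := flex_ord R hl2.
Let o3 R := flex_ord R hl3.

(** If two of the points coincided, two of the lines would have order at least [n > 1] at the common
    point, hence be the same tangent. *)
Lemma flex_points_neq : [/\ P1 != P2, P2 != P3 & P1 != P3].
Proof.
have n1 : 1 < n%:Z by rewrite ltz_nat ltnW.
move: hl; rewrite /= !inE negb_or => /and3P[/andP[l12 l13] l23 _].
split.
- apply: contraNneq l12 => e; apply/eqP.
  apply: (tangent_uniq hm (o1 P1) _ (o2 P1) _); rewrite -?e ?eqxx /= ?mulr1; lia.
- apply: contraNneq l23 => e; apply/eqP.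
  apply: (tangent_uniq hm (o2 P2) _ (o3 P2) _); rewrite -?e ?eqxx /= ?mulr1; lia.
- apply: contraNneq l13 => e; apply/eqP.
  apply: (tangent_uniq hm (o1 P1) _ (o3 P1) _); rewrite -?e ?eqxx /= ?mulr1; lia.
Qed.

(** Distinctness in arithmetic form: claims at an arbitrary [R] reduce to a case split on three
    booleans and linear arithmetic. *)
Lemma flex_points_disjoint R : ((P1 == R) + (P2 == R) + (P3 == R) <= 1)%N.
Proof.
have [n12 n23 n13] := flex_points_neq.
case: (eqVneq P1 R) => [<-|_].
  by rewrite (eq_sym P2) (negbTE n12) (eq_sym P3) (negbTE n13).
case: (eqVneq P2 R) => [<-|_]; last by case: eqP.
by rewrite (eq_sym P3) (negbTE n23).
Qed.

Lemma ord_form_exp R G (x : int) k : G \is 1.-homog -> ord_at R (form_at R 1 G) x ->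
  ord_at R (form_at R k (G ^+ k)) (k%:Z * x).
Proof.
move=> hG ox; elim: k => [|k IH].
  by rewrite expr0 form_at1 mul0r; exact/(ord_at_unit hm)/unit_at1.
rewrite exprS -(add1n k) form_atM //; last by have := dhomogMn k hG; rewrite mul1n.
by rewrite PoszD mulrDl mul1r; exact: ord_atM.
Qed.

Lemma vge_le R (k l : int) f : k <= l -> vge R l f -> vge R k f.
Proof.
move=> kl; case: (eqVneq f 0) => [->|f0] h; first exact: vge0.
by apply/(vgeP hm R k f0); apply: le_trans kl ((vgeP hm R l f0).1 h).
Qed.

Lemma vge_div_line (l : line K) R e H (k x y : int) : H \is e.-homog ->
  ord_at R (form_at R 1 (line_form l)) k -> k + x <= y ->
  vge R y (form_at R e.+1 (line_form l * H)) -> vge R x (form_at R e H).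
Proof.
move=> hH ok kxy v; apply: (vge_div hm (line_form_homog l) hH ok).
by rewrite add1n; exact: vge_le kxy v.
Qed.

(** The exponents are placed so that the orders at [P1], [P2], [P3] are [k n + j], [i n + k] and
    [j n + i], the parts of [a], [b], [c] that do not involve [r], [s], [t]. *)
Definition triangle_monomial (i j k : nat) : {mpoly K[3]} := L1 ^+ k * (L2 ^+ i * L3 ^+ j).

Lemma triangle_monomial_homog i j k : triangle_monomial i j k \is (k + (i + j)).-homog.
Proof.
have h (l : line K) e : line_form l ^+ e \is e.-homog.
  by have := dhomogMn e (line_form_homog l); rewrite mul1n.
by do 2!apply: dhomogM => //.
Qed.

Lemma triangle_monomial_notin i j k : triangle_monomial i j k \notin I.
Proof.
have h (l : line K) e : line_form l ^+ e \notin I.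
  elim: e => [|e IH]; first by rewrite expr0 (equation_proper X).
  by rewrite exprS notinM // line_form_notin.
by rewrite /triangle_monomial !notinM.
Qed.

Lemma triangle_monomial_ord i j k R :
  ord_at R (form_at R (k + (i + j)) (triangle_monomial i j k))
    ((k * n + j)%N%:Z * (P1 == R)%:Z + (i * n + k)%N%:Z * (P2 == R)%:Z
     + (j * n + i)%N%:Z * (P3 == R)%:Z).
Proof.
have h (l : line K) e : line_form l ^+ e \is e.-homog.
  by have := dhomogMn e (line_form_homog l); rewrite mul1n.
rewrite /triangle_monomial form_atM ?dhomogM // form_atM //.
have oo := ord_atM hm (ord_form_exp k (line_form_homog l1) (o1 R))
  (ord_atM hm (ord_form_exp i (line_form_homog l2) (o2 R)) (ord_form_exp j (line_form_homog l3) (o3 R))).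
move: oo; set x := (X in ord_at _ _ X -> _); set y := (X in _ -> ord_at _ _ X).
suff -> : x = y by [].
rewrite /x /y !PoszD !PoszM; move: (P1 == R)%:Z (P2 == R)%:Z (P3 == R)%:Z => a b c; ring.
Qed.

(** The coefficients omit the final 1 of [a], [b], [c] and the range extends to [n - 2 - d]: one
    statement then covers the divisor of a gap, the same divisor minus one point, and minus all
    three. *)
Lemma gap_space i j k r s t D : (i + j + k <= n - 3)%N ->
  (r <= n - 2 - (i + j + k))%N -> (s <= n - 2 - (i + j + k))%N -> (t <= n - 2 - (i + j + k))%N ->
  (forall R, coeff R D = (k * n + j + r)%N%:Z * (P1 == R)%:Z + (i * n + k + s)%N%:Z * (P2 == R)%:Z
     + (j * n + i + t)%N%:Z * (P3 == R)%:Z) ->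
  has_dim (RR_space D) 'C(i + j + k + 2, i + j + k).
Proof.
move=> dn rn sn tn cD; have dE : (i + j + k = k + (i + j))%N by rewrite addnC.
rewrite dE in dn rn sn tn *; set d := (k + (i + j))%N in dn rn sn tn *.
have hW := triangle_monomial_homog i j k; rewrite -/d in hW.
have WI := triangle_monomial_notin i j k.
set W := triangle_monomial i j k in hW WI.
have oW R := triangle_monomial_ord i j k R; rewrite -/d -/W in oW.
have dm : (d < n + 1)%N by clear -dn; lia.
apply: (sections_has_dim hW WI dm) => f; rewrite (RR_spaceP hm).
split=> [hf|[A hA eA] R]; last first.
  apply: (vge_le (l := - ((k * n + j)%N%:Z * (P1 == R)%:Z + (i * n + k)%N%:Z * (P2 == R)%:Z
     + (j * n + i)%N%:Z * (P3 == R)%:Z))).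
    rewrite lerN2 cD; move: (flex_points_disjoint R).
    by case: (P1 == R); case: (P2 == R); case: (P3 == R); clear; lia.
  apply/(vge_mul hm f (oW R)); rewrite (mul_form_at R hW hA eA); exact: form_at_reg.
(* The factor [T] has order [n + 1] at each of the three points, so that [f W T] keeps order at
   least [n + 1 - (n - 2 - d) = d + 3] there, which is its degree. *)
pose T := L1 * (L2 * L3).
have h1 := line_form_homog l1; have h2 := line_form_homog l2; have h3 := line_form_homog l3.
have hT : T \is (1 + (1 + 1)).-homog by rewrite !dhomogM.
have hWT := dhomogM hW hT.
have oT R : ord_at R (form_at R (1 + (1 + 1)) T) ((n + 1)%N%:Z * ((P1 == R) + (P2 == R) + (P3 == R))%N%:Z).
  have := ord_atM hm (o1 R) (ord_atM hm (o2 R) (o3 R)); rewrite -!form_atM ?dhomogM //.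
  set x := (X in ord_at _ _ X -> _); set y := (X in _ -> ord_at _ _ X).
  suff -> : x = y by [].
  by rewrite /x /y !PoszD; move: (P1 == R)%:Z (P2 == R)%:Z (P3 == R)%:Z => a b c; ring.
have oWT R := ord_atM hm (oW R) (oT R).
have vWT R : vge R ((d + 3)%N%:Z * ((P1 == R) + (P2 == R) + (P3 == R))%N%:Z)
    (f * form_at R (d + (1 + (1 + 1))) (W * T)).
  case: (eqVneq f 0) => [->|f0]; first by rewrite mul0r; exact: vge0.
  rewrite form_atM //; have g0 := ord_at_neq0 hm (oWT R).
  apply/(vgeP hm R _ (mulf_neq0 f0 g0)); rewrite (val_atM hm R f0 g0) (val_at_eq hm (oWT R)).
  have := (vgeP hm R _ f0).1 (hf R); rewrite cD; move: (flex_points_disjoint R) rn sn tn dn hn.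
  move: (val_at R f); case: (P1 == R); case: (P2 == R); case: (P3 == R) => //; clear; lia.
have [|A hA eA] := regular_section hm (f := f) hWT.
  move=> R; have := vge_le (k := 0) _ (vWT R); rewrite /vge oppr0 expr0z mulr1; apply.
  by rewrite mulr_ge0.
have e3 : (d + (1 + (1 + 1)) = d.+3)%N by rewrite !addnS addn0.
have vA R : vge R (d.+3%:Z * ((P1 == R) + (P2 == R) + (P3 == R))%N%:Z) (form_at R d.+3 A).
  by have := vWT R; rewrite (mul_form_at R hWT hA eA) e3 ?addn3.
rewrite e3 in hA.
have [n12 n23 n13] := flex_points_neq.
have := vA P1; have := vA P2; have := vA P3; rewrite !eqxx.
rewrite (eq_sym P2 P1) (eq_sym P3 P1) (eq_sym P3 P2) (negbTE n12) (negbTE n13) (negbTE n23) /= !mulr1.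
move=> v3 v2 v1.
have := o1 P1; have := o1 P2; have := o1 P3; have := o2 P2; have := o2 P3; have := o3 P3.
rewrite !eqxx (eq_sym P2 P1) (eq_sym P3 P2) (negbTE n12) (negbTE n13) (negbTE n23) /=.
rewrite !mulr1 !mulr0 !add0r !addr0 => o33 o23 o22 o13 o12 o11.
have n0 : (0 < n)%N by clear -hn; lia.
have dn3 : (d.+3 <= n)%N by clear -dn hn; lia.
(* Removing [l1] lowers the guaranteed order at [P2] to [d + 2], again equal to the degree, but
   leaves [d + 3] at [P3], where [l1] does not pass. *)
have [A1 hA1 eA1] := divides_of_contact2 hm (line_coords_neq0 l1) n12 o11 n0 dn3 o12 (lexx _) hA v1
  (vge_le (isT : 1 <= d.+3%:Z) v2).
rewrite eA1 in v2 v3.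
have v3' := vge_div_line hA1 o13 (lexx _ : 0 + d.+3%:Z <= d.+3%:Z) v3.
have v2' := vge_div_line hA1 o12 (lexx _ : 1 + d.+2%:Z <= d.+3%:Z) v2.
have dn2 : (d.+2 <= n)%N by exact: ltnW.
have [A2 hA2 eA2] := divides_of_contact2 hm (line_coords_neq0 l2) n23 o22 n0 dn2 o23 (lexx _) hA1 v2'
  (vge_le (isT : 1 <= d.+3%:Z) v3').
rewrite eA2 in v3'.
have v3'' := vge_div_line hA2 o23 (lexx _ : 1 + d.+2%:Z <= d.+3%:Z) v3'.
(* Now the order [d + 2] at [P3] exceeds the degree [d + 1], so this contact alone suffices for
   [l3]. *)
have [A3 hA3 eA3] := divides_of_contact hm (line_coords_neq0 l3) o33 n0 dn2 hA2 v3''.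
exists A3 => //.
have T0 : tofr T != 0 by rewrite to_frac_eq0 /T !notinM ?line_form_notin.
apply: (mulIf T0); rewrite -mulrA -to_fracM eA eA1 eA2 eA3 -to_fracM.
by congr (tofr _); rewrite /T -!/(line_form _) [A3 * _]mulrC -!mulrA.
Qed.

Lemma coeff_point_divisor a b c R :
  coeff R (point_divisor [tuple P1; P2; P3] [tuple a; b; c]) =
  a%:Z * (P1 == R)%:Z + b%:Z * (P2 == R)%:Z + c%:Z * (P3 == R)%:Z.
Proof.
rewrite /point_divisor !big_ord_recl big_ord0 addr0 !coeffD !coeffMn !(tnth_nth P1) !(tnth_nth 0%N) /=.
by rewrite !coeffU !mul1r -[_ *+ a]mulr_natl -[_ *+ b]mulr_natl -[_ *+ c]mulr_natl !natz addrA.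
Qed.

(** The function [l1^u l2^v l3^w] with [w = - u - v], written as a product of degree-0 quotients. *)
Definition laurent_monomial (u v : int) : function_field X := ffrac X L1 L3 ^ u * ffrac X L2 L3 ^ v.

Lemma laurent_monomial_ord u v w R : u + v + w = 0 ->
  ord_at R (laurent_monomial u v)
    ((n%:Z * u + w) * (P1 == R)%:Z + (n%:Z * v + u) * (P2 == R)%:Z + (n%:Z * w + v) * (P3 == R)%:Z).
Proof.
move=> uvw.
have h (l : line K) (x : int) : ord_at R (form_at R 1 (line_form l)) x ->
    ord_at R (ffrac X (line_form l) L3) (x - (n%:Z * (P3 == R)%:Z + (P1 == R)%:Z)).
  move=> ox; rewrite (ffrac_form_at R (line_form_homog l) (line_form_homog l3) (line_form_notin l3)).
  by apply: (ord_atM hm ox); apply: ord_atV => //; exact: o3.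
have hz f (x z : int) : ord_at R f x -> ord_at R (f ^ z) (z * x).
  move=> ox; have f0 := ord_at_neq0 hm ox; rewrite -(val_at_eq hm ox) -(val_atXz hm R z f0).
  by apply: (val_atP hm); exact: expfz_neq0.
have := ord_atM hm (hz _ _ u (h _ _ (o1 R))) (hz _ _ v (h _ _ (o2 R))).
set x := (X in ord_at _ _ X -> _); set y := (X in _ -> ord_at _ _ X).
suff -> : x = y by [].
rewrite /x /y; have -> : w = - u - v by rewrite -[RHS]add0r -uvw; ring.
by move: (P1 == R)%:Z (P2 == R)%:Z (P3 == R)%:Z => a b c; ring.
Qed.

Lemma laurent_monomial_RR u v w (a b c : int) D : u + v + w = 0 ->
  (forall R, coeff R D = a * (P1 == R)%:Z + b * (P2 == R)%:Z + c * (P3 == R)%:Z) ->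
  RR_space D (laurent_monomial u v) <->
  [/\ - a <= n%:Z * u + w, - b <= n%:Z * v + u & - c <= n%:Z * w + v].
Proof.
move=> uvw cD; have oM R := laurent_monomial_ord R uvw; have M0 := ord_at_neq0 hm (oM P1).
have [n12 n23 n13] := flex_points_neq.
rewrite (RR_spaceP hm); split=> [h|[ha hb hc] R].
  have h' R := (vgeP hm R _ M0).1 (h R).
  have := h' P1; have := h' P2; have := h' P3.
  rewrite !cD !(val_at_eq hm (oM _)) !eqxx (eq_sym P2 P1) (eq_sym P3 P1) (eq_sym P3 P2).
  rewrite (negbTE n12) (negbTE n13) (negbTE n23) /= !mulr0 !mulr1 !addr0 !add0r.
  by split.
apply/(vgeP hm R _ M0); rewrite (val_at_eq hm (oM R)) cD.
have := flex_points_disjoint R; move: ha hb hc.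
move: (n%:Z * u + w) (n%:Z * v + u) (n%:Z * w + v) => x y z.
by case: (P1 == R); case: (P2 == R); case: (P3 == R) => //=; clear; lia.
Qed.

Local Notation Q := [tuple P1; P2; P3].

Lemma coeff_point_divisorB a b c (j : 'I_3) R :
  coeff R (point_divisor Q [tuple a; b; c] - <<tnth Q j>>) =
  (a%:Z - (j == 0 :> nat)%:Z) * (P1 == R)%:Z + (b%:Z - (j == 1%N :> nat)%:Z) * (P2 == R)%:Z
  + (c%:Z - (j == 2%N :> nat)%:Z) * (P3 == R)%:Z.
Proof.
rewrite coeffB coeff_point_divisor coeffU mul1r natz (tnth_nth P1).
case: j => [[|[|[|//]]] ?] /=;
  move: (P1 == R)%:Z (P2 == R)%:Z (P3 == R)%:Z => x y z; ring.
Qed.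

(** Equal dimensions make [L(D)] and [L(D - Pj)] equal, so a monomial in [L(D)] cannot have a pole
    of the full order at any of the points. *)
Lemma pure_gap_interior a b c (u v w : int) : pure_gap Q [tuple a; b; c] -> u + v + w = 0 ->
  - a%:Z <= n%:Z * u + w -> - b%:Z <= n%:Z * v + u -> - c%:Z <= n%:Z * w + v ->
  [/\ n%:Z * u + w <> - a%:Z, n%:Z * v + u <> - b%:Z & n%:Z * w + v <> - c%:Z].
Proof.
move=> pg uvw ha hb hc.
have M := (laurent_monomial_RR uvw (coeff_point_divisor a b c)).2 (And3 ha hb hc).
have sub j f : RR_space (point_divisor Q [tuple a; b; c] - <<tnth Q j>>) f ->
    RR_space (point_divisor Q [tuple a; b; c]) f.
  rewrite !(RR_spaceP hm) => h R; apply: vge_le (h R); rewrite lerN2 coeffB coeffU mul1r.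
  by rewrite gerBl ler0n.
have Mj (j : 'I_3) : [/\ - (a%:Z - (j == 0 :> nat)%:Z) <= n%:Z * u + w,
    - (b%:Z - (j == 1%N :> nat)%:Z) <= n%:Z * v + u & - (c%:Z - (j == 2%N :> nat)%:Z) <= n%:Z * w + v].
  have [k d1 d2] := pg j; apply: (laurent_monomial_RR uvw (coeff_point_divisorB a b c j)).1.
  exact: same_dim_sub d1 d2 (@sub j) _ M.
have [x1 _ _] := Mj (Ordinal (isT : (0 < 3)%N)); have [_ x2 _] := Mj (Ordinal (isT : (1 < 3)%N)).
have [_ _ x3] := Mj (Ordinal (isT : (2 < 3)%N)).
move: x1 x2 x3 => /=; move: (n%:Z * u + w) (n%:Z * v + u) (n%:Z * w + v) => x y z; clear.
by split; lia.
Qed.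

(** The configuration is cyclically symmetric: rotating the exponents along with the points yields
    the hypotheses at [P2] and [P3] from the same monomials. *)
Lemma pure_gap_parameters a b c : pure_gap Q [tuple a; b; c] ->
  exists d i j k r s t : nat,
    [/\ [/\ (i + j + k = d)%N & (d <= n - 3)%N],
        [/\ (r <= n - 3 - d)%N, (s <= n - 3 - d)%N & (t <= n - 3 - d)%N],
        a = (k * n + j + r + 1)%N,
        b = (i * n + k + s + 1)%N
      & c = (j * n + i + t + 1)%N].
Proof.
move=> pg; apply: no_extremal_parameters => //.
- move=> u v w e hb hc; case: (lerP (- a%:Z) (n%:Z * u + w)) => [ha|/[swap]->]; last by rewrite ltxx.
  by case: (pure_gap_interior pg e ha hb hc).
- move=> u v w e hc ha; case: (lerP (- b%:Z) (n%:Z * u + w)) => [hb|/[swap]->]; last by rewrite ltxx.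
  have e' : w + u + v = 0 by rewrite -e; ring.
  by case: (pure_gap_interior pg e' ha hb hc).
- move=> u v w e ha hb; case: (lerP (- c%:Z) (n%:Z * u + w)) => [hc|/[swap]->]; last by rewrite ltxx.
  have e' : v + w + u = 0 by rewrite -e; ring.
  by case: (pure_gap_interior pg e' ha hb hc).
Qed.

(** All the divisors involved fall under [gap_space], with each of [r], [s], [t] increased by 1
    unless the corresponding point has been removed; the dimension depends on [d] only. *)
Lemma parameters_space i j k r s t : (i + j + k <= n - 3)%N ->
  (r <= n - 3 - (i + j + k))%N -> (s <= n - 3 - (i + j + k))%N -> (t <= n - 3 - (i + j + k))%N ->
  let a := (k * n + j + r + 1)%N in let b := (i * n + k + s + 1)%N in
  let c := (j * n + i + t + 1)%N in
  [/\ has_dim (RR_space (point_divisor Q [tuple a; b; c])) 'C(i + j + k + 2, i + j + k),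
      has_dim (RR_space (point_divisor Q [tuple (a - 1)%N; (b - 1)%N; (c - 1)%N]))
        'C(i + j + k + 2, i + j + k)
    & pure_gap Q [tuple a; b; c]].
Proof.
move=> dn rn sn tn a b c.
have le1 x : (x <= n - 3 - (i + j + k))%N -> (x <= n - 2 - (i + j + k))%N /\ (x + 1 <= n - 2 - (i + j + k))%N.
  by clear -dn hn; lia.
have [r0 r1] := le1 _ rn; have [s0 s1] := le1 _ sn; have [t0 t1] := le1 _ tn.
have da : has_dim (RR_space (point_divisor Q [tuple a; b; c])) 'C(i + j + k + 2, i + j + k).
  by apply: (gap_space dn r1 s1 t1) => R; rewrite coeff_point_divisor /a /b /c !addnA.
split=> //.
  by apply: (gap_space dn r0 s0 t0) => R; rewrite coeff_point_divisor /a /b /c !addnK.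
move=> x; exists 'C(i + j + k + 2, i + j + k) => //.
have cB R := coeff_point_divisorB a b c x R.
have e (y z : nat) (q : bool) : (y + z + 1)%N%:Z - q%:Z = (y + (z + ~~ q))%N%:Z.
  by case: q; rewrite /= !PoszD; ring.
case: x cB => [[|[|[|//]]] ?] cB.
- apply: (gap_space dn r0 s1 t1) => R; rewrite cB /a /b /c !e /= ?addn0 //.
- apply: (gap_space dn r1 s0 t1) => R; rewrite cB /a /b /c !e /= ?addn0 //.
- apply: (gap_space dn r1 s1 t0) => R; rewrite cB /a /b /c !e /= ?addn0 //.
Qed.

Definition gap_of (x : 'I_n * ('I_n * 'I_n) * ('I_n * ('I_n * 'I_n))) : 3.-tuple nat :=
  let: ((i, (j, k)), (r, (s, t))) := x in
  [tuple (k * n + j + r + 1)%N; (i * n + k + s + 1)%N; (j * n + i + t + 1)%N].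

Lemma pure_gap_card : has_card (fun a : 3.-tuple nat => pure_gap Q a) #|@admissible n|.
Proof.
exists [seq gap_of x | x <- enum (@admissible n)]; split.
- rewrite map_inj_in_uniq ?enum_uniq // => -[[i [j k]] [r [s t]]] [[i' [j' k']] [r' [s' t']]].
  rewrite !mem_enum !unfold_in /= => /and3P[h1 h2 h3] /and3P[h1' h2' h3'] /(congr1 val) /= [ea eb ec].
  have [||||||||ei ej ek [er es et]] := parameters_inj hn _ _ _ _ _ _ _ _ ea eb ec;
    try by clear -hn h1 h2 h3 h1' h2' h3'; lia.
  by rewrite (val_inj ei) (val_inj ej) (val_inj ek) (val_inj er) (val_inj es) (val_inj et).
- move=> x; split=> [/mapP[[[i [j k]] [r [s t]]]]|].
    rewrite mem_enum unfold_in /= => /and3P[h1 h2 h3] ->.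
    have [||||_ _ //] := @parameters_space i j k r s t; clear -hn h1 h2 h3; lia.
  case/tupleP: x => a x; case/tupleP: x => b x; case/tupleP: x => c x; rewrite (tuple0 x) => pg.
  have [|d [i [j [k [r [s [t [[dE dn] [rn sn tn] ea eb ec]]]]]]]] := @pure_gap_parameters a b c.
    by move: pg; congr pure_gap; apply: val_inj.
  have [i0 j0 k0 r0 [s0 t0]] : [/\ i < n, j < n, k < n, r < n & s < n /\ t < n]%N.
    by do !split; clear -dE dn rn sn tn hn; lia.
  apply/mapP; exists ((Ordinal i0, (Ordinal j0, Ordinal k0)), (Ordinal r0, (Ordinal s0, Ordinal t0))).
    by rewrite mem_enum unfold_in /=; apply/and3P; split; clear -dE dn rn sn tn hn; lia.
  by apply: val_inj; rewrite /= ea eb ec.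
- by rewrite size_map -cardE.
Qed.

End Configuration.

Theorem theorem1p2 (K : closedFieldType) (n : nat) (hn : (3 < n + 1)%N)
    (X : smooth_plane_curve K (n + 1)) (P1 P2 P3 : point X) (l1 l2 l3 : line K)
    (hl : uniq [:: l1; l2; l3])
    (hl1 : line_cuts l1 (<<P1>> *+ n + <<P2>> : divisor X))
    (hl2 : line_cuts l2 (<<P2>> *+ n + <<P3>> : divisor X))
    (hl3 : line_cuts l3 (<<P3>> *+ n + <<P1>> : divisor X)) :
  let Q := [tuple P1; P2; P3] in
  let parametrized (d a b c : nat) : Prop :=
    exists i j k r s t : nat,
      [/\ [/\ (i + j + k = d)%N & (d <= n - 3)%N],
          [/\ (r <= n - 3 - d)%N, (s <= n - 3 - d)%N & (t <= n - 3 - d)%N],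
          a = (k * n + j + r + 1)%N,
          b = (i * n + k + s + 1)%N
        & c = (j * n + i + t + 1)%N] in
  [/\ forall a b c : nat,
        pure_gap Q [tuple a; b; c] <-> exists d : nat, parametrized d a b c,
      forall d a b c : nat, parametrized d a b c ->
        has_dim (RR_space (point_divisor Q [tuple a; b; c]))
                ((d + 1) * (d + 2) %/ 2)%N /\
        has_dim (RR_space (point_divisor Q [tuple (a - 1)%N; (b - 1)%N; (c - 1)%N]))
                ((d + 1) * (d + 2) %/ 2)%N
    & exists2 g : nat, is_genus X g &
        exists2 N : nat,
          has_card (fun a : 3.-tuple nat => pure_gap Q a) N &
          N%:R = 30%:R^-1 * (g%:R - 1) * g%:R * (2%:R * g%:R - 1) :> rat].
Proof.
move=> Q parametrized; have hn2 : (2 < n)%N by rewrite addn1 ltnS in hn.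
have hm : (1 < n + 1)%N by rewrite addn1 ltnS ltnW // ltnW.
have space d a b c : parametrized d a b c ->
    [/\ has_dim (RR_space (point_divisor Q [tuple a; b; c])) ((d + 1) * (d + 2) %/ 2)%N,
        has_dim (RR_space (point_divisor Q [tuple (a - 1)%N; (b - 1)%N; (c - 1)%N]))
                ((d + 1) * (d + 2) %/ 2)%N
      & pure_gap Q [tuple a; b; c]].
  case=> i [j [k [r [s [t [[<- dn] [rn sn tn] -> -> ->]]]]]].
  have -> : ((i + j + k + 1) * (i + j + k + 2) %/ 2 = 'C(i + j + k + 2, i + j + k))%N.
    by rewrite mulnC -mul2_bin2 mulKn.
  exact: (parameters_space hn2 hl hl1 hl2 hl3 dn rn sn tn).
split=> [a b c|d a b c /space[] //|].
  split=> [pg|[d /space[] //]].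
  exact: (pure_gap_parameters hn2 hl hl1 hl2 hl3 pg).
exists 'C((n + 1).-1, 2); first exact: plane_curve_genus.
exists #|@admissible n|; first exact: (pure_gap_card hn2 hl hl1 hl2 hl3).
rewrite card_admissible // sum_cubes //.
(* With [g = n (n - 1) / 2] one has [2 (g - 1) = (n - 2)(n + 1)] and [2 g - 1 = n^2 - n - 1], which
   matches the closed form of the sum of cubes. *)
have e : 2 * ('C((n + 1).-1, 2))%:R = n%:R * (n%:R - 1) :> rat.
  have := mul_bin_diag n 1; rewrite bin1 addn1 /= => h.
  rewrite -[2]/(2%:R) -natrM -h natrM; congr (_ * _).
  by rewrite -subn1 natrB // ltnW // ltnW.
have -> : ('C((n + 1).-1, 2))%:R = n%:R * (n%:R - 1) / 2 :> rat.
  by rewrite -e mulrC mulKf.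
by field.
Qed.
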